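(* Let $a<b$, $T>0$, $\mu\in\mathbb{R}$, and let $(u,\theta)$ be a solution, in the sense defined in the context, of $$u_{tt}-u_{xx}=\mu\theta_x,\qquad \theta_t-\theta_{xx}=\mu\theta u_{tx}\qquad\text{in }(0,T)\times(a,b),$$ $$u(\cdot,a)=u(\cdot,b)=\theta_x(\cdot,a)=\theta_x(\cdot,b)=0\ \text{ on }(0,T),\qquad u(0,\cdot)=u_0,\ u_t(0,\cdot)=v_0,\ \theta(0,\cdot)=\theta_0.$$ Then there exists $\hat\theta>0$ such that $$\theta(t,x)\ge\hat\theta$$ for almost all $(t,x)\in[0,T]\times[a,b]$.
   Context: All functions are real-valued; $u$ is the displacement and $\theta$ the temperature. Definition of solution. A pair $(u,\theta)$ is a solution of the problem if: (0) the initial data satisfy $u_0\in H^2(a,b)\cap H^1_0(a,b)$, $v_0\in H^1_0(a,b)$, $\theta_0\in H^1(a,b)$, and there exists $\tilde\theta>0$ with $\theta_0(x)\ge\tilde\theta$ for all $x\in[a,b]$; (1) $u\in L^{\infty}(0,T;H^2(a,b))\cap W^{1,\infty}(0,T;H^1_0(a,b))\cap W^{2,\infty}(0,T;L^2(a,b))$ and $\theta\in L^{\infty}(0,T;H^1(a,b))\cap H^1(0,T;L^2(a,b))$; (2) the momentum equation $u_{tt}-u_{xx}=\mu\theta_x$ is satisfied for almost all $(t,x)\in(0,T)\times(a,b)$; (3) the entropy equation $\int_a^b\theta_t\psi\,dx+\int_a^b\theta_x\psi_x\,dx=\mu\int_a^b\theta u_{tx}\psi\,dx$ holds for all $\psi\in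 C^\infty[a,b]$ and for almost all $t\in(0,T)$; (4) the initial conditions $u(0,\cdot)=u_0$, $u_t(0,\cdot)=v_0$, $\theta(0,\cdot)=\theta_0$ are attained in the sense that $\theta\in C([0,T];L^2(a,b))$, $u\in C([0,T];H^1_0(a,b))$, $u_t\in C([0,T];L^2(a,b))$. *)

(* Defs.v *)
From HB Require Import structures.
From mathcomp Require Import all_boot all_order all_algebra.
From mathcomp Require Import all_classical all_reals all_analysis.

Set Implicit Arguments.
Unset Strict Implicit.
Unset Printing Implicit Defensive.
Import Order.TTheory GRing.Theory Num.Theory.
Import numFieldNormedType.Exports.

Local Open Scope classical_set_scope.
Local Open Scope ring_scope.

(* Elements of a function space over the interval (a, b) are represented by
   functions f : R -> R, of which only the values almost everywhere on ]a, b[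
   matter; space-time functions are curried, f : R -> R -> R, with time first,
   so that f t is the slice at time t. *)

Section sobolev_spaces.
Variable R : realType.
Implicit Types (a b : R) (f g phi : R -> R).

Local Notation mu := (@lebesgue_measure R).

Definition smooth phi := forall n x, derivable (derive1n n phi) x 1.

Definition test_fun a b phi :=
  let supp := closure [set x | phi x != 0] in
  [/\ smooth phi, compact supp & supp `<=` `]a, b[].

Definition is_wderiv a b f g :=
  [/\ locally_integrable `]a, b[ f, locally_integrable `]a, b[ g &
      forall phi, test_fun a b phi ->
        (\int[mu]_(x in `]a, b[) (f x * derive1 phi x)) =
        - (\int[mu]_(x in `]a, b[) (g x * phi x))].

(* a chosen weak derivative; meaningful only when one exists, and then unique
   up to equality almost everywhere on ]a, b[ *)
Definition wderiv a b f : R -> R := get (is_wderiv a b f).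

Record fspace := FSpace {
  fmem :> (R -> R) -> Prop ;
  fnorm : (R -> R) -> \bar R }.

Definition L2 a b : fspace := FSpace
  [set f | f \_ `]a, b[ \in Lfun mu 2%:E]
  (fun f => 'N[mu]_(2%:E)[EFin \o (f \_ `]a, b[)]%E).

Fixpoint Hmem k a b f : Prop :=
  if k is k'.+1 then
    L2 a b f /\ exists2 g, is_wderiv a b f g & Hmem k' a b g
  else L2 a b f.

(* ||f||_2 + ||f'||_2 + ..., equivalent to the Hilbert norm *)
Fixpoint Hnorm k a b f : \bar R :=
  if k is k'.+1 then
    (fnorm (L2 a b) f + Hnorm k' a b (wderiv a b f))%E
  else fnorm (L2 a b) f.

Definition Hk k a b : fspace := FSpace (Hmem k a b) (Hnorm k a b).

(* closure of the test functions in H^1 *)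
Definition H10 a b : fspace := FSpace
  [set f | Hk 1 a b f /\
    forall e : R, 0 < e ->
      exists2 phi, test_fun a b phi & (fnorm (Hk 1 a b) (f \- phi)%R < e%:E)%E]
  (fnorm (Hk 1 a b)).

End sobolev_spaces.

Section bochner_spaces.
Variable R : realType.
Implicit Types (T : R) (X : fspace R) (f g : R -> R -> R).

Local Notation mu := (@lebesgue_measure R).

(* the simple function t |-> \sum_i \1_(sset i) t * sval i *)
Record simple_fun := SimpleFun {
  ssize : nat ;
  sset : 'I_ssize -> set R ;
  svec : 'I_ssize -> R -> R }.

Definition simple_in X (s : simple_fun) :=
  forall i : 'I_(ssize s), measurable (sset i) /\ X (svec i).

Definition simple_eval (s : simple_fun) (t : R) : R -> R :=
  fun x => \sum_(i < ssize s) \1_(sset i) t * svec i x.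

Definition simple_int T (s : simple_fun) : R -> R :=
  fun x => \sum_(i < ssize s)
    fine (mu (sset i `&` `]0, T[)) * svec i x.

Definition simple_approx T X (s : nat -> simple_fun) f :=
  (forall n, simple_in X (s n)) /\
  {ae mu, forall t, t \in `]0, T[ -> X (f t) /\
     fnorm X (f t \- simple_eval (s n) t) @[n --> \oo] --> 0%E}.

Definition strongly_measurable T X f := exists s, simple_approx T X s f.

(* y is the Bochner integral over ]0, T[ of the X-valued function f *)
Definition is_bochner_int T X f (y : R -> R) := X y /\
  exists s, [/\ simple_approx T X s f,
    (\int[mu]_(t in `]0%R, T[)
       fnorm X (f t \- simple_eval (s n) t)%R)%E
      @[n --> \oo] --> 0%E &
    fnorm X (simple_int T (s n) \- y) @[n --> \oo] --> 0%E].

(* g is the weak derivative of f in the sense of X-valued distributions *)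
Definition is_tderiv T X f g := forall phi, test_fun 0 T phi ->
  exists y, is_bochner_int T X (fun t x => derive1 phi t * f t x) y /\
            is_bochner_int T X (fun t x => phi t * g t x) (\- y).

Definition LX (p : \bar R) T X f := strongly_measurable T X f /\
  ('N[mu]_p[(fun t => fnorm X (f t)) \_ `]0%R, T[] < +oo)%E.

(* f is in W^{1,p}(0,T;X), with derivative f1 *)
Definition W1X (p : \bar R) T X f f1 :=
  [/\ LX p T X f, LX p T X f1 & is_tderiv T X f f1].

(* f is in W^{2,p}(0,T;X), with derivatives f1 and f2 *)
Definition W2X (p : \bar R) T X f f1 f2 :=
  W1X p T X f f1 /\ W1X p T X f1 f2.

Definition CX T X f := forall t, t \in `[0, T] -> X (f t) /\
  fnorm X (f s \- f t) @[s --> within `[0, T] (nbhs t)] --> 0%E.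

(* f has a representative in C([0,T];X) whose value at time 0 is f0 *)
Definition attains a b T X f (f0 : R -> R) := exists g,
  [/\ CX T X g,
      {ae mu, forall t, t \in `]0, T[ -> ae_eq mu `]a, b[%classic (g t) (f t)} &
      ae_eq mu `]a, b[%classic (g 0) f0].

End bochner_spaces.

Section thermoelasticity.
Variable R : realType.

Local Notation leb := (@lebesgue_measure R).

Definition ae_rect (S I : set R) (P : R -> R -> Prop) :=
  {ae (leb \x leb)%E, forall z, S z.1 -> I z.2 -> P z.1 z.2}.

Definition joint_measurable (a b T : R) (f : R -> R -> R) :=
  measurable_fun (`]0, T[ `*` `]a, b[)
    (fun z : measurableTypeR R * measurableTypeR R => f z.1 z.2 : measurableTypeR R).

Definition space_deriv (a b T : R) (f fx : R -> R -> R) :=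
  {ae leb, forall t, t \in `]0, T[ -> is_wderiv a b (f t) (fx t)}.

(* The boundary conditions are part of the formulation: the Dirichlet one is
   membership in H10, the Neumann one is the weak form of the entropy equation
   against functions smooth up to the boundary. *)
Record solves (a b T mu : R) (u0 v0 th0 : R -> R)
    (u ut utt ux uxx utx th tht thx : R -> R -> R) : Prop := Solves {
  solves_u0 : Hk 2 a b u0 /\ H10 a b u0 ;
  solves_v0 : H10 a b v0 ;
  solves_th0 : Hk 1 a b th0 ;
  solves_th0_gt0 :
    exists2 c : R, 0 < c & forall x, x \in `[a, b] -> c <= th0 x ;
  solves_measurable_u : [/\ joint_measurable a b T u,
      joint_measurable a b T ut & joint_measurable a b T utt] ;
  solves_measurable_ux : [/\ joint_measurable a b T ux,
      joint_measurable a b T uxx & joint_measurable a b T utx] ;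
  solves_measurable_th : [/\ joint_measurable a b T th,
      joint_measurable a b T tht & joint_measurable a b T thx] ;
  solves_u_H2 : LX +oo T (Hk 2 a b) u ;
  solves_u_W1 : W1X +oo T (H10 a b) u ut ;
  solves_u_W2 : W2X +oo T (L2 a b) u ut utt ;
  solves_th_H1 : LX +oo T (Hk 1 a b) th ;
  solves_th_W1 : W1X 2%:E T (L2 a b) th tht ;
  solves_ux : space_deriv a b T u ux ;
  solves_uxx : space_deriv a b T ux uxx ;
  solves_utx : space_deriv a b T ut utx ;
  solves_thx : space_deriv a b T th thx ;
  solves_momentum : ae_rect `]0, T[ `]a, b[
    (fun t x => utt t x - uxx t x = mu * thx t x) ;
  solves_entropy : forall psi : R -> R, smooth psi ->
    {ae leb, forall t, t \in `]0, T[ ->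
      (\int[leb]_(x in `]a, b[) (tht t x * psi x)) +
      (\int[leb]_(x in `]a, b[) (thx t x * derive1 psi x)) =
      mu * (\int[leb]_(x in `]a, b[) (th t x * utx t x * psi x))} ;
  solves_init_u : attains a b T (H10 a b) u u0 ;
  solves_init_ut : attains a b T (L2 a b) ut v0 ;
  solves_init_th : attains a b T (L2 a b) th th0 }.

Definition is_solution (a b T mu : R) (u0 v0 th0 : R -> R)
    (u th : R -> R -> R) : Prop :=
  exists ut utt ux uxx utx tht thx : R -> R -> R,
    solves a b T mu u0 v0 th0 u ut utt ux uxx utx th tht thx.

End thermoelasticity.

(* Main.v *)
Require Import Defs.
From HB Require Import structures.
From mathcomp Require Import all_boot all_order all_algebra.
From mathcomp Require Import all_classical all_reals all_analysis.
From mathcomp Require Import measurable_realfun ess_sup_inf ring lra.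
Set Implicit Arguments.
Unset Strict Implicit.
Unset Printing Implicit Defensive.
Import Order.TTheory GRing.Theory Num.Theory.
Import numFieldNormedType.Exports.
Local Open Scope classical_set_scope.
Local Open Scope ring_scope.

(** Write v for the velocity u_t and m for the coupling constant. The heat
    equation th_t - th_xx = m th v_x has a zero-order coefficient m v_x that is
    only square integrable in space, so the usual comparison of th with a
    function of time alone is not available. The proof compares th with a
    barrier that absorbs this coefficient. Let Z = exp s with s_x = - m v. Then
    Z_x + m v Z = 0, and

      Z_xx + m Z v_x = (Z_x + m v Z)_x - m v Z_x = (m v)^2 Z >= 0,

    so that Z is a subsolution as soon as s_t <= 0. Since s_x = - m v, one can
    take s_t = - m (the integral of v_t over ]a, x]) - M with M a constant: the
    acceleration v_t = u_tt is bounded in L2 uniformly in time, hence in L1, and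
    a large M makes s_t nonpositive. The function s stays bounded on the
    rectangle, so Z is bounded below by a positive constant there; the constant
    of integration is chosen so that Z <= th_0 at time 0.

    That Z <= th follows from an energy estimate for d = Z - th. With D the
    positive part of d, the entropy equation is tested against D^2, and the
    terms containing v_x disappear after an integration by parts, because
    m v th = Z m v - d m v and Z_x = - m v Z. The remaining terms form a complete
    square up to (9/8) P^2 D^3, where P bounds |m v| (slice_energy). Integrating
    the chain rule for D^3 in time gives, for F(t) the integral of D(t,.)^3, the
    inequality F(t) <= K * (integral of F over [0, t]), and F vanishes by
    Gronwall's lemma (chain_time, comparison). The cube is used because its
    derivative, the test function, still has a Lipschitz derivative; with D^2 as
    energy the test function D would not.

    Everything is done with one notion of weak regularity in one variable:
    ac a b f g says that f is the primitive of the integrable function g on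
    [a, b]. The products, the chain rule for C^{1,1} outer functions and the
    fundamental theorem of calculus hold for it (ac_mul, ac_comp, ac_ftc). The
    rest of the work is to bring the data of a solution to this form.

    In space, the du Bois-Reymond lemma turns a weak derivative into ac, with
    vanishing end values for the closure of the test functions (H10_trace) and,
    by testing against primitives of bumps, vanishing flux for the entropy
    equation (neumann_representation). In time, the derivatives are vector-valued
    distributions, tested by Bochner integrals. Integration over a subset A of
    the interval is a continuous functional on L2, so it commutes with these
    integrals (bochner_int_functional); the du Bois-Reymond lemma then applies to
    the scalar function of time obtained from each A, and letting A range over the
    intervals with rational end points recovers f(t,x) = f_0(x) + integral of
    f_t(.,x) over [0, t] for almost all t and x (time_representation). *)

(** * Smooth functions and bumps *)

Section smooth_functions.
Variable R : realType.
Implicit Types (f g : R -> R) (x c d : R).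

Lemma scale_mulE c d : c *: d = c * d. Proof. by []. Qed.

(** Differentiability to finite order is compared with iterated derivatives
    taken from the inside, so that stability under products and
    substitutions goes by induction on the order. *)
Fixpoint derivable_upto n f : Prop :=
  (forall x, derivable f x 1) /\
  if n is n'.+1 then derivable_upto n' (derive1 f) else True.

Lemma smoothE f : smooth f <-> forall n, derivable_upto n f.
Proof.
split=> [sf n|H n].
  elim: n f sf => [|n IH] f sf /=; first by split=> //; exact: (sf 0%N).
  split; first exact: (sf 0%N).
  by apply: IH => k x; have := sf k.+1 x; rewrite (derive1Sn f k).
elim: n f {H}(H n) => [|n IH] f /= [df rf] x; first exact: df.
by rewrite -derive1nS derive1Sn; exact: IH.
Qed.

Lemma smooth_derive1 f : smooth f -> smooth (derive1 f).
Proof. by move=> sf n x; have := sf n.+1 x; rewrite (derive1Sn f n). Qed.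

Lemma smooth_derivable f : smooth f -> forall x, derivable f x 1.
Proof. by move=> sf; exact: (sf 0%N). Qed.

Lemma smoothS f : (forall x, derivable f x 1) -> smooth (derive1 f) -> smooth f.
Proof.
by move=> df sf [|n] x; [exact: df|rewrite (derive1Sn f n); exact: sf].
Qed.

Lemma derivable_uptoW n f : derivable_upto n.+1 f -> derivable_upto n f.
Proof. by elim: n f => [|n IH] f /= [df H]; split=> //; exact: IH. Qed.

Lemma derivable_uptoD n f g : derivable_upto n f -> derivable_upto n g ->
  derivable_upto n (f + g).
Proof.
elim: n f g => [|n IH] f g /= [df f'] [dg g'].
  by split; [move=> x; exact: derivableD|].
split; first by move=> x; exact: derivableD.
have -> : derive1 (f + g) = derive1 f + derive1 g.
  by apply/funext => x; rewrite !derive1E (deriveD (df x) (dg x)) !fctE !derive1E.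
exact: IH.
Qed.

Lemma derivable_uptoM n f g : derivable_upto n f -> derivable_upto n g ->
  derivable_upto n (f * g).
Proof.
elim: n f g => [|n IH] f g.
  by move=> [df f'] [dg g']; split; [move=> x; exact: derivableM|].
move=> hf hg; have [df f'] := hf; have [dg g'] := hg.
split; first by move=> x; exact: derivableM.
have -> : derive1 (f * g) = f * derive1 g + g * derive1 f.
  by apply/funext => x; rewrite !derive1E (deriveM (df x) (dg x)) !fctE !derive1E.
by apply: derivable_uptoD; apply: IH => //; exact: derivable_uptoW.
Qed.

Lemma derivable_upto_cst n c : derivable_upto n (cst c : R -> R).
Proof.
elim: n c => [|n IH] c /=; split=> //.
by rewrite (_ : derive1 _ = cst 0) //; apply/funext => x; rewrite derive1_cst.
Qed.

Lemma is_derive_affine f c d x : derivable f (c * x + d) 1 ->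
  is_derive x 1 (fun y => f (c * y + d)) (c * derive1 f (c * x + d)).
Proof.
move=> df.
have h : is_derive x 1 (fun y : R => c * y + d) c.
  have : is_derive x 1 ((c \*: id) + cst d) (c *: (1 : R) + 0).
    by apply: is_deriveD; exact: is_deriveZ.
  by rewrite addr0 scale_mulE mulr1.
have hf : is_derive (c * x + d) 1 f (derive1 f (c * x + d)).
  by rewrite derive1E; exact: derivableP.
have := @is_derive1_comp _ f (fun y => c * y + d) x _ _ hf h.
by rewrite mulrC.
Qed.

Lemma derivable_upto_affine n f c d : derivable_upto n f ->
  derivable_upto n (fun y => f (c * y + d)).
Proof.
elim: n f => [|n IH] f /= [df f'].
  by split; [move=> x; have [] := is_derive_affine (df (c * x + d))|].
split; first by move=> x; have [] := is_derive_affine (df (c * x + d)).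
have -> : derive1 (fun y => f (c * y + d)) =
    cst c * (fun y => derive1 f (c * y + d)).
  apply/funext => x; rewrite derive1E.
  by have [_ ->] := is_derive_affine (df (c * x + d)).
by apply: derivable_uptoM; [exact: derivable_upto_cst|exact: IH].
Qed.

Lemma smoothM f g : smooth f -> smooth g -> smooth (f * g).
Proof.
by move=> /smoothE hf /smoothE hg; apply/smoothE => n; exact: derivable_uptoM.
Qed.

Lemma smoothD f g : smooth f -> smooth g -> smooth (f + g).
Proof.
by move=> /smoothE hf /smoothE hg; apply/smoothE => n; exact: derivable_uptoD.
Qed.

Lemma smooth_cst c : smooth (cst c : R -> R).
Proof. by apply/smoothE => n; exact: derivable_upto_cst. Qed.

Lemma smooth_affine f c d : smooth f -> smooth (fun y => f (c * y + d)).
Proof. by move=> /smoothE hf; apply/smoothE => n; exact: derivable_upto_affine. Qed.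

Lemma smooth_continuous f : smooth f -> continuous f.
Proof.
by move=> sf x; apply: differentiable_continuous; apply/derivable1_diffP;
  exact: smooth_derivable.
Qed.

End smooth_functions.

Section flat.
Variable R : realType.
Implicit Types (p : {poly R}) (x : R).

(** Functions p(1/x) exp(-1/x) on the positive half-line. Unlike exp(-1/x)
    alone, this family is stable under differentiation, which gives
    smoothness by induction. *)
Definition flat p x : R := if 0 < x then p.[x^-1] * expR (- x^-1) else 0.

(** The exponential dominates every polynomial; the power y ^ k is carried
    along because the induction on p multiplies by y. *)
Lemma poly_expR_bound p k :
  exists2 C : R, 0 <= C &
    forall y, 0 <= y -> `|p.[y]| * y ^+ k * expR (- y) <= C.
Proof.
elim/poly_ind: p k => [k|p c IH k].
  by exists 0 => // y _; rewrite horner0 normr0 !mul0r.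
have [C C0 HC] := IH k.+1.
exists (C + `|c| * k`!%:R) => [|y y0]; first by rewrite addr_ge0.
rewrite hornerMXaddC -mulrA.
rewrite (le_trans (ler_wpM2r _ (ler_normD _ _))) ?mulr_ge0 ?exprn_ge0 ?expR_ge0//.
rewrite mulrDl lerD//.
  by rewrite normrM (ger0_norm y0) -mulrA (mulrA y) -exprS mulrA HC.
rewrite ler_wpM2l// expRN ler_pdivrMr ?expR_gt0//.
case: k {C C0 HC} => [|k].
  by rewrite expr0 mul1r -expR0 ler_expR.
have := expR_ge1Dxn k y0; set F := _%:R.
have F0 : 0 < F by rewrite ltr0n fact_gt0.
move=> H; rewrite -ler_pdivrMl// mulrC; apply: le_trans H.
by rewrite lerDr.
Qed.

(** With y = 1/x one has dy/dx = - y^2, whence d/dx (p(y) exp(-y)) = y^2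
    (p(y) - p'(y)) exp(-y). *)
Definition dflat p := 'X^2 * (p - p^`()).

Lemma flat_le_sqr p : exists2 C : R, 0 <= C & forall x, `|flat p x| <= C * x ^+ 2.
Proof.
have [C C0 HC] := poly_expR_bound p 2.
exists C => // x; rewrite /flat; case: ifPn => [x0|_]; last first.
  by rewrite normr0 mulr_ge0// sqr_ge0.
have := HC x^-1; rewrite invr_ge0 (ltW x0) => /(_ isT).
rewrite mulrAC exprVn ler_pdivrMr ?exprn_gt0// => H.
by rewrite normrM (ger0_norm (expR_ge0 _)).
Qed.

(** Away from 0 this is a computation; at 0 the function is O(x^2), so the
    difference quotient tends to 0. *)
Lemma is_derive_flat p x : is_derive x 1 (flat p) (flat (dflat p) x).
Proof.
have [x0|x0|<-] := ltgtP 0 x.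
- have xn0 : x != 0 by rewrite gt_eqF.
  have hi : is_derive x 1 (fun y : R => y^-1) (- x ^- 2).
    have := is_deriveV xn0 (is_derive_id x 1).
    by rewrite scale_mulE mulr1.
  have hp := @is_derive1_comp _ (horner p) (fun y : R => y^-1) x _ _
     (is_derive_poly p x^-1) hi.
  have hn : is_derive x 1 (fun y : R => - y^-1) (x ^- 2).
    by have := is_deriveN hi; rewrite opprK.
  have he := @is_derive1_comp _ expR (fun y : R => - y^-1) x _ _
     (is_derive_expR _) hn.
  have h := is_deriveM hp he.
  have nf : \forall y \near x,
      ((horner p \o [eta GRing.inv]) * (expR \o (fun y : R => - y^-1))) y = flat p y.
    near=> y; rewrite /flat ifT//; near: y.
    exact: lt_nbhsr.
  apply: (near_eq_is_derive nf).
  suff <- : ((horner p \o [eta GRing.inv]) x *: (expR (- x^-1) * x ^- 2) +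
    (expR \o (fun y : R => - y^-1)) x *: (p^`().[x^-1] * - x ^- 2)) =
     flat (dflat p) x by exact: h.
  rewrite /flat x0 /dflat !hornerE /= -!exprVn !scale_mulE.
  ring.
- have nf : \forall y \near x, cst 0 y = flat p y.
    near=> y; rewrite /flat ifF//; apply/negbTE; rewrite -leNgt ltW//.
    by near: y; exact: lt_nbhsl.
  apply: (near_eq_is_derive nf).
  by rewrite /flat ltNge (ltW x0) /=; exact: is_derive_cst.
- have [C C0 HC] := flat_le_sqr p.
  have C1 : 0 < C + 1 by rewrite ltr_wpDl.
  have f0 : flat p 0 = 0 by rewrite /flat ltxx.
  have -> : flat (dflat p) 0 = 0 by rewrite /flat ltxx.
  have H : h^-1 *: (flat p (h *: 1 + 0) - flat p 0) @[h --> 0^'] --> (0 : R).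
    rewrite f0; apply/cvgrPdist_le => /= e e0; near=> h.
    rewrite scaler1 addr0 subr0 sub0r normrN scale_mulE normrM normfV.
    have h0 : h != 0 by near: h; exact: nbhs_dnbhs_neq.
    rewrite mulrC ler_pdivrMr ?normr_gt0//; apply: (le_trans (HC h)).
    rewrite -real_normK ?num_real// expr2 mulrA ler_wpM2r//.
    apply: (@le_trans _ _ ((C + 1) * `|h|)); first by rewrite ler_wpM2r// lerDl.
    rewrite mulrC -ler_pdivlMr//.
    near: h; apply: dnbhs0_le; apply: divr_gt0; [exact: e0|exact: C1].
  split; first by apply/cvg_ex; exists 0.
  by apply/cvg_lim => //; exact: H.
Unshelve. all: by end_near. Qed.

Lemma smooth_flat p : smooth (flat p).
Proof.
apply/smoothE => n; elim: n p => [|n IH] p /=; split => //;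
  try by move=> x; have [] := is_derive_flat p x.
have -> : derive1 (flat p) = flat (dflat p).
  by apply/funext => x; rewrite derive1E; have [_ ->] := is_derive_flat p x.
exact: IH.
Qed.

End flat.

Lemma integrable_extend d (T : measurableType d) (R : realType)
    (nu : {measure set T -> \bar R}) (D : set T) (f : T -> R) :
  measurable D -> (forall x, ~ D x -> f x = 0) ->
  nu.-integrable D (EFin \o f) -> nu.-integrable setT (EFin \o f).
Proof.
move=> mD f0 /(integrable_mkcond _ mD); apply: eq_integrable => // x _.
by rewrite patchE; case: ifPn => // /negP xD; rewrite /= f0// => /mem_set.
Qed.

Section integrable_arith.
Context d (T : measurableType d) (R : realType).
Variables (nu : {measure set T -> \bar R}) (D : set T).
Hypothesis mD : measurable D.
Implicit Types (f g : T -> R) (c : R).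

Lemma integrable_mulcl c f : nu.-integrable D (EFin \o f) ->
  nu.-integrable D (EFin \o (fun x => c * f x)).
Proof. by move=> /(integrableZl mD c); apply: eq_integrable. Qed.

Lemma integrable_add f g : nu.-integrable D (EFin \o f) ->
  nu.-integrable D (EFin \o g) -> nu.-integrable D (EFin \o (fun x => f x + g x)).
Proof. by move=> hf hg; have := integrableD mD hf hg; apply: eq_integrable. Qed.

Lemma integrable_sub f g : nu.-integrable D (EFin \o f) ->
  nu.-integrable D (EFin \o g) -> nu.-integrable D (EFin \o (fun x => f x - g x)).
Proof. by move=> hf hg; have := integrableB mD hf hg; apply: eq_integrable. Qed.

Lemma integrable_measurable f : nu.-integrable D (EFin \o f) -> measurable_fun D f.
Proof. by case/integrableP => /measurable_EFinP. Qed.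

Lemma integrable_bounded_mul f g (B : R) : measurable_fun D f ->
  (forall x, D x -> `|f x| <= B) -> nu.-integrable D (EFin \o g) ->
  nu.-integrable D (EFin \o (fun x => f x * g x)).
Proof.
move=> mf fB ig; apply: le_integrable (integrable_mulcl B ig) => //.
  apply/measurable_EFinP; apply: measurable_funM => //.
  exact: integrable_measurable.
move=> x Dx; rewrite lee_fin !normrM ler_wpM2r//.
by rewrite (le_trans (fB x _))// ler_norm.
Qed.

End integrable_arith.

Section bumpf.
Variable R : realType.
Implicit Types (p q x : R) (n : nat).
Local Notation mu := (@lebesgue_measure R).

(** As n grows these functions increase to the indicator of ]p, q[ and never
    exceed 1. Having a sequence indexed by nat, used with rational p and q,
    keeps every argument that discards null sets countable. *)
Definition bumpf p q n x : R :=
  flat 1 (n.+1%:R * (x - p)) * flat 1 (n.+1%:R * (q - x)).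

Lemma smooth_bump p q n : smooth (bumpf p q n).
Proof.
have -> : bumpf p q n = (fun x => flat 1 (n.+1%:R * x + (- n.+1%:R * p))) *
    (fun x => flat 1 (- n.+1%:R * x + n.+1%:R * q)).
  apply/funext => x; rewrite /bumpf !fctE; congr (flat _ _ * flat _ _); ring.
by apply: smoothM; apply: smooth_affine; exact: smooth_flat.
Qed.

Lemma flat1_ge0 x : 0 <= flat 1 x.
Proof. by rewrite /flat; case: ifP => // _; rewrite hornerC mul1r expR_ge0. Qed.

Lemma flat1_le1 x : flat 1 x <= 1.
Proof.
rewrite /flat; case: ifP => // x0; rewrite hornerC mul1r expR_le1 oppr_le0.
by rewrite invr_ge0 ltW.
Qed.

Lemma flat_le0 (r : {poly R}) x : x <= 0 -> flat r x = 0.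
Proof. by rewrite /flat leNgt => /negbTE ->. Qed.

Lemma bump_ge0 p q n x : 0 <= bumpf p q n x.
Proof. by rewrite mulr_ge0 ?flat1_ge0. Qed.

Lemma bump_le1 p q n x : bumpf p q n x <= 1.
Proof. by rewrite mulr_ile1 ?flat1_ge0 ?flat1_le1. Qed.

Lemma bump_out p q n x : x \notin `]p, q[ -> bumpf p q n x = 0.
Proof.
rewrite in_itv /= negb_and -!leNgt /bumpf => /orP[xp|qx].
  by rewrite (@flat_le0 _ (_ * (x - p))) ?mul0r// mulr_ge0_le0// subr_le0.
by rewrite (@flat_le0 _ (_ * (q - x))) ?mulr0// mulr_ge0_le0// subr_le0.
Qed.

Lemma flat1_cvg x : 0 < x -> flat 1 (n.+1%:R * x) @[n --> \oo] --> (1 : R).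
Proof.
move=> x0.
have -> : (fun n => flat 1 (n.+1%:R * x)) = (fun n => expR (- (harmonic n * x^-1))).
  apply/funext => n; rewrite /flat mulr_gt0// hornerC mul1r invfM.
  by rewrite /harmonic.
rewrite -expR0; apply: continuous_cvg; first exact: continuous_expR.
rewrite -oppr0; apply: cvgN; rewrite -(mul0r x^-1).
by apply: cvgM; [exact: cvg_harmonic|exact: cvg_cst].
Qed.

Lemma bump_cvg p q x : x \in `]p, q[ -> bumpf p q n x @[n --> \oo] --> (1 : R).
Proof.
rewrite in_itv /= => /andP[px xq]; rewrite -(mulr1 1).
by apply: cvgM; apply: flat1_cvg; rewrite subr_gt0.
Qed.

Definition primitive (f : R -> R) (x : R) : R := \int[mu]_(t in `]-oo, x]) f t.

Variables (f : R -> R) (p q : R).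
Hypotheses (cf : continuous f) (f0 : forall x, x \notin `[p, q] -> f x = 0).

Lemma continuous_supp_integrable (D : set R) : measurable D ->
  mu.-integrable D (EFin \o f).
Proof.
move=> mD; apply: (@integrableS _ _ _ _ setT) => //.
apply: (@integrable_extend _ _ _ mu `[p, q]%classic).
- exact: measurable_itv.
- by move=> x xpq; apply: f0; apply/negP.
- apply: continuous_compact_integrable; first exact: segment_compact.
  by apply: continuous_subspaceT => x; exact: cf.
Qed.

Lemma is_derive_primitive x : is_derive x 1 (primitive f) (f x).
Proof.
have [] := @continuous_FTC1 R f -oo%O x (x + 1).
- by rewrite ltrDl.
- exact: continuous_supp_integrable.
- by rewrite ltNyr.
- exact: cf.
- by move=> d; rewrite derive1E => <-; exact: derivableP.
Qed.

Lemma derive1_primitive : derive1 (primitive f) = f.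
Proof.
by apply/funext => x; rewrite derive1E; have [_ ->] := is_derive_primitive x.
Qed.

Lemma smooth_primitive : smooth f -> smooth (primitive f).
Proof.
move=> sf; apply: smoothS; last by rewrite derive1_primitive.
by move=> x; have [] := is_derive_primitive x.
Qed.

Lemma primitive_left x : x < p -> primitive f x = 0.
Proof.
move=> xp; rewrite /primitive (@eq_Rintegral _ _ _ mu _ (cst 0)).
  by rewrite Rintegral_cst// mul0r.
move=> y; rewrite inE /= in_itv /= => yx; apply: f0.
by rewrite in_itv /= negb_and -ltNge (le_lt_trans yx xp).
Qed.

Lemma primitive_right x : q <= x -> primitive f x = \int[mu]_(t in `[p, q]) f t.
Proof.
move=> qx; rewrite /primitive Rintegral_mkcond [RHS]Rintegral_mkcond.
congr Rintegral; apply/funext => y; rewrite !patchE.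
have [ypq|ypq] := boolP (y \in `[p, q]).
  rewrite [in RHS]mem_set// mem_set//=.
  by move: ypq; rewrite !in_itv /= => /andP[_ yq]; exact: le_trans qx.
by rewrite f0// !if_same.
Qed.

(** A primitive vanishes to the right of the support exactly when the total
    integral is 0. This is how test functions with a prescribed derivative
    are obtained. *)
Lemma test_fun_primitive a b : a < p -> q < b -> smooth f ->
  \int[mu]_(t in `[p, q]) f t = 0 -> test_fun a b (primitive f).
Proof.
move=> ap qb sf intf0.
have sub : closure [set x | primitive f x != 0] `<=` `[p, q].
  have/closure_id -> : closed [set` `[p, q]] by exact: interval_closed.
  apply: closureS => x /= /negP px; rewrite in_itv /=; apply/andP; split.
    by rewrite leNgt; apply/negP => xp; apply: px; rewrite primitive_left.
  rewrite leNgt; apply/negP => qx; apply: px.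
  by rewrite primitive_right ?intf0// ltW.
split; first exact: smooth_primitive.
- apply: subclosed_compact sub; first exact: closed_closure.
  exact: segment_compact.
- move=> x /sub /=; rewrite !in_itv /= => /andP[px xq].
  by rewrite (lt_le_trans ap px) (le_lt_trans xq qb).
Qed.

End bumpf.

(** * Primitives of integrable functions *)

Section ac.
Variable R : realType.
Local Notation mu := (@lebesgue_measure R).
Implicit Types (f g N D : R -> R) (a b x y L : R).

Lemma integrable_sub_itv a b x y g : a <= x -> y <= b ->
  mu.-integrable `]a, b] (EFin \o g) -> mu.-integrable `]x, y] (EFin \o g).
Proof.
move=> ax yb; apply: integrableS => //.
by apply: subset_itv; rewrite bnd_simp.
Qed.

Lemma Rintegral_cat a x y b g : a <= x -> x <= y -> y <= b ->
  mu.-integrable `]a, b] (EFin \o g) ->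
  \int[mu]_(t in `]a, y]) g t =
  \int[mu]_(t in `]a, x]) g t + \int[mu]_(t in `]x, y]) g t.
Proof.
move=> ax xy yb ig; rewrite -(@Rintegral_itvB _ g (BRight a) (BRight y) x).
- by rewrite addrCA subrr addr0.
- exact: integrable_sub_itv yb ig.
- by rewrite bnd_simp.
- by rewrite bnd_simp.
Qed.

(** End points are null, so the four kinds of bounded interval have the same
    integrable functions. *)
Lemma integrable_itv_bnd (b0 b1 c0 c1 : bool) a b g :
  mu.-integrable [set` Interval (BSide b0 a) (BSide b1 b)] (EFin \o g) ->
  mu.-integrable [set` Interval (BSide c0 a) (BSide c1 b)] (EFin \o g).
Proof.
have cc d0 d1 :
    mu.-integrable [set` Interval (BSide d0 a) (BSide d1 b)] (EFin \o g) ->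
    mu.-integrable `[a, b] (EFin \o g).
  move=> /integrableP[mg ig]; have mg' : measurable_fun `[a, b] g.
    by move/measurable_EFinP : mg => /measurable_fun_itv_cc.
  apply/integrableP; split; first exact/measurable_EFinP.
  move: ig; rewrite (@integral_itv_bndoo _ a b _ d0 d1); last first.
    apply: measurableT_comp => //; apply/measurable_EFinP.
    by apply: measurable_funS mg' => //; exact: subset_itv_oo_cc.
  rewrite (@integral_itv_bndoo _ a b _ true false)//.
  apply: measurableT_comp => //; apply/measurable_EFinP.
  by apply: measurable_funS mg' => //; exact: subset_itv_oo_cc.
move=> /cc; apply: integrableS => //.
by apply: subset_itv; rewrite bnd_simp; case: c0; case: c1.
Qed.

(** Absolute continuity, encoded by its integral formula. The half-open
    intervals make the integrals additive under concatenation without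
    exceptional points. *)
Definition ac a b f g := mu.-integrable `]a, b] (EFin \o g) /\
  forall x, a <= x <= b -> f x = f a + \int[mu]_(t in `]a, x]) g t.

Lemma ac_incr a b f g x y : ac a b f g -> a <= x -> x <= y -> y <= b ->
  f y - f x = \int[mu]_(t in `]x, y]) g t.
Proof.
move=> [ig fE] ax xy yb; rewrite (fE y) ?(le_trans ax xy)// (fE x) ?ax ?(le_trans xy)//.
rewrite (Rintegral_cat ax xy yb ig) opprD addrACA subrr add0r.
by rewrite addrC addKr.
Qed.

Lemma integrable_normr (A : set R) g : measurable A ->
  mu.-integrable A (EFin \o g) -> mu.-integrable A (EFin \o (fun x => `|g x|)).
Proof. by move=> mA ig; exact: integrable_norm. Qed.

Lemma ac_incr_le a b f g x y : ac a b f g -> a <= x -> x <= y -> y <= b ->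
  `|f y - f x| <= \int[mu]_(t in `]x, y]) `|g t|.
Proof.
move=> acf ax xy yb; rewrite (ac_incr acf)//; apply: le_normr_Rintegral => //.
exact: integrable_sub_itv acf.1.
Qed.

Lemma integral_ub_continuous a b g : a <= b -> mu.-integrable `]a, b] (EFin \o g) ->
  {within `[a, b], continuous (fun x => \int[mu]_(t in `]a, x]) g t)}.
Proof.
move=> ab ig.
have ig' : mu.-integrable `[a, b] (EFin \o g).
  exact: integrable_itv_bnd ig.
have := parameterized_integral_continuous ab ig'.
apply: subspace_eq_continuous => x; rewrite inE /= => /andP[ax xb].
rewrite /from_subspace /parameterized_integral.
by rewrite Rintegral_itv_obnd_cbnd//; exact: integrable_sub_itv ig.
Qed.

Lemma ac_continuous a b f g : a <= b -> ac a b f g ->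
  {within `[a, b], continuous f}.
Proof.
move=> ab [ig fE].
have c : {within `[a, b], continuous (fun x => f a + \int[mu]_(t in `]a, x]) g t)}.
  move=> x; apply: cvgD; first exact: cvg_cst.
  exact: integral_ub_continuous.
move: c; apply: subspace_eq_continuous => x; rewrite inE /= in_itv /= => xab.
by rewrite /from_subspace -fE.
Qed.

Lemma ac_measurable a b f g : a <= b -> ac a b f g -> measurable_fun `]a, b] f.
Proof.
move=> ab /(ac_continuous ab) cf; apply: (@measurable_funS _ _ _ _ `[a, b]) => //.
  exact: subset_itv_oc_cc.
exact: subspace_continuous_measurable_fun.
Qed.

(** A function whose increments are at most quadratic in those of a
    continuous monotone N cannot grow: cut [a, b] into n pieces on which N
    grows by (N b - N a)/n, and the n increments add up to O(1/n). Here N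
    replaces the variable x, for which the increments of a primitive need
    not be small at a uniform rate. *)
Lemma quadratic_increment_le a b N D L : a <= b -> 0 <= L ->
  {within `[a, b], continuous N} ->
  (forall x y, a <= x -> x <= y -> y <= b -> N x <= N y) ->
  (forall x y, a <= x -> x <= y -> y <= b -> D y - D x <= L * (N y - N x) ^+ 2) ->
  D b <= D a.
Proof.
move=> ab L0 cN ndN DN.
have step (d : R) (k : nat) : 0 <= d -> forall y, a <= y <= b ->
    N y <= N a + k%:R * d -> D y - D a <= k%:R * (L * d ^+ 2).
  move=> d0; elim: k => [|k IH] y /andP[ay yb].
    rewrite !mul0r addr0 => Ny; apply: le_trans (DN _ _ _ _ _) _ => //.
    by rewrite (@le_anti _ _ (N y) (N a)) ?subrr ?expr0n ?mulr0// Ny ndN.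
  move=> Ny; have [Nk|Nk] := leP (N y) (N a + k%:R * d).
    apply: (le_trans (IH y _ Nk)); first by rewrite ay.
    by rewrite ler_wpM2r ?ler_nat// mulr_ge0// sqr_ge0.
  (* the point where N has grown by k steps of size d splits off the last
     piece *)
  have [c cay Nc] : exists2 c, c \in `[a, y] & N c = N a + k%:R * d.
    apply: IVT => //.
      apply: continuous_subspaceW cN; apply: subset_itvl; by rewrite bnd_simp.
    have -> : Num.min (N a) (N y) = N a by apply/min_idPl; exact: ndN.
    have -> : Num.max (N a) (N y) = N y by apply/max_idPr; exact: ndN.
    by rewrite (ltW Nk) lerDl mulr_ge0.
  move: cay; rewrite in_itv /= => /andP[ac cy].
  have := IH c; rewrite ac (le_trans cy yb) Nc lexx => /(_ isT isT) H1.
  have H2 := DN c y ac cy yb.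
  have Ncy : (N y - N c) ^+ 2 <= d ^+ 2.
    rewrite lerXn2r ?nnegrE ?subr_ge0 ?ndN// lerBlDl Nc -addrA.
    by rewrite (le_trans Ny)// -natr1 mulrDl mul1r.
  have H3 : L * (N y - N c) ^+ 2 <= L * d ^+ 2 by rewrite ler_wpM2l.
  rewrite -natr1 mulrDl mul1r; lra.
rewrite -subr_le0; apply/ler_addgt0Pr => e e0; rewrite add0r.
have [n hn] : exists n, L * (N b - N a) ^+ 2 / e < n.+1%:R.
  exists (Num.truncn (L * (N b - N a) ^+ 2 / e)).
  by rewrite truncnS_gt.
have n0 : 0 < n.+1%:R :> R by rewrite ltr0n.
have := step ((N b - N a) / n.+1%:R) n.+1 _ b; rewrite ab lexx.
rewrite divr_ge0 ?subr_ge0 ?ndN// => /(_ isT isT).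
rewrite mulrCA divff ?gt_eqF// mulr1 addrC subrK lexx => /(_ isT) H.
apply: (le_trans H).
move: hn; rewrite ltr_pdivrMr// => /ltW.
set P := _ * _ ^+ 2 => hn.
have -> : L * ((N b - N a) / n.+1%:R) ^+ 2 = P / n.+1%:R / n.+1%:R.
  by rewrite /P; move: n0; set m := n.+1%:R => n0; field; rewrite gt_eqF.
by rewrite mulrC divfK ?gt_eqF// ler_pdivrMr// mulrC.
Qed.

Lemma ac_bounded a b f g x : ac a b f g -> a <= x <= b ->
  `|f x| <= `|f a| + \int[mu]_(t in `]a, b]) `|g t|.
Proof.
move=> acf /andP[ax xb].
have ab := le_trans ax xb.
have ign := integrable_normr (measurable_itv _) acf.1.
have H := ac_incr_le acf (lexx a) ax xb.
have : \int[mu]_(t in `]a, x]) `|g t| <= \int[mu]_(t in `]a, b]) `|g t|.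
  by rewrite (Rintegral_cat ax xb (lexx b) ign) lerDl Rintegral_ge0.
have := ler_normD (f a) (f x - f a); rewrite addrC subrK; lra.
Qed.

Lemma ac_integrable a b f g : a <= b -> ac a b f g ->
  mu.-integrable `]a, b] (EFin \o f).
Proof.
move=> ab acf; apply: (@integrable_itv_bnd true false).
apply: continuous_compact_integrable; first exact: segment_compact.
exact: ac_continuous acf.
Qed.

(** J is differentiable with derivative j, with a quadratic remainder that
    is uniform on bounded sets. This first-order Taylor estimate is the form
    in which the chain rule uses the Lipschitz continuity of the
    derivative. *)
Definition locally_C11 (J j : R -> R) := continuous j /\
  forall B : R, exists2 L : R, 0 <= L & forall x y, `|x| <= B -> `|y| <= B ->
    `|J y - J x - j x * (y - x)| <= L * (y - x) ^+ 2.

(** Adding the Taylor estimates at x and at y bounds (j x - j y)(y - x). *)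
Lemma locally_C11_lip (J j : R -> R) (B L : R) :
  (forall x y, `|x| <= B -> `|y| <= B ->
    `|J y - J x - j x * (y - x)| <= L * (y - x) ^+ 2) ->
  forall x y, `|x| <= B -> `|y| <= B -> `|j x - j y| <= 2 * L * `|y - x|.
Proof.
move=> H x y xB yB; have [->|xy] := eqVneq x y.
  by rewrite !subrr normr0 mulr0.
have yx0 : 0 < `|y - x| by rewrite normr_gt0 subr_eq0 eq_sym.
rewrite -(ler_pM2r yx0) -normrM -[leRHS]mulrA -(expr2 `|y - x|) real_normK ?num_real//.
have H1 := H _ _ xB yB; have H2 := H _ _ yB xB.
have -> : (j x - j y) * (y - x) = - (J y - J x - j x * (y - x)) -
   (J x - J y - j y * (x - y)) by ring.
rewrite (le_trans (ler_normB _ _))// normrN.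
have -> : 2 * L * (y - x) ^+ 2 = L * (y - x) ^+ 2 + L * (x - y) ^+ 2 by ring.
exact: lerD.
Qed.

(** Let N be the primitive of |g|. On [x, y], f moves by at most N y - N x,
    so both J(f y) - J(f x) and the integral of j(f) g differ from
    j(f x)(f y - f x) by O((N y - N x)^2). The difference of the two sides
    has increments quadratic in N, hence is constant. *)
Lemma ac_comp a b f g (J j : R -> R) : a <= b -> ac a b f g -> locally_C11 J j ->
  ac a b (J \o f) (fun x => j (f x) * g x).
Proof.
move=> ab acf [cj H].
pose B : R := `|f a| + \int[mu]_(t in `]a, b]) `|g t|.
have fB x : a <= x <= b -> `|f x| <= B by exact: ac_bounded.
have [L L0 HL] := H B.
have lip := locally_C11_lip HL.
have cjf : {within `[a, b], continuous (j \o f)}.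
  move=> x; apply: (@continuous_comp (subspace `[a, b]) R R f j); last exact: cj.
  exact: (ac_continuous ab acf).
have mjf : measurable_fun `]a, b] (j \o f).
  apply: (@measurable_funS _ _ _ _ `[a, b]) => //; first exact: subset_itv_oc_cc.
  exact: subspace_continuous_measurable_fun.
have ijg : mu.-integrable `]a, b] (EFin \o (fun x => j (f x) * g x)).
  apply: (@integrable_bounded_mul _ _ _ mu `]a, b] _ (j \o f) g (`|j (f a)| + 2 * L * (2 * B))) => //.
    move=> x /=; rewrite in_itv /= => /andP[ax xb].
    have hx : `|f x| <= B by apply: fB; rewrite (ltW ax).
    have ha : `|f a| <= B by apply: fB; rewrite lexx.
    have h1 := lip _ _ hx ha.
    have h2 : `|f a - f x| <= 2 * B.
      by rewrite (le_trans (ler_normB _ _))// mulrDl mul1r lerD.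
    have h3 := ler_normD (j (f a)) (j (f x) - j (f a)).
    rewrite addrC subrK in h3; apply: (le_trans h3); rewrite lerD2l (le_trans h1)//.
    by rewrite ler_wpM2l// mulr_ge0.
  exact: acf.1.
have ign := integrable_normr (measurable_itv _) acf.1.
pose N x := \int[mu]_(t in `]a, x]) `|g t|.
have NE x y : a <= x -> x <= y -> y <= b -> N y - N x = \int[mu]_(t in `]x, y]) `|g t|.
  by move=> ax xy yb; rewrite /N (Rintegral_cat ax xy yb ign) addrC addKr.
have cN : {within `[a, b], continuous N} by exact: integral_ub_continuous.
have ndN x y : a <= x -> x <= y -> y <= b -> N x <= N y.
  by move=> ax xy yb; rewrite -subr_ge0 NE// Rintegral_ge0.
(* the two sides of the chain rule; D is shown to be constant *)
pose D x := J (f x) - \int[mu]_(t in `]a, x]) (j (f t) * g t).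
have DN x y : a <= x -> x <= y -> y <= b -> `|D y - D x| <= 3 * L * (N y - N x) ^+ 2.
  move=> ax xy yb.
  have xB : `|f x| <= B by rewrite fB// ax (le_trans xy).
  have yB : `|f y| <= B by rewrite fB// (le_trans ax).
  have igxy := integrable_sub_itv ax yb acf.1.
  have incr (s : R) : x <= s -> s <= y -> `|f s - f x| <= N y - N x.
    move=> xs sy; have sb := le_trans sy yb.
    apply: (le_trans (ac_incr_le acf ax xs sb)).
    by rewrite -NE// lerD2r ndN// (le_trans ax).
  have -> : D y - D x = (J (f y) - J (f x) - j (f x) * (f y - f x)) +
      \int[mu]_(t in `]x, y]) (j (f x) * g t - j (f t) * g t).
    rewrite RintegralB//; last 2 first.
    - exact: integrable_mulcl.
    - exact: integrable_sub_itv ijg.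
    rewrite RintegralZl// (ac_incr acf ax xy yb) /D (Rintegral_cat ax xy yb ijg).
    ring.
  apply: (le_trans (ler_normD _ _)).
  have -> : 3 * L * (N y - N x) ^+ 2 = L * (N y - N x) ^+ 2 +
     2 * L * (N y - N x) * (N y - N x) by ring.
  apply: lerD.
    apply: (le_trans (HL _ _ xB yB)); rewrite ler_wpM2l//.
    rewrite -(@real_normK _ (f y - f x)) ?num_real//.
    by rewrite lerXn2r ?nnegrE ?subr_ge0 ?ndN// incr.
  have idiff : mu.-integrable `]x, y] (EFin \o (fun t => j (f x) * g t - j (f t) * g t)).
    have i1 : mu.-integrable `]x, y] (EFin \o (fun t => j (f x) * g t)).
      exact: integrable_mulcl.
    have i2 := integrable_sub_itv ax yb ijg.
    exact: integrable_sub.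
  apply: (le_trans (le_normr_Rintegral _ idiff)) => //.
  rewrite [in leRHS]NE// -RintegralZl//; last exact: integrable_sub_itv ign.
  apply: le_Rintegral => //.
  - exact: integrable_normr.
  - by apply: integrable_mulcl => //; exact: integrable_sub_itv ign.
  move=> t /=; rewrite in_itv /= => /andP[xt ty].
  rewrite -mulrBl normrM ler_wpM2r//.
  have tB : `|f t| <= B by rewrite fB// (le_trans ax (ltW xt)) (le_trans ty).
  apply: (le_trans (lip _ _ xB tB)); rewrite -NE// ler_wpM2l ?mulr_ge0// incr//.
  exact: ltW.
split => // x /andP[ax xb].
have DE : D x = D a.
  have cNx : {within `[a, x], continuous N}.
    by apply: continuous_subspaceW cN; apply: subset_itvl; rewrite bnd_simp.
  have ndNx u v : a <= u -> u <= v -> v <= x -> N u <= N v.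
    by move=> au uv vx; rewrite ndN// (le_trans vx).
  have L3 : 0 <= 3 * L by rewrite mulr_ge0.
  apply/le_anti/andP; split.
    apply: (quadratic_increment_le ax L3 cNx ndNx) => u v au uv vx.
    by apply: le_trans (DN u v _ _ _) => //; [exact: ler_norm|exact: le_trans xb].
  rewrite -lerN2; apply: (@quadratic_increment_le a x N (fun z => - D z) (3 * L) ax L3 cNx ndNx) => u v au uv vx.
  apply: le_trans (DN u v _ _ _) => //; last exact: le_trans xb.
  by have := ler_norm (- (D v - D u)); rewrite normrN opprB opprK addrC.
move: DE; rewrite /D /=.
have -> : `]a, a]%classic = set0 :> set R by rewrite set_itv_ge// bnd_simp ltxx.
by rewrite Rintegral_set0 subr0 => <-; rewrite subrK.
Qed.

Lemma ac_ae a b f g f' g' : ac a b f g -> (forall x, a <= x <= b -> f x = f' x) ->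
  measurable_fun `]a, b] g' -> ae_eq mu `]a, b]%classic g g' -> ac a b f' g'.
Proof.
move=> [ig fE] ff' mg' gg'.
have mg := integrable_measurable ig.
split.
  apply/integrableP; split; first exact/measurable_EFinP.
  have /integrableP[_] := ig; congr (_ < _)%E; apply: ae_eq_integral => //.
  - by apply: measurableT_comp => //; exact/measurable_EFinP.
  - by apply: measurableT_comp => //; exact/measurable_EFinP.
  - by apply: filterS gg' => x h Dx /=; rewrite h.
move=> x /andP[ax xb]; rewrite -!ff' ?ax ?lexx ?(le_trans ax)//.
rewrite fE ?ax//; congr (_ + _); rewrite /Rintegral; congr fine.
have sub : `]a, x] `<=` `]a, b] by apply: subset_itvl; rewrite bnd_simp.
apply: ae_eq_integral => //.
- by apply/measurable_EFinP; exact: measurable_funS mg.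
- by apply/measurable_EFinP; exact: measurable_funS mg'.
- by apply: filterS gg' => t h Dt /=; rewrite h//; exact: sub.
Qed.

Lemma ac_ext a b f g f' g' : ac a b f g -> (forall x, a <= x <= b -> f x = f' x) ->
  (forall x, a < x <= b -> g x = g' x) -> ac a b f' g'.
Proof.
move=> acf ff' gg'.
have gg : {in `]a, b]%classic, g =1 g'}.
  by move=> x; rewrite inE /= in_itv /=; exact: gg'.
apply: (ac_ae acf ff').
  apply: eq_measurable_fun (integrable_measurable acf.1).
  exact: gg.
by apply: aeW => x Dx; apply: gg; rewrite inE.
Qed.

Lemma ac_subitv a b x f g : ac a b f g -> a <= x <= b -> ac a x f g.
Proof.
move=> [ig fE] /andP[ax xb]; split; first exact: integrable_sub_itv ig.
by move=> y /andP[ay yx]; apply: fE; rewrite ay (le_trans yx).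
Qed.

Lemma ac_integral a b c g : mu.-integrable `]a, b] (EFin \o g) ->
  ac a b (fun x => c + \int[mu]_(t in `]a, x]) g t) g.
Proof.
move=> ig; split => // x _.
have -> : `]a, a]%classic = set0 :> set R by rewrite set_itv_ge// bnd_simp ltxx.
by rewrite Rintegral_set0 addr0.
Qed.

Lemma ac_cst a b c : ac a b (cst c) (cst 0).
Proof.
split; first by have := @integrable0 _ _ R mu `]a, b]; apply: eq_integrable.
by move=> x _; rewrite /= Rintegral_cst// mul0r addr0.
Qed.

Lemma ac_add a b f1 g1 f2 g2 : ac a b f1 g1 -> ac a b f2 g2 ->
  ac a b (fun x => f1 x + f2 x) (fun x => g1 x + g2 x).
Proof.
move=> [i1 e1] [i2 e2]; split; first exact: integrable_add.
move=> x /andP[ax xb]; rewrite RintegralD//; last 2 first.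
- exact: integrable_sub_itv i1.
- exact: integrable_sub_itv i2.
by rewrite e1 ?ax// e2 ?ax//; ring.
Qed.

Lemma ac_scale a b c f g : ac a b f g -> ac a b (fun x => c * f x) (fun x => c * g x).
Proof.
move=> [i1 e1]; split; first exact: integrable_mulcl.
move=> x /andP[ax xb]; rewrite RintegralZl//; last exact: integrable_sub_itv i1.
by rewrite e1 ?ax// mulrDr.
Qed.

Lemma ac_linear a b c : a <= b -> ac a b (fun t => c * t) (cst c).
Proof.
move=> ab; have acid : ac a b (fun t => a + \int[mu]_(s in `]a, t]) 1) (cst 1).
  apply: ac_integral; apply: measurable_bounded_integrable => //.
    have := lebesgue_measure_itv (Interval (BRight a) (BRight b)) => /= ->.
    by case: ifP => _; rewrite ?ltry// -EFinB ltry.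
  by exists 1; split => // B B1 t _; rewrite /= normr1 ltW.
apply: ac_ext (ac_scale c acid) _ _.
- move=> t /andP[at' _]; rewrite Rintegral_cst//= lebesgue_measure_itv /= lte_fin.
  by move: at'; rewrite le_eqVlt => /orP[/eqP<-|->]; rewrite /= ?ltxx /=; ring.
- by move=> t _; rewrite /= mulr1.
Qed.

Lemma ac_sub a b f1 g1 f2 g2 : ac a b f1 g1 -> ac a b f2 g2 ->
  ac a b (fun x => f1 x - f2 x) (fun x => g1 x - g2 x).
Proof.
move=> h1 /(ac_scale (-1)) /(ac_add h1) h; apply: ac_ext h _ _ => x _; ring.
Qed.

Lemma locally_C11_sqr : locally_C11 (fun x : R => x ^+ 2) (fun x => 2 * x).
Proof.
split=> [x|B]; first by apply: cvgM; [exact: cvg_cst|exact: cvg_id].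
exists 1 => // x y _ _; rewrite (_ : _ - _ = (y - x) ^+ 2); last by ring.
by rewrite ger0_norm ?sqr_ge0// mul1r.
Qed.

(** Polarization: 2 f g = (f + g)^2 - f^2 - g^2 reduces the product rule to
    the chain rule for the square. *)
Lemma ac_mul a b f1 g1 f2 g2 : a <= b -> ac a b f1 g1 -> ac a b f2 g2 ->
  ac a b (fun x => f1 x * f2 x) (fun x => g1 x * f2 x + f1 x * g2 x).
Proof.
move=> ab h1 h2.
have q1 := ac_comp ab h1 locally_C11_sqr.
have q2 := ac_comp ab h2 locally_C11_sqr.
have q := ac_comp ab (ac_add h1 h2) locally_C11_sqr.
have := ac_scale 2^-1 (ac_sub (ac_sub q q1) q2).
by move=> h; apply: ac_ext h _ _ => x _ /=; field.
Qed.

Lemma ac_ftc a b f g : a <= b -> ac a b f g ->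
  \int[mu]_(t in `]a, b]) g t = f b - f a.
Proof. by move=> ab acf; rewrite (ac_incr acf). Qed.

(** The remainder exp h - 1 - h is squeezed between 0 and h (exp h - 1) by
    the inequality exp h >= 1 + h at h and at - h. *)
Lemma locally_C11_expR : locally_C11 (@expR R) (@expR R).
Proof.
split=> [|B]; first exact: continuous_expR.
exists (expR B * expR (2 * B)) => [|x y xB yB]; first by rewrite mulr_ge0 ?expR_ge0.
set h := y - x.
have hB : `|h| <= 2 * B by rewrite (le_trans (ler_normB _ _))// mulrDl mul1r lerD.
have -> : expR y = expR x * expR h by rewrite -expRD /h addrC subrK.
have -> : expR x * expR h - expR x - expR x * h = expR x * (expR h - 1 - h) by ring.
rewrite normrM (ger0_norm (expR_ge0 _)) -mulrA.
have xB' : expR x <= expR B by rewrite ler_expR (le_trans (ler_norm _)).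
apply: ler_pM; rewrite ?expR_ge0//.
have h1 := expR_ge1Dx h; have h2 := expR_ge1Dx (- h).
rewrite ger0_norm; last by lra.
have h3 : expR h * (1 - h) <= 1.
  by rewrite -[leRHS](expRxMexpNx_1 h) ler_wpM2l ?expR_ge0.
have h4 : expR h - 1 - h <= h * (expR h - 1) by lra.
apply: (le_trans h4).
have [h0|h0] := leP 0 h.
  have eB : expR h <= expR (2 * B) by rewrite ler_expR (le_trans (ler_norm _)).
  have e2 : expR h - 1 <= h * expR h by lra.
  have e3 : h * expR h <= h * expR (2 * B) by rewrite ler_wpM2l.
  have -> : expR (2 * B) * h ^+ 2 = h * (h * expR (2 * B)) by ring.
  by rewrite ler_wpM2l// (le_trans e2).
have B0 : 0 <= 2 * B by rewrite (le_trans _ hB).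
have e2 : 1 <= expR (2 * B) by rewrite -[leLHS](@expR0 R) ler_expR.
have -> : h * (expR h - 1) = (- h) * (1 - expR h) by ring.
have e3 : - h * (1 - expR h) <= - h * - h by apply: ler_wpM2l; lra.
by apply: (le_trans e3); rewrite mulrNN -expr2 ler_peMl// sqr_ge0.
Qed.

Definition pos (s : R) := Num.max s 0.

Lemma pos_ge0 s : 0 <= pos s. Proof. by rewrite /pos le_max lexx orbT. Qed.

Lemma pos_if s : pos s = if 0 <= s then s else 0.
Proof. by rewrite /pos; case: leP => [h|h]; rewrite ?max_l ?max_r// ltW. Qed.

Lemma mul_pos s : s * pos s = pos s ^+ 2.
Proof. by rewrite pos_if; case: ifP => _; rewrite ?mulr0 ?expr0n// expr2. Qed.

Lemma continuous_pos : continuous pos.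
Proof. by move=> x; apply: (@continuous_max _ _ id (cst 0)) => //; exact: cvg_cst. Qed.

Lemma locally_C11_pos_sqr :
  locally_C11 (fun s => pos s ^+ 2) (fun s => 2 * pos s).
Proof.
split=> [x|B].
  by apply: cvgM; [exact: cvg_cst|exact: continuous_pos].
exists 1 => // x y _ _; rewrite mul1r !pos_if.
have hx := sqr_ge0 x; have hy := sqr_ge0 y; have hQ := sqr_ge0 (y - x).
have [y0|y0] := leP 0 y; have [x0|x0] := leP 0 x;
  rewrite ler_norml ?expr0n /=; apply/andP.
- split; lra.
- by have h : 0 <= y * - x; [apply: mulr_ge0 => //; lra|split; lra].
- by have h : 0 <= x * - y; [apply: mulr_ge0 => //; lra|split; lra].
- split; lra.
Qed.

(** The cube is the lowest power of the positive part for which the chain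
    rule applies both to the power and to its derivative, the test function
    of the energy estimate. *)
Lemma locally_C11_pos_cube :
  locally_C11 (fun s => pos s ^+ 3) (fun s => 3 * pos s ^+ 2).
Proof.
split=> [x|B].
  apply: cvgM; first exact: cvg_cst.
  rewrite (_ : (fun s => pos s ^+ 2) = pos \* pos); last first.
    by apply/funext => s; rewrite expr2.
  by apply: cvgM; exact: continuous_pos.
exists (5 * `|B|) => [|x y]; first by rewrite mulr_ge0.
move=> /le_trans/(_ (ler_norm B)) xB /le_trans/(_ (ler_norm B)) yB.
move: xB yB; rewrite !ler_norml; move: `|B| => C /andP[xB1 xB2] /andP[yB1 yB2].
have C0 : 0 <= C by lra.
have Q0 := sqr_ge0 (y - x); have hx := sqr_ge0 x; have hy := sqr_ge0 y.
have CQ := mulr_ge0 C0 Q0.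
rewrite !pos_if.
have [y0|y0] := leP 0 y; have [x0|x0] := leP 0 x; rewrite ?expr0n /=; apply/andP.
- have h1 : 0 <= (y + 2 * x) * (y - x) ^+ 2 by apply: mulr_ge0 => //; lra.
  have h2 : 0 <= (3 * C - (y + 2 * x)) * (y - x) ^+ 2 by apply: mulr_ge0 => //; lra.
  split; lra.
- have h0 : 0 <= y * - x by apply: mulr_ge0 => //; lra.
  have h1 : 0 <= y * y ^+ 2 by apply: mulr_ge0.
  have h2 : 0 <= (C - y) * y ^+ 2 by apply: mulr_ge0 => //; lra.
  have h3 : 0 <= C * ((y - x) ^+ 2 - y ^+ 2) by apply: mulr_ge0 => //; lra.
  split; lra.
- have h0 : 0 <= x * - y by apply: mulr_ge0 => //; lra.
  have h1 : 0 <= (2 * x - 3 * y) * x ^+ 2 by apply: mulr_ge0 => //; lra.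
  have h2 : 0 <= (5 * C - (2 * x - 3 * y)) * x ^+ 2 by apply: mulr_ge0 => //; lra.
  have h3 : 0 <= C * ((y - x) ^+ 2 - x ^+ 2) by apply: mulr_ge0 => //; lra.
  split; lra.
- split; lra.
Qed.

End ac.

(** * The du Bois-Reymond lemma *)

Section almost_everywhere_rules.
Context d (X : measurableType d) (R : realType) (nu : {measure set X -> \bar R}).
Implicit Types P Q S : X -> Prop.

Lemma ae_imp P Q : (forall x, P x -> Q x) ->
  {ae nu, forall x, P x} -> {ae nu, forall x, Q x}.
Proof. exact: filterS. Qed.

Lemma ae_imp2 P Q S : (forall x, P x -> Q x -> S x) ->
  {ae nu, forall x, P x} -> {ae nu, forall x, Q x} -> {ae nu, forall x, S x}.
Proof. exact: filterS2. Qed.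

Lemma ae_and P Q : {ae nu, forall x, P x} -> {ae nu, forall x, Q x} ->
  {ae nu, forall x, P x /\ Q x}.
Proof. by apply: ae_imp2. Qed.

End almost_everywhere_rules.

Lemma ae_forall_count (I : countType) d (T : measurableType d) (R : realType)
    (nu : {measure set T -> \bar R}) (P : I -> T -> Prop) :
  (forall i, {ae nu, forall x, P i x}) -> {ae nu, forall x, forall i, P i x}.
Proof.
move=> H; have : {ae nu, forall x, forall n : nat,
    if (@unpickle I n) is Some i then P i x else True}.
  apply: ae_foralln => n; case: unpickle => [i|]; [exact: H|exact: aeW].
by apply: filterS => x h i; have := h (pickle i); rewrite pickleK.
Qed.

Section variations.
Variable R : realType.
Local Notation mu := (@lebesgue_measure R).
Implicit Types (f g h : R -> R) (a b p q x c : R).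

Lemma Rintegral_supp (A B : set R) f : (forall x, A x -> ~ B x -> f x = 0) ->
  (forall x, B x -> ~ A x -> f x = 0) ->
  \int[mu]_(x in A) f x = \int[mu]_(x in B) f x.
Proof.
move=> fA fB; rewrite Rintegral_mkcond [RHS]Rintegral_mkcond; congr Rintegral.
apply/funext => x; rewrite !patchE.
have [xA|xA] := boolP (x \in A); have [xB|xB] := boolP (x \in B) => //.
- by apply: fA; [exact: set_mem|move=> h; move/negP: xB; apply; rewrite inE].
- by apply/esym/fB; [exact: set_mem|move=> h; move/negP: xA; apply; rewrite inE].
Qed.

(** By the Lebesgue differentiation theorem the primitive of h, here
    constantly 0, has derivative h almost everywhere. *)
Lemma ae_eq0_interval a b h : a < b -> mu.-integrable `]a, b] (EFin \o h) ->
  (forall x, a < x < b -> \int[mu]_(t in `]a, x]) h t = 0) ->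
  ae_eq mu `]a, b[%classic h (cst 0).
Proof.
move=> ab ih h0; pose f := h \_ `]a, b].
have If : mu.-integrable setT (EFin \o f).
  apply: (@integrable_extend _ _ _ mu `]a, b]%classic) => //.
    by move=> x xab; rewrite /f patchE memNset.
  apply: eq_integrable ih => // x xab.
  by rewrite /= /f patchE xab.
have If' (y : R) : mu.-integrable [set` Interval (BRight a) (BRight y)] (EFin \o f).
  exact: integrableS If.
have lf : locally_integrable [set: R] f by apply: open_integrable_locally => //; exact: openT.
have := FTC1 If' lf; apply: filterS; first exact: (ae_filter_ringOfSetsType mu).
move=> x H; rewrite /= in_itv /= => /andP[ax xb].
have [_] := H ax; rewrite /f patchE mem_set /=; last by rewrite in_itv /= ax ltW.
move=> <-; rewrite derive1E.
rewrite -(@near_eq_derive _ _ _ (cst 0)) ?derive_cst//.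
near=> y; apply/esym.
have /andP[ay yb] : a < y < b.
  by apply/andP; split; near: y; [exact: lt_nbhsr|exact: lt_nbhsl].
rewrite -(h0 y) ?ay//; apply: eq_Rintegral => t; rewrite inE /= in_itv /= => /andP[xt ty].
by rewrite patchE mem_set//= in_itv /= xt (le_trans ty) ?ltW.
Unshelve. all: by end_near. Qed.

(** Rational end points suffice because the primitive is continuous. They
    keep the family of null sets countable, and staying away from a and b
    makes the lemma apply to locally integrable functions. *)
Lemma ae_eq0_rational_intervals a b h :
  (forall p q, a < p -> p < q -> q < b -> mu.-integrable `]p, q] (EFin \o h)) ->
  (forall p q : rat, a < ratr p -> (ratr p : R) < ratr q -> ratr q < b ->
    \int[mu]_(t in `]ratr p, ratr q]) h t = 0) ->
  ae_eq mu `]a, b[%classic h (cst 0).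
Proof.
move=> ih h0.
have H (pq : rat * rat) : {ae mu, forall x : R,
    a < ratr pq.1 -> (ratr pq.1 : R) < x < ratr pq.2 -> ratr pq.2 < b -> h x = 0}.
  case: pq => p q /=.
  have [pq|] := ltP (ratr p : R) (ratr q); last first.
    move=> qp; apply: aeW => x _ /andP[px xq] _.
    by have := lt_le_trans (lt_trans px xq) qp; rewrite ltxx.
  have [ap|pa] := ltP a (ratr p); last by apply: aeW.
  have [qb|bq] := ltP (ratr q) b; last by apply: aeW.
  have ipq := ih _ _ ap pq qb.
  have : ae_eq mu `](ratr p : R), ratr q[%classic h (cst 0).
    apply: (ae_eq0_interval pq ipq) => x /andP[px xq].
    apply/eqP; apply/negPn/negP => Fx.
    have cF := integral_ub_continuous (ltW pq) ipq.
    have [cFx _ _] := (continuous_within_itvP _ pq).1 cF.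
    have /cFx/cvgrPdist_lt : x \in `](ratr p : R), ratr q[ by rewrite in_itv /= px.
    have : 0 < `|\int[mu]_(t in `](ratr p), x]) h t| by rewrite normr_gt0.
    move=> /[swap] /[apply] -[e /= e0 He].
    have [r] : exists r, ratr r \in `]x, (Num.min (x + e) (ratr q))[.
      by apply: rat_in_itvoo; rewrite lt_min ltrDl e0.
    rewrite in_itv /= lt_min => /and3P[xr rxe rq].
    have := He (ratr r); rewrite /ball /=.
    rewrite h0// ?subr0 ?ltxx//; last 2 first.
    - exact: lt_trans xr.
    - exact: lt_trans qb.
    suff h1 : `|x - ratr r| < e by move=> /(_ h1).
    by rewrite ltr_distlC rxe (lt_trans _ xr)// gtrBl.
  by apply: filterS => x hx _ xpq _; apply: hx; rewrite /= in_itv.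
have := ae_forall_count H; apply: filterS => x hx; rewrite /= in_itv /= => /andP[ax xb].
have [p] := rat_in_itvoo ax; have [q] := rat_in_itvoo xb.
rewrite !in_itv /= => /andP[xq qb] /andP[ap px].
by apply: (hx (p, q)) => //=; rewrite px.
Qed.

Lemma continuous_bump p q n : continuous (bumpf p q n).
Proof. by apply: smooth_continuous; exact: smooth_bump. Qed.

Lemma integrable_bump_mul a b (k : R -> R) p q n : mu.-integrable `]a, b] (EFin \o k) ->
  mu.-integrable `]a, b] (EFin \o (fun x => k x * bumpf p q n x)).
Proof.
move=> Ik; have := @integrable_bounded_mul _ _ _ mu `]a, b]%classic _ (bumpf p q n) k 1.
move=> H; apply: eq_integrable (H _ _ _ Ik) => //.
- by move=> x _ /=; rewrite mulrC.
- apply: (@measurable_funS _ _ _ _ setT) => //; apply: continuous_measurable_fun.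
  exact: continuous_bump.
- by move=> x _; rewrite ger0_norm ?bump_ge0 ?bump_le1.
Qed.

(** Dominated convergence, with |h| as the dominating function. *)
Lemma bump_integral_cvg p q h : mu.-integrable `]p, q] (EFin \o h) ->
  \int[mu]_(x in `]p, q]) (h x * bumpf p q n x) @[n --> \oo] -->
  \int[mu]_(x in `]p, q]) h x.
Proof.
move=> ih.
have ih' : mu.-integrable `]p, q[ (EFin \o h) by exact: (@integrable_itv_bnd _ false false false true).
have mh := integrable_measurable ih'.
have mb n : measurable_fun `]p, q[ (bumpf p q n).
  apply: (@measurable_funS _ _ _ _ setT) => //; apply: continuous_measurable_fun.
  by apply: smooth_continuous; exact: smooth_bump.
have ihb n : mu.-integrable `]p, q[ (EFin \o (fun x => h x * bumpf p q n x)).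
  have := @integrable_bounded_mul _ _ _ mu `]p, q[%classic _ (bumpf p q n) h 1.
  move=> H; apply: eq_integrable (H _ _ _ ih') => //.
  - by move=> x _ /=; rewrite mulrC.
  - exact: mb.
  - by move=> x _; rewrite ger0_norm ?bump_ge0 ?bump_le1.
have := @dominated_convergence _ _ _ mu `]p, q[%classic (measurable_itv _)
  (fun n x => (h x * bumpf p q n x)%:E) (fun x => (h x)%:E) (fun x => `|h x|%:E).
case.
- by move=> n; apply/measurable_EFinP; exact: integrable_measurable (ihb n).
- exact/measurable_EFinP.
- apply: aeW => x xpq; apply: cvg_EFin; first by near=> n.
  rewrite -[X in _ --> X]mulr1; apply: cvgM; first exact: cvg_cst.
  by apply: bump_cvg; move: xpq.
- exact: integrable_normr.
- apply: aeW => x n _ /=; rewrite lee_fin normrM ler_piMr//.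
  by rewrite ger0_norm ?bump_ge0 ?bump_le1.
move=> _ _; rewrite -(fineK (integrable_fin_num _ ih'))// => /fine_cvg H.
have -> : \int[mu]_(x in `]p, q]) h x = \int[mu]_(x in `]p, q[) h x.
  by rewrite Rintegral_itv_bndo_bndc.
have -> : (fun n => \int[mu]_(x in `]p, q]) (h x * bumpf p q n x)) =
   (fun n => \int[mu]_(x in `]p, q[) (h x * bumpf p q n x)).
  by apply/funext => n; rewrite Rintegral_itv_bndo_bndc.
apply: cvg_trans H _.
Unshelve. all: by end_near. Qed.

Lemma bump_supp p q n x : ~ `]p, q]%classic x -> bumpf p q n x = 0.
Proof.
move=> xpq; apply: bump_out; apply/negP => h; apply: xpq => /=.
by apply: subset_itv_oo_oc.
Qed.

Lemma bump_supp_cc p q n x : x \notin `[p, q] -> bumpf p q n x = 0.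
Proof.
move=> h; apply: bump_out; apply: contra h; exact: subset_itv_oo_cc.
Qed.

Lemma ae_eq0_bump a b h :
  (forall p q, a < p -> p < q -> q < b -> mu.-integrable `]p, q] (EFin \o h)) ->
  (forall (p q : rat) n, a < ratr p -> (ratr p : R) < ratr q -> ratr q < b ->
    \int[mu]_(t in `]a, b[) (h t * bumpf (ratr p) (ratr q) n t) = 0) ->
  ae_eq mu `]a, b[%classic h (cst 0).
Proof.
move=> ih hb; apply: ae_eq0_rational_intervals => // p q ap pq qb.
have := bump_integral_cvg (ih _ _ ap pq qb).
have -> : (fun n => \int[mu]_(x in `](ratr p : R), ratr q])
    (h x * bumpf (ratr p) (ratr q) n x)) = cst 0.
  apply/funext => n /=; rewrite -(hb p q n ap pq qb); apply: Rintegral_supp => x.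
    move=> /= + nx; rewrite in_itv /= => /andP[px xq]; exfalso; apply: nx => /=.
    by rewrite in_itv /= (lt_trans ap) ?(le_lt_trans xq).
  by move=> _ nx; rewrite bump_supp ?mulr0.
by move=> /cvg_lim <- //; rewrite lim_cst.
Qed.

Lemma exists_bump_integral_neq0 p q : p < q ->
  exists n, \int[mu]_(x in `]p, q]) bumpf p q n x != 0.
Proof.
move=> pq; apply: contrapT => /forallNP H.
have i1 : mu.-integrable `]p, q] (EFin \o cst (1 : R)).
  apply: measurable_bounded_integrable => //.
    by rewrite /= lebesgue_measure_itv /= lte_fin pq -EFinB ltry.
  exact: bounded_cst.
have := bump_integral_cvg i1.
have -> : (fun n => \int[mu]_(x in `]p, q]) (cst 1 x * bumpf p q n x)) = cst 0.
  apply/funext => n /=; have /negP := H n; rewrite negbK => /eqP <-.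
  by apply: eq_Rintegral => x _; rewrite mul1r.
move=> /cvg_lim; rewrite lim_cst// => /(_ (@Rhausdorff R)).
rewrite Rintegral_cst// mul1r /= lebesgue_measure_itv /= lte_fin pq -EFinB /= => h.
by move: pq; rewrite -subr_gt0 -h ltxx.
Qed.

Lemma Rintegral_oo_oc a b f : mu.-integrable `]a, b] (EFin \o f) ->
  \int[mu]_(x in `]a, b[) f x = \int[mu]_(x in `]a, b]) f x.
Proof.
by move=> h; apply: Rintegral_itv_bndo_bndc; exact: (@integrable_itv_bnd _ false false false true).
Qed.

Lemma ac_primitive (f : R -> R) p q a b : continuous f ->
  (forall x, x \notin `[p, q] -> f x = 0) -> ac a b (primitive f) f.
Proof.
move=> cf f0; have If D : measurable D -> mu.-integrable D (EFin \o f).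
  exact: continuous_supp_integrable f0 D.
split=> [|x /andP[ax xb]]; first exact: If.
rewrite -(@Rintegral_itvB _ f -oo%O (BRight x) a) ?bnd_simp//; last exact: If.
by rewrite addrCA subrr addr0.
Qed.

(** Let G be the primitive of g. For a test function whose derivative is
    eta, the weak identity and an integration by parts say that f - G is
    orthogonal to eta. Every bump minus a multiple of a fixed bump rho, with
    the multiple chosen to cancel the integral, is such an eta. Hence the
    integral of (f - G) against a bump is a constant c times the integral of
    the bump, and f - G - c vanishes almost everywhere. *)
Lemma du_bois_reymond a b f g : a < b ->
  mu.-integrable `]a, b] (EFin \o f) -> mu.-integrable `]a, b] (EFin \o g) ->
  (forall phi, test_fun a b phi ->
    \int[mu]_(x in `]a, b[) (f x * derive1 phi x) =
    - \int[mu]_(x in `]a, b[) (g x * phi x)) ->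
  exists c, ae_eq mu `]a, b[%classic f (fun x => c + \int[mu]_(t in `]a, x]) g t).
Proof.
move=> ab If Ig wd.
(* any interval compactly contained in ]a, b[ can carry rho *)
pose a' := a + (b - a) / 3; pose b' := a + 2 * (b - a) / 3.
have aa' : a < a' by rewrite /a'; lra.
have a'b' : a' < b' by rewrite /a' /b'; lra.
have b'b : b' < b by rewrite /b'; lra.
have [n0 rho0] := exists_bump_integral_neq0 a'b'.
pose rho := bumpf a' b' n0.
pose G x := \int[mu]_(t in `]a, x]) g t.
have acG : ac a b G g.
  by have := ac_integral 0 Ig; move=> h; apply: ac_ext h _ _ => // x _; rewrite add0r.
have bumpE p q n : a < p -> q < b ->
    \int[mu]_(x in `]a, b]) bumpf p q n x = \int[mu]_(x in `]p, q]) bumpf p q n x.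
  move=> ap qb; apply: Rintegral_supp => x.
    by move=> _ nx; rewrite bump_supp.
  move=> /= + nx; rewrite in_itv /= => /andP[px xq]; exfalso; apply: nx => /=.
  by rewrite in_itv /= (lt_trans ap) ?(le_trans xq) ?ltW.
have Ib p q n D : measurable D -> mu.-integrable D (EFin \o bumpf p q n).
  apply: (@continuous_supp_integrable _ _ p q); first exact: continuous_bump.
  by move=> x; exact: bump_supp_cc.
have Im := @integrable_bump_mul a b.
have IG : mu.-integrable `]a, b] (EFin \o G) by exact: ac_integrable (ltW ab) acG.
pose h x := f x - G x.
have Ih : mu.-integrable `]a, b] (EFin \o h) by exact: integrable_sub.
pose I k := \int[mu]_(x in `]a, b]) k x.
have key p q n : a < p -> p < q -> q < b ->
    I (fun x => h x * bumpf p q n x) * I rho = I (bumpf p q n) * I (fun x => h x * rho x).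
  move=> ap pq qb.
  pose s := I (bumpf p q n) / I rho.
  have rho0' : I rho != 0 by rewrite /I bumpE.
  (* s makes the integral of eta vanish, so that eta is the derivative of a
     test function *)
  pose eta x := bumpf p q n x - s * rho x.
  have ceta : continuous eta.
    by move=> x; apply: cvgB; [exact: continuous_bump|apply: cvgM; [exact: cvg_cst|exact: continuous_bump]].
  have seta : smooth eta.
    have -> : eta = bumpf p q n + cst (- s) * rho.
      by apply/funext => x; rewrite /eta !fctE; ring.
    apply: smoothD; first exact: smooth_bump.
    by apply: smoothM; [exact: smooth_cst|exact: smooth_bump].
  (* an interval containing both supports *)
  pose P := Num.min p a'; pose Q := Num.max q b'.
  have eta0 x : x \notin `[P, Q] -> eta x = 0.
    rewrite in_itv /= /P /Q => hx; rewrite /eta /rho !bump_supp_cc ?mulr0 ?subr0//.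
      apply: contra hx; rewrite in_itv /= => /andP[h1 h2].
      by rewrite ge_min h1 orbT le_max h2 orbT.
    apply: contra hx; rewrite in_itv /= => /andP[h1 h2].
    by rewrite ge_min h1 le_max h2.
  have aP : a < P by rewrite /P lt_min ap.
  have Qb : Q < b by rewrite /Q gt_max qb.
  have Ieta0 : I eta = 0.
    rewrite /I /eta RintegralB//; [|exact: Ib|by apply: integrable_mulcl => //; exact: Ib].
    rewrite RintegralZl//; last exact: Ib.
    by rewrite -/(I _) -/(I rho) /s divfK// subrr.
  have PQeta : \int[mu]_(t in `[P, Q]) eta t = 0.
    rewrite -Ieta0; apply: Rintegral_supp => x.
      move=> /= + nx; rewrite in_itv /= => /andP[px xq]; exfalso; apply: nx => /=.
      by rewrite in_itv /= (lt_le_trans aP px) (le_trans xq (ltW Qb)).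
    by move=> _ nx; apply: eta0; apply/negP.
  pose phi := primitive eta.
  have tphi : test_fun a b phi by exact: (@test_fun_primitive _ _ P Q).
  have acphi : ac a b phi eta by exact: ac_primitive eta0.
  have phia : phi a = 0 by rewrite /phi (primitive_left eta0).
  have phib : phi b = 0 by rewrite /phi (primitive_right eta0) ?ltW.
  have prod := ac_mul (ltW ab) acG acphi.
  have := ac_ftc (ltW ab) prod; rewrite phia phib !mulr0 subrr.
  have mphi := ac_measurable (ltW ab) acphi.
  have Igphi : mu.-integrable `]a, b] (EFin \o (fun x => g x * phi x)).
    have := @integrable_bounded_mul _ _ _ mu `]a, b]%classic _ phi g
      (`|phi a| + \int[mu]_(t in `]a, b]) `|eta t|).
    move=> H; apply: eq_integrable (H _ mphi _ Ig) => //.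
      by move=> x _ /=; rewrite mulrC.
    move=> x /=; rewrite in_itv /= => /andP[ax xb]; apply: ac_bounded acphi _.
    by rewrite xb ltW.
  have Imeta k : mu.-integrable `]a, b] (EFin \o k) ->
      mu.-integrable `]a, b] (EFin \o (fun x => k x * eta x)).
    move=> Ik.
    have := @integrable_sub _ _ _ mu _ (measurable_itv _) _ _ (Im k p q n Ik)
      (@integrable_mulcl _ _ _ mu _ (measurable_itv _) s _ (Im k a' b' n0 Ik)).
    by apply: eq_integrable => // x _; rewrite /= /eta /rho; congr EFin; ring.
  rewrite RintegralD//; last exact: Imeta.
  move=> e1.
  have := wd _ tphi; rewrite (derive1_primitive ceta eta0).
  rewrite Rintegral_oo_oc; last exact: Imeta.
  rewrite Rintegral_oo_oc// => e2.
  have e3 : I (fun x => h x * eta x) = 0.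
    have -> : I (fun x => h x * eta x) = I (fun x => f x * eta x - G x * eta x).
      by apply: eq_Rintegral => x _; rewrite /h mulrBl.
    rewrite /I RintegralB//; [|exact: Imeta|exact: Imeta].
    by rewrite e2; apply/eqP; rewrite subr_eq0 eq_sym -addr_eq0 addrC e1.
  have e4 : I (fun x => h x * eta x) =
      I (fun x => h x * bumpf p q n x) - s * I (fun x => h x * rho x).
    rewrite /I -RintegralZl//; last exact: Im.
    rewrite -RintegralB//; [|exact: Im|by apply: integrable_mulcl => //; exact: Im].
    by apply: eq_Rintegral => x _; rewrite /eta; ring.
  move: e3; rewrite e4 /s => /eqP; rewrite subr_eq0 => /eqP ->.
  by field.
pose c := I (fun x => h x * rho x) / I rho.
exists c.
(* dividing the relation key by the integral of rho shows that h - c is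
   orthogonal to all bumps *)
have : ae_eq mu `]a, b[%classic (fun x => h x - c) (cst 0).
  apply: ae_eq0_bump.
    move=> p q ap pq qb; apply: (@integrable_sub_itv _ a b) => //; try exact: ltW.
    apply: integrable_sub => //.
    apply: measurable_bounded_integrable => //.
      by rewrite /= lebesgue_measure_itv /= lte_fin ab -EFinB ltry.
    exact: bounded_cst.
  move=> p q n ap pq qb.
  rewrite Rintegral_oo_oc; last first.
    have := @integrable_sub _ _ _ mu _ (measurable_itv _) _ _ (Im h (ratr p) (ratr q) n Ih)
      (@integrable_mulcl _ _ _ mu _ (measurable_itv _) c _ (Ib (ratr p) (ratr q) n `]a, b]%classic _)).
    move=> /(_ (measurable_itv _)).
    apply: eq_integrable => //.
    by move=> x _; rewrite /= [in RHS]mulrBl.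
  have -> : \int[mu]_(x in `]a, b]) ((h x - c) * bumpf (ratr p) (ratr q) n x) =
      I (fun x => h x * bumpf (ratr p) (ratr q) n x - c * bumpf (ratr p) (ratr q) n x).
    by apply: eq_Rintegral => x _; rewrite mulrBl.
  rewrite /I RintegralB//; [|exact: Im|by apply: integrable_mulcl => //; exact: Ib].
  rewrite RintegralZl//; last exact: Ib.
  have rho0' : I rho != 0 by rewrite /I bumpE.
  apply/eqP; rewrite subr_eq0; apply/eqP.
  apply: (mulIf rho0'); rewrite [LHS](key _ _ n ap pq qb) /c.
  by rewrite [RHS]mulrAC divfK// mulrC.
apply: filterS => x H xab; have := H xab; rewrite /h /= => /eqP.
by rewrite subr_eq0 subr_eq => /eqP.
Qed.

End variations.

(** * Weak derivatives in one variable *)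

Section sobolev.
Variable R : realType.
Local Notation mu := (@lebesgue_measure R).
Implicit Types (f g h phi : R -> R) (a b p q x c : R).

(** The Cauchy-Schwarz inequality against the indicator of the interval; K
    is the square root of its length. *)
Lemma L1_le_L2 a b : exists2 K : R, 0 <= K & forall f, measurable_fun `]a, b[ f ->
  (\int[mu]_(x in `]a, b[) (`|f x|)%:E <= K%:E * fnorm (L2 a b) f)%E.
Proof.
pose D := `]a, b[%classic : set R.
have Nfin : ('N[mu]_(2%:E)[EFin \o \1_D] < +oo)%E.
  rewrite unlock; apply: poweR_lty.
  rewrite [ltLHS](_ : _ = \int[mu]_x (\1_D x)%:E)%E; last first.
    apply: eq_integral => x _ /=; rewrite indicE; case: (_ \in _) => /=.
      by rewrite normr1 powR1.
    by rewrite normr0 powR0.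
  rewrite integral_indic; [|exact: measurableT|exact: measurable_itv].
  rewrite setIT.
  by rewrite /= /D lebesgue_measure_itv /=; case: ifP => _; rewrite ?ltry// -EFinB ltry.
exists (fine ('N[mu]_(2%:E)[EFin \o \1_D])); first by rewrite fine_ge0// Lnorm_ge0.
move=> f mf.
rewrite fineK; last by rewrite ge0_fin_numE// Lnorm_ge0.
rewrite muleC /=.
have mfD : measurable_fun setT (f \_ D).
  apply: (proj1 (measurable_restrictT _ _) mf).
  exact: measurable_itv.
have := @hoelder _ _ _ mu (f \_ D) \1_D 2 2 mfD.
have h2 : 2^-1 + 2^-1 = 1 :> R by rewrite [RHS]splitr !div1r.
have mD : measurable_fun setT (\1_D : measurableTypeR R -> R).
  by apply: measurable_indic; exact: measurable_itv.
move=> /(_ mD (ltr0Sn R 1) (ltr0Sn R 1) h2); apply: le_trans.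
rewrite Lnorm1 [leLHS]integral_mkcond le_eqVlt; apply/orP; left; apply/eqP.
apply: eq_integral => x _; rewrite patchE /= indicE patchE -/D.
by case: ifPn => xD; rewrite ?mulr1 ?mulr0 ?normr0.
Qed.

Lemma L2_integrable a b f : L2 a b f -> mu.-integrable `]a, b] (EFin \o f).
Proof.
move=> L2f; have mf : measurable_fun `]a, b[ f.
  apply/(measurable_restrictT _ _).2 => //.
  by move: L2f; rewrite /= inE => /andP[]; rewrite inE.
have [K K0 HK] := L1_le_L2 a b.
apply: (@integrable_itv_bnd _ false true); apply/integrableP; split.
  exact/measurable_EFinP.
apply: le_lt_trans (HK f mf) _; apply: lte_mul_pinfty => //.
by move: L2f; rewrite /= inE => /andP[_]; rewrite inE.
Qed.

Lemma locally_integrable_sub a b p q f : locally_integrable `]a, b[ f ->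
  a < p -> q < b -> mu.-integrable `]p, q] (EFin \o f).
Proof.
move=> [mf oD H] ap qb.
have sub : `[p, q] `<=` `]a, b[.
  move=> x /=; rewrite !in_itv /= => /andP[px xq].
  by rewrite (lt_le_trans ap px) (le_lt_trans xq qb).
apply: (@integrableS _ _ _ mu `[p, q]) => //; first exact: subset_itv_oc_cc.
apply/integrableP; split; first by apply/measurable_EFinP; exact: measurable_funS mf.
by apply: H => //; exact: segment_compact.
Qed.

Lemma test_fun_bump a b p q n : a < p -> q < b -> test_fun a b (bumpf p q n).
Proof.
move=> ap qb.
have sub : closure [set x | bumpf p q n x != 0] `<=` `[p, q].
  have/closure_id -> : closed [set` `[p, q]] by exact: interval_closed.
  apply: closureS => x /=; apply: contraTT => h.
  by rewrite negbK; apply/eqP; exact: bump_supp_cc.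
split; first exact: smooth_bump.
- apply: subclosed_compact sub; first exact: closed_closure.
  exact: segment_compact.
- move=> x /sub /=; rewrite !in_itv /= => /andP[px xq].
  by rewrite (lt_le_trans ap px) (le_lt_trans xq qb).
Qed.

Lemma locally_integrable_mul_bump a b p q n g : locally_integrable `]a, b[ g ->
  a < p -> q < b -> mu.-integrable `]a, b[ (EFin \o (fun x => g x * bumpf p q n x)).
Proof.
move=> lg ap qb; have [mg _ _] := lg.
have sub : `]p, q] `<=` `]a, b[.
  move=> x /=; rewrite !in_itv /= => /andP[px xq].
  by rewrite (lt_trans ap px) (le_lt_trans xq qb).
have mb : measurable_fun `]p, q] (bumpf p q n).
  apply: (@measurable_funS _ _ _ _ setT) => //; apply: continuous_measurable_fun.
  by apply: smooth_continuous; exact: smooth_bump.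
apply: (@integrableS _ _ _ mu setT) => //.
apply: (@integrable_extend _ _ _ mu `]p, q]%classic) => //.
  by move=> x nx; rewrite bump_supp ?mulr0.
have := @integrable_bounded_mul _ _ _ mu `]p, q]%classic _ (bumpf p q n) g 1.
move=> H; apply: eq_integrable (H _ mb _ (locally_integrable_sub lg ap qb)) => //.
- by move=> x _ /=; rewrite mulrC.
- by move=> x _; rewrite ger0_norm ?bump_ge0 ?bump_le1.
Qed.

Lemma wderiv_unique a b f g1 g2 : is_wderiv a b f g1 -> is_wderiv a b f g2 ->
  ae_eq mu `]a, b[%classic g1 g2.
Proof.
move=> [_ l1 w1] [_ l2 w2].
have : ae_eq mu `]a, b[%classic (fun x => g1 x - g2 x) (cst 0).
  apply: ae_eq0_bump.
    move=> p q ap pq qb; apply: integrable_sub => //.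
      exact: locally_integrable_sub l1 ap qb.
    exact: locally_integrable_sub l2 ap qb.
  move=> p q n ap pq qb.
  have tb := test_fun_bump n ap qb.
  have -> : \int[mu]_(t in `]a, b[) ((g1 t - g2 t) * bumpf (ratr p) (ratr q) n t) =
     \int[mu]_(t in `]a, b[) (g1 t * bumpf (ratr p) (ratr q) n t -
        g2 t * bumpf (ratr p) (ratr q) n t).
    by apply: eq_Rintegral => x _; rewrite mulrBl.
  rewrite RintegralB//; last 2 first.
  - exact: locally_integrable_mul_bump.
  - exact: locally_integrable_mul_bump.
  have := w1 _ tb; rewrite (w2 _ tb) => /oppr_inj ->; exact: subrr.
apply: filterS => x H xab; have := H xab => /= /eqP.
by rewrite subr_eq0 => /eqP.
Qed.

Lemma wderiv_ac a b f g : a < b -> mu.-integrable `]a, b] (EFin \o f) ->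
  mu.-integrable `]a, b] (EFin \o g) -> is_wderiv a b f g ->
  exists2 F, ac a b F g & ae_eq mu `]a, b[%classic f F.
Proof.
move=> ab If Ig [_ _ w]; have [c H] := du_bois_reymond ab If Ig w.
by exists (fun x => c + \int[mu]_(t in `]a, x]) g t) => //; exact: ac_integral.
Qed.

(** The average of |f| bounds |f| at some point, and f varies by at most the
    integral of |g|. Multiplying by b - a avoids division. *)
Lemma ac_sup_le a b f g x : a < b -> ac a b f g -> a <= x <= b ->
  (b - a) * `|f x| <= \int[mu]_(t in `]a, b]) `|f t| +
     (b - a) * \int[mu]_(t in `]a, b]) `|g t|.
Proof.
move=> ab acf /andP[ax xb].
have If := ac_integrable (ltW ab) acf.
have Ifn := integrable_normr (measurable_itv _) If.
have Ign := integrable_normr (measurable_itv _) acf.1.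
set N := \int[mu]_(t in `]a, b]) `|g t|.
have N0 : 0 <= N by exact: Rintegral_ge0.
have sub s t : a <= s -> s <= t -> t <= b -> \int[mu]_(t in `]s, t]) `|g t| <= N.
  move=> as_ st tb; rewrite /N (Rintegral_cat (le_trans as_ st) tb (lexx b) Ign).
  rewrite (Rintegral_cat as_ st tb Ign) -addrA addrCA lerDl addr_ge0 //;
    exact: Rintegral_ge0.
have H t : a <= t <= b -> `|f x| - N <= `|f t|.
  move=> /andP[at_ tb]; rewrite lerBlDr -lerBlDl.
  rewrite (le_trans (lerB_dist _ _))//.
  have [tx|xt] := leP t x.
    exact: le_trans (ac_incr_le acf at_ tx xb) (sub _ _ at_ tx xb).
  rewrite distrC.
  exact: le_trans (ac_incr_le acf ax (ltW xt) tb) (sub _ _ ax (ltW xt) tb).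
have Ic (c : R) : mu.-integrable `]a, b] (EFin \o cst c).
  apply: measurable_bounded_integrable => //.
    by rewrite /= lebesgue_measure_itv /= lte_fin ab -EFinB ltry.
  exact: bounded_cst.
have -> : (b - a) * `|f x| = (\int[mu]_(t in `]a, b]) cst (`|f x| - N) t) + (b - a) * N.
  rewrite Rintegral_cst//= lebesgue_measure_itv /= lte_fin ab -EFinB /=; ring.
rewrite lerD2r; apply: le_Rintegral => // t /=; rewrite in_itv /= => /andP[at_ tb].
by apply: H; rewrite tb ltW.
Qed.

(** The fundamental theorem of calculus for continuous derivatives. *)
Lemma smooth_ac a b phi : a <= b -> smooth phi -> ac a b phi (derive1 phi).
Proof.
move=> ab sphi.
have cd : continuous (derive1 phi) by exact: smooth_continuous (smooth_derive1 sphi).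
have Id : mu.-integrable `[a, b] (EFin \o derive1 phi).
  apply: continuous_compact_integrable; first exact: segment_compact.
  exact: continuous_subspaceT.
split; first exact: (@integrable_itv_bnd _ true false).
move=> x /andP[ax xb].
move: ax; rewrite le_eqVlt => /predU1P[<-|ax].
  have -> : `]a, a]%classic = set0 :> set R by rewrite set_itv_ge// bnd_simp ltxx.
  by rewrite Rintegral_set0 addr0.
have ic : mu.-integrable `]a, x] (EFin \o derive1 phi).
  by apply: integrableS Id => //; apply: subset_itv; rewrite bnd_simp.
rewrite Rintegral_itv_obnd_cbnd// /Rintegral.
rewrite (@continuous_FTC2 _ (derive1 phi) phi a x ax)//.
- by rewrite -EFinB /= addrC subrK.
- exact: continuous_subspaceT.
- have cphi := smooth_continuous sphi.
  split=> [y _||]; first exact: smooth_derivable.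
    by apply: cvg_at_right_filter; exact: cphi.
  by apply: cvg_at_left_filter; exact: cphi.
Qed.

Lemma test_fun_out a b phi x : test_fun a b phi -> x \notin `]a, b[ -> phi x = 0.
Proof.
move=> [_ _ sub] xab; apply/eqP; apply: contraNT xab => h; apply: sub.
exact: subset_closure.
Qed.

Lemma ac_bounded_mul_integrable a b f g h : a <= b -> ac a b f g ->
  mu.-integrable `]a, b] (EFin \o h) ->
  mu.-integrable `]a, b] (EFin \o (fun x => f x * h x)).
Proof.
move=> ab acf Ih.
apply: (@integrable_bounded_mul _ _ _ mu `]a, b]%classic _ f h
  (`|f a| + \int[mu]_(t in `]a, b]) `|g t|)) => //; first exact: ac_measurable acf.
move=> x /=; rewrite in_itv /= => /andP[ax xb]; apply: ac_bounded acf _.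
by rewrite xb ltW.
Qed.

Lemma ac_wderiv a b f g : a < b -> ac a b f g -> is_wderiv a b f g.
Proof.
move=> ab acf; have If := ac_integrable (ltW ab) acf.
have oo_oc h : mu.-integrable `]a, b] (EFin \o h) -> mu.-integrable `]a, b[ (EFin \o h).
  exact: (@integrable_itv_bnd _ false false false true).
split.
- by apply: open_integrable_locally; [exact: interval_open|exact: oo_oc].
- by apply: open_integrable_locally; [exact: interval_open|exact: oo_oc acf.1].
move=> phi tphi.
have acphi : ac a b phi (derive1 phi) by apply: smooth_ac; [exact: ltW|case: tphi].
have pa : phi a = 0 by apply: test_fun_out tphi _; rewrite in_itv /= ltxx.
have pb : phi b = 0 by apply: test_fun_out tphi _; rewrite in_itv /= ltxx andbF.
have := ac_ftc (ltW ab) (ac_mul (ltW ab) acf acphi).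
have I1 : mu.-integrable `]a, b] (EFin \o (fun x => f x * derive1 phi x)).
  exact: ac_bounded_mul_integrable (ltW ab) acf acphi.1.
have I2 : mu.-integrable `]a, b] (EFin \o (fun x => g x * phi x)).
  have := ac_bounded_mul_integrable (ltW ab) acphi acf.1.
  by apply: eq_integrable => // x _ /=; rewrite mulrC.
rewrite pa pb !mulr0 subrr RintegralD// => e.
rewrite !Rintegral_oo_oc//; apply/eqP; rewrite -addr_eq0 addrC; exact/eqP.
Qed.

End sobolev.

Section sobolev_traces.
Variable R : realType.
Local Notation mu := (@lebesgue_measure R).
Implicit Types (f g h phi F : R -> R) (a b p q x c : R).

Lemma wderivP a b f g : is_wderiv a b f g -> is_wderiv a b f (wderiv a b f).
Proof. by move=> H; apply: getPex; exists g. Qed.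

Lemma is_wderiv_sub a b f1 g1 f2 g2 : a < b ->
  mu.-integrable `]a, b] (EFin \o f1) -> mu.-integrable `]a, b] (EFin \o g1) ->
  mu.-integrable `]a, b] (EFin \o f2) -> mu.-integrable `]a, b] (EFin \o g2) ->
  is_wderiv a b f1 g1 -> is_wderiv a b f2 g2 ->
  is_wderiv a b (fun x => f1 x - f2 x) (fun x => g1 x - g2 x).
Proof.
move=> ab If1 Ig1 If2 Ig2 [lf1 lg1 w1] [lf2 lg2 w2]; split.
- exact: locally_integrableB.
- exact: locally_integrableB.
move=> phi tphi.
have [sphi _ _] := tphi.
have acphi := smooth_ac (ltW ab) sphi.
have acphi' := smooth_ac (ltW ab) (smooth_derive1 sphi).
have M k h h' : ac a b h h' -> mu.-integrable `]a, b] (EFin \o k) ->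
    mu.-integrable `]a, b[ (EFin \o (fun x => k x * h x)).
  move=> ach Ik; apply: (@integrable_itv_bnd _ false false false true).
  have := ac_bounded_mul_integrable (ltW ab) ach Ik.
  by apply: eq_integrable => // x _ /=; rewrite mulrC.
have S k1 k2 h h' : ac a b h h' -> mu.-integrable `]a, b] (EFin \o k1) ->
    mu.-integrable `]a, b] (EFin \o k2) ->
    \int[mu]_(x in `]a, b[) ((k1 x - k2 x) * h x) =
    \int[mu]_(x in `]a, b[) (k1 x * h x) - \int[mu]_(x in `]a, b[) (k2 x * h x).
  move=> ach I1 I2; rewrite -RintegralB//; [|exact: M ach I1|exact: M ach I2].
  by apply: eq_Rintegral => x _; rewrite mulrBl.
rewrite (S _ _ _ _ acphi' If1 If2) (S _ _ _ _ acphi Ig1 Ig2) (w1 _ tphi) (w2 _ tphi).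
by rewrite opprB opprK addrC.
Qed.

Lemma ae_neq (c : R) : {ae mu, forall x : R, x <> c}.
Proof.
exists [set c]; split; [exact: measurable_set1|exact: lebesgue_measure_set1|].
by move=> x /= /contrapT.
Qed.

Lemma ae_exists_in_itv (P : R -> Prop) a b : a < b ->
  {ae mu, forall x : R, P x} -> exists2 x, a < x < b & P x.
Proof.
move=> ab [N [mN N0 subN]]; apply: contrapT => H.
have : (mu `]a, b[ <= mu N)%E.
  apply: le_measure; rewrite ?inE//.
  move=> y /= yab; apply: subN => /= Py; apply: H; exists y => //.
by rewrite N0 /= lebesgue_measure_itv /= lte_fin ab -EFinB lee_fin leNgt subr_gt0 ab.
Qed.

Lemma ae_eq_oo_oc a b (f g : R -> R) : ae_eq mu `]a, b[%classic f g ->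
  ae_eq mu `]a, b]%classic f g.
Proof.
move=> H; move: H (ae_neq b); apply: ae_imp2 => x H xb; rewrite /= in_itv /= => /andP[ax].
rewrite le_eqVlt => /predU1P[|xb']; first by [].
by apply: H; rewrite /= in_itv /= ax.
Qed.

Lemma ae_eq_Rintegral (D : set R) (f g : R -> R) : measurable D ->
  measurable_fun D f -> measurable_fun D g -> ae_eq mu D f g ->
  \int[mu]_(x in D) f x = \int[mu]_(x in D) g x.
Proof.
move=> mD mf mg fg; rewrite /Rintegral; congr fine; apply: ae_eq_integral => //.
- exact/measurable_EFinP.
- exact/measurable_EFinP.
- by apply: filterS fg => x H Dx; rewrite H.
Qed.

Lemma ae_eq_integrable (D : set R) (f g : R -> R) : measurable D ->
  measurable_fun D g -> ae_eq mu D f g -> mu.-integrable D (EFin \o f) ->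
  mu.-integrable D (EFin \o g).
Proof.
move=> mD mg fg If; have mf := integrable_measurable If.
apply/integrableP; split; first exact/measurable_EFinP.
have /integrableP[_] := If; congr (_ < _)%E; apply: ae_eq_integral => //.
- by apply: measurableT_comp => //; exact/measurable_EFinP.
- by apply: measurableT_comp => //; exact/measurable_EFinP.
- by apply: filterS fg => x h Dx /=; rewrite h.
Qed.

Lemma integral_EFin_norm (D : set R) f : measurable D -> mu.-integrable D (EFin \o f) ->
  (\int[mu]_(x in D) (`|f x|)%:E = (\int[mu]_(x in D) `|f x|)%:E)%E.
Proof.
move=> mD If; rewrite /Rintegral fineK//; apply: integrable_fin_num => //.
exact: integrable_normr.
Qed.

(** The norm of the derivative is defined through a chosen weak derivative,
    so any given one has first to be identified with it almost everywhere.
    The embedding of H^1 in the continuous functions is then ac_sup_le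
    followed by the Cauchy-Schwarz inequality. *)
Lemma H1_sup a b : a < b -> exists2 C : R, 0 <= C & forall f g,
  mu.-integrable `]a, b] (EFin \o f) -> mu.-integrable `]a, b] (EFin \o g) ->
  is_wderiv a b f g ->
  ((\int[mu]_(x in `]a, b]) `|g x|)%:E <= C%:E * fnorm (Hk 1 a b) f)%E /\
  exists F, [/\ ac a b F g, ae_eq mu `]a, b[%classic f F &
    forall x, a <= x <= b -> (`|F x|%:E <= C%:E * fnorm (Hk 1 a b) f)%E].
Proof.
move=> ab; have [K K0 HK] := L1_le_L2 a b.
have ba0 : 0 < b - a by rewrite subr_gt0.
exists (K / (b - a) + K) => [|f g If Ig w].
  by rewrite addr_ge0// divr_ge0// ltW.
have [F acF fF] := wderiv_ac ab If Ig w.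
have w' := wderivP w.
have gw := wderiv_unique w w'.
have sub : `]a, b[ `<=` `]a, b] by exact: subset_itv_oo_oc.
have mf : measurable_fun `]a, b[ f by apply: measurable_funS (integrable_measurable If).
have mg : measurable_fun `]a, b[ g by apply: measurable_funS (integrable_measurable Ig).
have mw : measurable_fun `]a, b[ (wderiv a b f) by case: w' => _ [].
have mF : measurable_fun `]a, b[ F.
  by apply: measurable_funS (ac_measurable (ltW ab) acF).
have oo h : mu.-integrable `]a, b] (EFin \o h) -> mu.-integrable `]a, b[ (EFin \o h).
  exact: (@integrable_itv_bnd _ false false false true).
have nf : ((\int[mu]_(x in `]a, b]) `|F x|)%:E <= K%:E * fnorm (L2 a b) f)%E.
  apply: le_trans (HK f mf); rewrite integral_EFin_norm//; last exact: oo.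
  have IF := ac_integrable (ltW ab) acF.
  rewrite -Rintegral_oo_oc; last exact: integrable_normr.
  rewrite lee_fin (@ae_eq_Rintegral _ (fun x => `|F x|) (fun x => `|f x|))//.
  - exact: measurableT_comp.
  - exact: measurableT_comp.
  - by apply: filterS fF => x H Dx; rewrite H.
have ng : ((\int[mu]_(x in `]a, b]) `|g x|)%:E <= K%:E * fnorm (L2 a b) (wderiv a b f))%E.
  apply: le_trans (HK _ mw).
  have Iw : mu.-integrable `]a, b[ (EFin \o wderiv a b f).
    exact: ae_eq_integrable gw (oo _ Ig).
  rewrite integral_EFin_norm//.
  rewrite -Rintegral_oo_oc; last exact: integrable_normr.
  rewrite lee_fin (@ae_eq_Rintegral _ (fun x => `|g x|) (fun x => `|wderiv a b f x|))//.
  - exact: measurableT_comp.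
  - exact: measurableT_comp.
  - by apply: filterS gw => x H Dx; rewrite H.
have HE : fnorm (Hk 1 a b) f = (fnorm (L2 a b) f + fnorm (L2 a b) (wderiv a b f))%E by [].
have n1 : (0 <= fnorm (L2 a b) f)%E by exact: Lnorm_ge0.
have n2 : (0 <= fnorm (L2 a b) (wderiv a b f))%E by exact: Lnorm_ge0.
have Kba : 0 <= K / (b - a) by rewrite divr_ge0// ltW.
rewrite HE; split.
  apply: (le_trans ng); rewrite ge0_muleDr//; apply: le_trans (leeDr _ _); last first.
    by rewrite mule_ge0// lee_fin addr_ge0.
  by rewrite lee_wpmul2r// lee_fin lerDr.
exists F; split => // x xab.
have := ac_sup_le ab acF xab; set A := \int[mu]_(t in _) _; set B := \int[mu]_(t in _) _.
move=> H.
have -> : (`|F x|%:E <= ((K / (b - a) + K)%:E * (fnorm (L2 a b) f + fnorm (L2 a b) (wderiv a b f))))%E.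
  apply: (@le_trans _ _ ((b - a)^-1 * A + B)%:E).
    rewrite lee_fin -(ler_pM2l ba0) mulrDr mulrA divff ?gt_eqF// mul1r.
    exact: H.
  rewrite EFinD ge0_muleDr//; apply: leeD.
    rewrite EFinM; apply: (@le_trans _ _ ((b - a)^-1%:E * (K%:E * fnorm (L2 a b) f)))%E.
      by apply: lee_wpmul2l => //; rewrite lee_fin invr_ge0 ltW.
    rewrite muleA -EFinM; apply: lee_wpmul2r => //; rewrite lee_fin mulrC lerDl//.
  apply: (le_trans ng); apply: lee_wpmul2r => //.
  by rewrite lee_fin lerDr.
by [].
Qed.

(** The values at the end points are continuous for the H^1 norm, by H1_sup
    applied to f - phi, and they vanish on test functions. *)
Lemma H10_trace a b f g : a < b -> H10 a b f -> is_wderiv a b f g ->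
  mu.-integrable `]a, b] (EFin \o g) ->
  exists F, [/\ ac a b F g, ae_eq mu `]a, b[%classic f F, F a = 0 & F b = 0].
Proof.
move=> ab [[L2f _] H] w Ig.
have If := L2_integrable L2f.
have [F acF fF] := wderiv_ac ab If Ig w.
have [C C0 HC] := H1_sup ab.
have key e : 0 < e -> `|F a| <= C * e /\ `|F b| <= C * e.
  move=> e0; have [phi tphi nphi] := H e e0.
  have [sphi _ _] := tphi.
  have acphi := smooth_ac (ltW ab) sphi.
  have Iphi := ac_integrable (ltW ab) acphi.
  have wphi := ac_wderiv ab acphi.
  have wd := is_wderiv_sub ab If Ig Iphi acphi.1 w wphi.
  have I1 : mu.-integrable `]a, b] (EFin \o (fun x => f x - phi x)) by exact: integrable_sub.
  have I2 : mu.-integrable `]a, b] (EFin \o (fun x => g x - derive1 phi x)).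
    by apply: integrable_sub => //; exact: acphi.1.
  have [_ [G [acG fG GC]]] := HC _ _ I1 I2 wd.
  have GE x : a <= x <= b -> G x = F x - phi x.
    have acd := ac_sub acF acphi.
    (* two primitives of one function differ by a constant, which an almost
       everywhere equality forces to be 0 *)
    have [c Hc] : exists c, forall x, a <= x <= b -> G x = F x - phi x + c.
      exists (G a - (F a - phi a)) => y yab; rewrite (acG.2 y yab) (acd.2 y yab); ring.
    suff c0 : c = 0 by move=> xab; rewrite Hc// c0 addr0.
    have [y /andP[ay yb] [h1 h2]] := ae_exists_in_itv ab (ae_and fG fF).
    have yab : `]a, b[%classic y by rewrite /= in_itv /= ay.
    have yab' : a <= y <= b by rewrite !ltW.
    by move: (h1 yab) => /=; rewrite (h2 yab) Hc// => /eqP; rewrite -subr_eq0 opprD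
      addNKr oppr_eq0 => /eqP.
  have pa : phi a = 0 by apply: test_fun_out tphi _; rewrite in_itv /= ltxx.
  have pb : phi b = 0 by apply: test_fun_out tphi _; rewrite in_itv /= ltxx andbF.
  have bnd x : a <= x <= b -> `|G x| <= C * e.
    move=> xab; rewrite -lee_fin (le_trans (GC x xab))// EFinM.
    by apply: lee_wpmul2l; [rewrite lee_fin|exact: ltW].
  split.
    have aab : a <= a <= b by rewrite lexx ltW.
    by have := bnd a aab; rewrite (GE a aab) pa subr0.
  have bab : a <= b <= b by rewrite lexx ltW.
  by have := bnd b bab; rewrite (GE b bab) pb subr0.
have zero (y : R) : (forall e, 0 < e -> `|y| <= C * e) -> y = 0.
  move=> Hy; apply/eqP; rewrite -normr_eq0 eq_le normr_ge0 andbT.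
  apply/ler_addgt0Pr => e e0; rewrite add0r.
  have C1 : 0 < C + 1 by rewrite ltr_wpDl.
  have := Hy (e / (C + 1)) (divr_gt0 e0 C1); move/le_trans; apply.
  by rewrite mulrA ler_pdivrMr// mulrC ler_pM2l// lerDl.
exists F; split => //.
  by apply: zero => e /key[].
by apply: zero => e /key[].
Qed.

End sobolev_traces.

(** * The energy estimate at a fixed time *)

Section fixed_time.
Variable R : realType.
Local Notation mu := (@lebesgue_measure R).
Implicit Types (f g h k phi F G s : R -> R) (a b x c : R).

(** Smooth approximations of a step from 0 to a constant. They are smooth up
    to the boundary without vanishing at b, which is what makes testing
    against them see the Neumann condition. *)
Definition ramp (p q : rat) n : R -> R := primitive (bumpf (ratr p) (ratr q) n).

Lemma derive1_ramp p q n : derive1 (ramp p q n) = bumpf (ratr p) (ratr q) n.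
Proof.
by apply: (@derive1_primitive _ _ (ratr p) (ratr q));
  [exact: continuous_bump|move=> x; exact: bump_supp_cc].
Qed.

Lemma smooth_ramp p q n : smooth (ramp p q n).
Proof.
by apply: (@smooth_primitive _ _ (ratr p) (ratr q));
  [exact: continuous_bump|move=> x; exact: bump_supp_cc|exact: smooth_bump].
Qed.

Lemma ac_ramp p q n a b : ac a b (ramp p q n) (bumpf (ratr p) (ratr q) n).
Proof.
by apply: (@ac_primitive _ _ (ratr p) (ratr q));
  [exact: continuous_bump|move=> x; exact: bump_supp_cc].
Qed.

(** The primitive G of g vanishes at a, and at b because g has mean 0.
    Integrating g ramp by parts produces no boundary term, and the weak
    identity says that k - G is orthogonal to all bumps. *)
Lemma neumann_representation a b k g : a < b ->
  mu.-integrable `]a, b] (EFin \o k) -> mu.-integrable `]a, b] (EFin \o g) ->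
  \int[mu]_(x in `]a, b[) g x = 0 ->
  (forall p q n, \int[mu]_(x in `]a, b[) (g x * ramp p q n x) +
    \int[mu]_(x in `]a, b[) (k x * bumpf (ratr p) (ratr q) n x) = 0) ->
  exists G, [/\ ac a b G g, ae_eq mu `]a, b[%classic k G, G a = 0 & G b = 0].
Proof.
move=> ab Ik Ig g0 H.
pose G x := 0 + \int[mu]_(t in `]a, x]) g t.
have acG : ac a b G g by exact: ac_integral.
have Ga : G a = 0.
  rewrite /G (_ : `]a, a]%classic = set0 :> set R) ?Rintegral_set0 ?addr0//.
  by rewrite set_itv_ge// bnd_simp ltxx.
have Gb : G b = 0 by rewrite /G -Rintegral_oo_oc// g0 addr0.
have IG := ac_integrable (ltW ab) acG.
exists G; split => //.
have : ae_eq mu `]a, b[%classic (fun x => k x - G x) (cst 0).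
  apply: ae_eq0_bump.
    move=> p q ap pq qb; apply: (@integrable_sub_itv _ a b) => //; try exact: ltW.
    exact: integrable_sub.
  move=> p q n ap pq qb.
  have Ikb := integrable_bump_mul (ratr p) (ratr q) n Ik.
  have IGb := integrable_bump_mul (ratr p) (ratr q) n IG.
  have Igt : mu.-integrable `]a, b] (EFin \o (fun x => g x * ramp p q n x)).
    have := ac_bounded_mul_integrable (ltW ab) (ac_ramp p q n a b) Ig.
    by apply: eq_integrable => // x _ /=; rewrite mulrC.
  have -> : \int[mu]_(t in `]a, b[) ((k t - G t) * bumpf (ratr p) (ratr q) n t) =
     \int[mu]_(t in `]a, b[) (k t * bumpf (ratr p) (ratr q) n t -
        G t * bumpf (ratr p) (ratr q) n t).
    by apply: eq_Rintegral => x _; rewrite mulrBl.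
  rewrite Rintegral_oo_oc; last exact: integrable_sub.
  rewrite RintegralB//.
  have := ac_ftc (ltW ab) (ac_mul (ltW ab) acG (ac_ramp p q n a b)).
  rewrite Ga Gb !mul0r subrr RintegralD//.
  have := H p q n; rewrite !Rintegral_oo_oc//.
  move=> h1 h2; lra.
apply: filterS => x h xab; have := h xab => /= /eqP.
by rewrite subr_eq0 => /eqP.
Qed.

(** Here p stands for - m v, theta_x = G, and g = theta_t - m v_x theta
    = G_x. Put d = exp s - theta, D its positive part, z = exp s, and
    w = z p - G, so that d_x = w. The function (G - p theta) D^2 vanishes at
    both end points, so its derivative S integrates to 0. Adding it to -
    theta_t D^2 gives - z p^2 D^2 - 2 D w^2 + 3 p w D^2, which is at most
    (9/8) p^2 D^3: the derivative p' of p, which is merely integrable, has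
    cancelled. *)
Lemma slice_energy a b (theta thetat G g p p' s : R -> R) P : a < b ->
  ac a b theta G -> ac a b G g -> G a = 0 -> G b = 0 ->
  ac a b p p' -> p a = 0 -> p b = 0 -> ac a b s p ->
  mu.-integrable `]a, b] (EFin \o thetat) ->
  ae_eq mu `]a, b]%classic thetat (fun x => g x - p' x * theta x) ->
  (forall x, a < x <= b -> `|p x| <= P) ->
  - (\int[mu]_(x in `]a, b]) (pos (expR (s x) - theta x) ^+ 2 * thetat x)) <=
  9 / 8 * P ^+ 2 * \int[mu]_(x in `]a, b]) (pos (expR (s x) - theta x) ^+ 3).
Proof.
move=> ab acth acG Ga Gb acp pa pb acs It teq pP.
have ab' := ltW ab.
have acz := ac_comp ab' acs (locally_C11_expR R).
have acd := ac_sub acz acth.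
have acpsi := ac_comp ab' acd (locally_C11_pos_sqr R).
have accub := ac_comp ab' acd (locally_C11_pos_cube R).
have acA := ac_mul ab' acG acpsi.
have acB := ac_mul ab' acp (ac_mul ab' acth acpsi).
have acS := ac_sub acA acB.
have := ac_ftc ab' acS; rewrite Ga Gb pa pb !mul0r !subrr.
set S := (X in Rintegral _ _ X) => intS.
have IS : mu.-integrable `]a, b] (EFin \o S) by exact: acS.1.
set d := fun x => expR (s x) - theta x.
have It' : mu.-integrable `]a, b] (EFin \o (fun x => g x - p' x * theta x)).
  apply: integrable_sub => //; first exact: acG.1.
  have := ac_bounded_mul_integrable ab' acth acp.1.
  by apply: eq_integrable => // x _ /=; rewrite mulrC.
have Ipt := ac_bounded_mul_integrable ab' acpsi It.
have Ipt' := ac_bounded_mul_integrable ab' acpsi It'.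
have e1 : \int[mu]_(x in `]a, b]) (pos (d x) ^+ 2 * thetat x) =
    \int[mu]_(x in `]a, b]) (pos (d x) ^+ 2 * (g x - p' x * theta x)).
  apply: ae_eq_Rintegral => //.
  - exact: integrable_measurable Ipt.
  - exact: integrable_measurable Ipt'.
  - by apply: filterS teq => x h xab; rewrite h.
have Ic : mu.-integrable `]a, b] (EFin \o (fun x => pos (d x) ^+ 3)).
  exact: ac_integrable ab' accub.
have IY : mu.-integrable `]a, b]
    (EFin \o (fun x => pos (d x) ^+ 2 * (g x - p' x * theta x))) by exact: Ipt'.
have IK : mu.-integrable `]a, b] (EFin \o (fun x => 9 / 8 * P ^+ 2 * pos (d x) ^+ 3)).
  exact: integrable_mulcl.
suff H : 0 <= \int[mu]_(x in `]a, b]) (9 / 8 * P ^+ 2 * pos (d x) ^+ 3 +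
    pos (d x) ^+ 2 * (g x - p' x * theta x) - S x).
  move: H; rewrite RintegralB//; last exact: integrable_add.
  rewrite RintegralD// RintegralZl// intS subr0 e1.
  by rewrite -lerBlDr sub0r.
apply: Rintegral_ge0 => x /=; rewrite in_itv /= => xab.
rewrite /S /=.
have := pP _ xab.
have := mul_pos (d x); have := pos_ge0 (d x); rewrite -/(d x).
set D := pos (d x); have -> : theta x = expR (s x) - d x by rewrite /d; ring.
move: (expR (s x)) (expR_ge0 (s x)) (d x) D (p x) (p' x) (g x) (G x) => z z0 e D q q' g0 G0.
move=> D0 eD; rewrite ler_norml => /andP[q1 q2].
(* w is the derivative of d; in terms of it the integrand is a sum of
   nonnegative terms, plus a multiple of e * D - D ^+ 2, which is 0 as D is
   the positive part of e *)
have [w ->] : exists w, G0 = z * q - w by exists (z * q - G0); ring.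
have h1 : 0 <= z * (q * D) ^+ 2 by apply: mulr_ge0 => //; exact: sqr_ge0.
(* completing the square in - 2 D w^2 + 3 q w D^2; this is the origin of
   9/8 *)
have h2 : 0 <= D * (w - 3 / 4 * q * D) ^+ 2 by apply: mulr_ge0 => //; exact: sqr_ge0.
have h3 : 0 <= D ^+ 3 * (P ^+ 2 - q ^+ 2).
  apply: mulr_ge0; first exact: exprn_ge0.
  have -> : P ^+ 2 - q ^+ 2 = (P - q) * (P + q) by ring.
  by apply: mulr_ge0; lra.
set X := (X in 0 <= X).
have -> : X = 9 / 8 * (D ^+ 3 * (P ^+ 2 - q ^+ 2)) + z * (q * D) ^+ 2 +
    2 * (D * (w - 3 / 4 * q * D) ^+ 2) - 2 * q * w * (e * D - D ^+ 2).
  by rewrite /X; field.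
rewrite eD subrr mulr0 subr0; lra.
Qed.

End fixed_time.

(** * Joint integrability of space-time functions *)

(** For nonnegative functions monotonicity is immediate from the definition
    of the integral as a supremum over simple functions. This version
    applies to the norms of slices in a Bochner space, whose measurability
    in time is unknown. *)
Lemma ge0_le_integral_le d (X : measurableType d) (R : realType)
    (nu : {measure set X -> \bar R}) (D : set X) (f g : X -> \bar R) :
  (forall x, D x -> (0 <= f x)%E) -> (forall x, D x -> (f x <= g x)%E) ->
  (\int[nu]_(x in D) f x <= \int[nu]_(x in D) g x)%E.
Proof.
move=> f0 fg; have g0 x : D x -> (0 <= g x)%E.
  by move=> Dx; exact: le_trans (f0 _ Dx) (fg _ Dx).
rewrite ge0_integralE// [leRHS]ge0_integralE//; apply: le_ereal_sup => _ [h hf <-].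
exists h => // x; apply: (le_trans (hf x)); rewrite !patchE.
by case: ifPn => // /set_mem; exact: fg.
Qed.

Section joint.
Variable R : realType.
Local Notation mu := (@lebesgue_measure R).
Local Notation RR := (measurableTypeR R * measurableTypeR R)%type.
Implicit Types (f g h : R -> R -> R) (a b T : R) (A : set R).

(** Space-time functions are prescribed only on the open rectangle;
    extending them by 0 gives a function on the whole plane, to which the
    theorems on product measures apply without restrictions of domains. *)
Definition cutoff a b T f : RR -> R :=
  (fun z : RR => f z.1 z.2) \_ (`]0, T[ `*` `]a, b[).

Lemma measurable_rect a b T : measurable (`]0, T[ `*` `]a, b[ : set RR).
Proof. by apply: measurableX; exact: measurable_itv. Qed.

Lemma measurable_cutoff a b T f : joint_measurable a b T f ->
  measurable_fun setT (cutoff a b T f).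
Proof.
move=> mf; apply: (proj1 (measurable_restrictT _ _) mf).
exact: measurable_rect.
Qed.

Lemma cutoffE a b T f t x : t \in `]0, T[ -> x \in `]a, b[ -> cutoff a b T f (t, x) = f t x.
Proof. by move=> tT xab; rewrite /cutoff patchE mem_set. Qed.

Lemma cutoff_out a b T f t x : t \notin `]0, T[ -> cutoff a b T f (t, x) = 0.
Proof. by move=> /negP tT; rewrite /cutoff patchE memNset// => -[]. Qed.

Lemma cutoff_out2 a b T f t x : x \notin `]a, b[ -> cutoff a b T f (t, x) = 0.
Proof. by move=> /negP tT; rewrite /cutoff patchE memNset// => -[]. Qed.

Lemma measurable_slice a b T f t : joint_measurable a b T f -> t \in `]0, T[ ->
  measurable_fun `]a, b[ (f t).
Proof.
move=> mf tT.
have m1 : measurable_fun setT (fun x : measurableTypeR R => cutoff a b T f (t, x)).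
  by apply: (measurableT_comp (measurable_cutoff mf)).
have m2 : measurable_fun `]a, b[ (fun x : measurableTypeR R => cutoff a b T f (t, x)).
  by apply: (@measurable_funS _ _ _ _ setT) => //.
apply: eq_measurable_fun m2 => x; rewrite inE /= => xab.
by rewrite cutoffE.
Qed.

(** The L1 norm of the time slice. By Tonelli it is measurable in time, in
    contrast to the norm of the slice in an arbitrary function space. *)
Definition slice_norm a b T f (t : R) : \bar R := (\int[mu]_x (`|cutoff a b T f (t, x)|)%:E)%E.

Lemma measurable_slice_norm a b T f : joint_measurable a b T f ->
  measurable_fun setT (slice_norm a b T f).
Proof.
move=> mf; apply: (measurable_fun_fubini_tonelli_F (fun z : RR => (`|cutoff a b T f z|)%:E)).
  apply/measurable_EFinP; apply: measurableT_comp => //; exact: measurable_cutoff.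
by move=> z; rewrite lee_fin.
Qed.

Lemma slice_norm_out a b T f t : t \notin `]0, T[ -> slice_norm a b T f t = 0%E.
Proof.
move=> tT; rewrite /slice_norm (eq_integral (cst 0%E)) ?integral0// => x _.
by rewrite cutoff_out// normr0.
Qed.

Lemma slice_normE a b T f t : t \in `]0, T[ ->
  slice_norm a b T f t = (\int[mu]_(x in `]a, b[) (`|f t x|)%:E)%E.
Proof.
move=> tT; rewrite /slice_norm [RHS]integral_mkcond; apply: eq_integral => x _.
rewrite patchE; case: ifPn => [/set_mem xab|xab]; first by rewrite cutoffE.
rewrite cutoff_out2 ?normr0//; apply: contra xab => h; exact: mem_set.
Qed.

Lemma slice_norm_ge0 a b T f t : (0 <= slice_norm a b T f t)%E.
Proof. by apply: integral_ge0 => x _; rewrite lee_fin. Qed.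

Lemma integrable_cutoff a b T f : joint_measurable a b T f ->
  (\int[mu]_t slice_norm a b T f t < +oo)%E ->
  (mu \x mu)%E.-integrable setT (EFin \o cutoff a b T f).
Proof.
move=> mf H; apply/integrable12ltyP.
  by apply/measurable_EFinP; exact: measurable_cutoff.
exact: H.
Qed.

(** The norm of a function in L^oo(0,T;X) is an essential supremum. It
    bounds the norm at almost all times. *)
Lemma LXy_bound T (X : fspace R) (f : R -> R -> R) : LX +oo%E T X f ->
  exists2 B : R, 0 <= B &
   {ae mu, forall t : R, t \in `]0, T[ -> (fnorm X (f t) <= B%:E)%E}.
Proof.
move=> [_]; rewrite unlock.
have -> : ((0 < mu [set: measurableTypeR R])%E = true).
  rewrite (@lt_le_trans _ _ (mu `[0, 1]))//.
    by rewrite /= lebesgue_measure_itv /= lte01 sube0.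
  by apply: le_measure; rewrite ?inE//; exact: measurable_itv.
set N := (_ \_ _).
have := ess_sup_ge mu (abse \o N); set B := ess_sup _ _ => HB By.
exists (Num.max 0 (fine B)); first by rewrite le_max lexx.
move: HB; apply: ae_imp => t Ht tT.
have -> : fnorm X (f t) = N t by rewrite /N patchE mem_set.
apply: (le_trans (lee_abs _)); apply: (le_trans Ht).
move: By; case: B {Ht} => [r _| |] //=; last by rewrite leNye.
by rewrite lee_fin le_max lexx orbT.
Qed.

Lemma LXy_integrable a b T f : joint_measurable a b T f -> LX +oo%E T (L2 a b) f ->
  (mu \x mu)%E.-integrable setT (EFin \o cutoff a b T f).
Proof.
move=> mf /LXy_bound[B B0 HB]; have [K K0 HK] := L1_le_L2 a b.
apply: integrable_cutoff => //.
rewrite (@le_lt_trans _ _ (\int[mu]_t (((K * B) * \1_(`]0, T[) t)%:E)))%E//.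
  apply: ae_ge0_le_integral => //.
  - by move=> t _; exact: slice_norm_ge0.
  - exact: measurable_slice_norm.
  - move=> t _; rewrite lee_fin mulr_ge0//; exact: mulr_ge0.
  - apply/measurable_EFinP; apply: measurable_funM => //.
  move: HB; apply: ae_imp => t Ht _; have [tT|tT] := boolP (t \in `]0, T[).
    rewrite slice_normE// (le_trans (HK _ (measurable_slice mf tT)))//.
    rewrite indicE mem_set//= mulr1 EFinM; apply: lee_wpmul2l; first by rewrite lee_fin.
    exact: Ht.
  by rewrite slice_norm_out// lee_fin mulr_ge0// mulr_ge0.
have Ii : mu.-integrable setT (EFin \o (\1_(`]0, T[) : measurableTypeR R -> R)).
  exact: integrable_indic_itv.
have /integrableP[_] := @integrable_mulcl _ _ _ mu setT measurableT (K * B) _ Ii.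
by apply: le_lt_trans; apply: ge0_le_integral_le => t _;
  [rewrite lee_fin !mulr_ge0|rewrite lee_fin ler_norm].
Qed.

(** The norm of the slices in L2 is square integrable in time only as an
    upper integral. A multiple of it dominates the measurable function
    slice_norm, and x <= 1 + x^2 gives integrability on the bounded
    interval. *)
Lemma LX2_integrable a b T f : joint_measurable a b T f -> LX 2%:E T (L2 a b) f ->
  (mu \x mu)%E.-integrable setT (EFin \o cutoff a b T f).
Proof.
move=> mf [_]; rewrite unlock => H; have [K K0 HK] := L1_le_L2 a b.
have K1 : 0 < K + 1 by rewrite ltr_wpDl.
(* K + 1 rather than K, which may be 0 *)
pose G t := ((K + 1)^-1%:E * slice_norm a b T f t)%E.
have G0 t : (0 <= G t)%E.
  by rewrite mule_ge0// ?slice_norm_ge0// lee_fin invr_ge0 ltW.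
have mG : measurable_fun setT G.
  by apply: measurable_funeM; exact: measurable_slice_norm.
have intG2 : (\int[mu]_t (G t * G t) < +oo)%E.
  have : (\int[mu]_t (`|(fun t0 => fnorm (L2 a b) (f t0)) \_ `]0%R, T[ t| `^ 2) < +oo)%E.
    apply: (@lty_poweRy _ _ 2^-1) => //.
  apply: le_lt_trans; apply: ge0_le_integral_le => t _; first exact: mule_ge0.
  rewrite patchE; case: ifPn => [/set_mem tT|tT]; last first.
    rewrite /G slice_norm_out ?mule0 ?mule0 ?poweR_ge0//.
    by apply: contra tT => h; exact: mem_set.
  have n0 : (0 <= fnorm (L2 a b) (f t))%E by exact: Lnorm_ge0.
  have GN : (G t <= fnorm (L2 a b) (f t))%E.
    rewrite /G slice_normE//.
    apply: (@le_trans _ _ ((K + 1)^-1%:E * (K%:E * fnorm (L2 a b) (f t))))%E.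
      apply: lee_wpmul2l; first by rewrite lee_fin invr_ge0 ltW.
      exact: HK (measurable_slice mf tT).
    rewrite muleA -EFinM -[leRHS]mul1e; apply: lee_wpmul2r => //.
    by rewrite lee_fin mulrC ler_pdivrMr// mul1r lerDl.
  rewrite gee0_abs//; apply: (@le_trans _ _ (fnorm (L2 a b) (f t) * fnorm (L2 a b) (f t)))%E.
    exact: lee_pmul.
  move: (fnorm _ _) n0 => [r| |]//; last by rewrite poweRyr ?leey// pnatr_eq0.
  by rewrite lee_fin => r0; rewrite poweR_EFin powR_mulrn// expr2.
apply: integrable_cutoff => //.
have lin (x : \bar R) : (0 <= x -> x <= 1 + x * x)%E.
  case: x => [x| |]//; rewrite ?lee_fin.
    move=> x0; have := sqr_ge0 (x - 1); rewrite sqrrB expr1n expr2; nra.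
have Ii : mu.-integrable setT (EFin \o (\1_(`]0, T[) : measurableTypeR R -> R)).
  exact: integrable_indic_itv.
rewrite (@le_lt_trans _ _ (\int[mu]_t ((K + 1)%:E * ((\1_(`]0, T[) t)%:E + G t * G t))))%E//.
  apply: ge0_le_integral_le => t _; first exact: slice_norm_ge0.
  have [tT|tT] := boolP (t \in `]0, T[); last first.
    rewrite slice_norm_out//; apply: mule_ge0; first by rewrite lee_fin ltW.
    by apply: adde_ge0; [rewrite lee_fin|exact: mule_ge0].
  rewrite indicE mem_set//=.
  have -> : slice_norm a b T f t = ((K + 1)%:E * G t)%E.
    by rewrite /G muleA -EFinM divff ?gt_eqF// mul1e.
  apply: lee_wpmul2l; first by rewrite lee_fin ltW.
  exact: lin.
rewrite ge0_integralZl//; last 3 first.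
- apply: emeasurable_funD; first exact: measurable_int Ii.
  exact: emeasurable_funM.
- by move=> t _; apply: adde_ge0; [rewrite lee_fin|exact: mule_ge0].
- by rewrite lee_fin ltW.
rewrite lte_mul_pinfty//; first by rewrite lee_fin ltW.
rewrite ge0_integralD//;
  try (by move=> t _; exact: mule_ge0); try exact: emeasurable_funM;
  try exact: measurable_int Ii.
rewrite lte_add_pinfty//.
have /integrableP[_] := Ii.
apply: le_lt_trans; apply: ge0_le_integral_le => t _; first by rewrite lee_fin.
by rewrite /= lee_fin ler_norm.
Qed.

End joint.

(** * Bochner integrals paired with bounded functionals *)

Section pairing.
Variable R : realType.
Local Notation mu := (@lebesgue_measure R).
Local Notation RR := (measurableTypeR R * measurableTypeR R)%type.
Implicit Types (f g h : R -> R -> R) (a b T : R) (A : set R).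

(** A bounded linear functional of the slice. The functionals attached to
    the intervals A with rational end points separate the elements of L1. *)
Definition slice_int A f (t : R) : R := \int[mu]_(x in A) f t x.

Lemma cutoff_mul_integrable a b T f (B : R) (c : RR -> R) :
  (mu \x mu)%E.-integrable setT (EFin \o cutoff a b T f) ->
  measurable_fun setT c -> (forall z, `|c z| <= B) ->
  (mu \x mu)%E.-integrable setT (EFin \o (fun z => c z * cutoff a b T f z)).
Proof.
by move=> If mc cB; apply: (@integrable_bounded_mul _ _ _ _ setT _ c _ B).
Qed.

(** Fubini for the product of f with the indicator of A. *)
Lemma slice_integrable a b T f A :
  (mu \x mu)%E.-integrable setT (EFin \o cutoff a b T f) ->
  measurable A -> A `<=` `]a, b[ ->
  mu.-integrable `]0, T[ (EFin \o slice_int A f).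
Proof.
move=> If mA AI.
pose c (z : RR) : R := \1_A z.2.
have mc : measurable_fun setT c.
  by apply: measurableT_comp => //; exact: measurable_indic.
have c1 z : `|c z| <= 1.
  by rewrite /c indicE; case: (_ \in _); rewrite ?normr1 ?normr0.
have Ic := cutoff_mul_integrable If mc c1.
have IF := integrable_fubini_F Ic.
have E t : t \in `]0, T[ -> slice_int A f t = fine (fubini_F mu (EFin \o (fun z => c z * cutoff a b T f z)) t).
  move=> tT; rewrite /slice_int /Rintegral integral_mkcond /fubini_F; congr fine.
  apply: eq_integral => x _; rewrite patchE /c /= indicE.
  case: ifPn => [/set_mem xA|xA]; last by rewrite mul0r.
  by rewrite mul1r cutoffE//; exact: AI.
have IF' : mu.-integrable setT (EFin \o (fine \o fubini_F mu (EFin \o (fun z => c z * cutoff a b T f z)))).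
  apply: le_integrable IF => //.
    apply/measurable_EFinP; apply: measurableT_comp => //.
    by have /integrableP[] := integrable_fubini_F Ic.
  by move=> t _ /=; case: (fubini_F _ _ _) => [r| |]//=; rewrite ?leey// normr0 leey.
have IFD : mu.-integrable `]0, T[ (EFin \o (fine \o fubini_F mu (EFin \o (fun z => c z * cutoff a b T f z)))).
  exact: integrableS IF'.
by apply: eq_integrable IFD => // t; rewrite inE /= => tT; rewrite E.
Qed.

Lemma Rintegral_sumr d (X : measurableType d) (nu : {measure set X -> \bar R})
    (D : set X) n (h : 'I_n -> X -> R) : measurable D ->
  (forall i, nu.-integrable D (EFin \o h i)) ->
  nu.-integrable D (EFin \o (fun x => \sum_(i < n) h i x)) /\
  \int[nu]_(x in D) (\sum_(i < n) h i x) = \sum_(i < n) \int[nu]_(x in D) h i x.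
Proof.
move=> mD; elim: n h => [|n IH] h Ih.
  split.
    have := @integrable0 _ _ R nu D; apply: eq_integrable => // x _.
    by rewrite /= big_ord0.
  rewrite big_ord0 (@eq_Rintegral _ _ _ nu _ (cst 0)) ?Rintegral_cst ?mul0r//.
  by move=> x _; rewrite big_ord0.
have [I1 E1] := IH (fun i => h (widen_ord (leqnSn n) i)) (fun i => Ih _).
have I2 := integrable_add mD I1 (Ih ord_max).
split.
  by apply: eq_integrable I2 => // x _; rewrite /= big_ord_recr.
rewrite big_ord_recr /= -E1 -RintegralD//.
by apply: eq_Rintegral => x _; rewrite big_ord_recr.
Qed.

Lemma L2_integrable_sub a b A (v : R -> R) : measurable A -> A `<=` `]a, b[ ->
  L2 a b v -> mu.-integrable A (EFin \o v).
Proof.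
move=> mA AI /L2_integrable; apply: integrableS => //.
by move=> x /AI; exact: subset_itv_oo_oc.
Qed.

Lemma integrable_ab a b (v : R -> R) : mu.-integrable `]a, b] (EFin \o v) ->
  mu.-integrable `]a, b[ (EFin \o v).
Proof. exact: (@integrable_itv_bnd _ false false false true). Qed.

Lemma L2_functional_le a b A (K : R) (v : R -> R) :
  (forall f : R -> R, measurable_fun `]a, b[ f ->
    (\int[mu]_(x in `]a, b[) (`|f x|)%:E <= K%:E * fnorm (L2 a b) f)%E) ->
  measurable A -> A `<=` `]a, b[ -> mu.-integrable `]a, b[ (EFin \o v) ->
  ((`|\int[mu]_(x in A) v x|)%:E <= K%:E * fnorm (L2 a b) v)%E.
Proof.
move=> HK mA AI Iv; apply: le_trans (HK v (integrable_measurable Iv)).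
have IA : mu.-integrable A (EFin \o v) by exact: integrableS Iv.
rewrite integral_EFin_norm// lee_fin (le_trans (le_normr_Rintegral _ IA))//.
rewrite -lee_fin -!integral_EFin_norm//; apply: ge0_subset_integral => //.
apply/measurable_EFinP; apply: measurableT_comp => //; exact: integrable_measurable Iv.
Qed.

(** Passage to the limit in an estimate r <= K u_n between a real number and
    extended reals that are finite only eventually. *)
Lemma cvge0_real_le (u : (\bar R)^nat) (r K : R) : 0 <= K ->
  u n @[n --> \oo] --> 0%E -> (forall n, (r%:E <= K%:E * u n)%E) -> r <= 0.
Proof.
move=> K0 u0 H; apply/ler_addgt0Pr => e e0; rewrite add0r.
have K1 : 0 < K + 1 by rewrite ltr_wpDl.
have /fine_cvgP[uf /cvgrPdist_lt/(_ _ (divr_gt0 e0 K1)) ul] := u0.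
near \oo => n.
have un : (u n < (e / (K + 1))%:E)%E.
  have ufin : u n \is a fin_num by near: n; exact: uf.
  rewrite -(fineK ufin) lte_fin; apply: le_lt_trans (ler_norm _) _.
  rewrite -normrN -sub0r; near: n; exact: ul.
rewrite -lee_fin (le_trans (H n))//.
apply: (@le_trans _ _ (K%:E * (e / (K + 1))%:E))%E.
  by apply: lee_wpmul2l; [rewrite lee_fin|exact: ltW].
by rewrite -EFinM lee_fin mulrA ler_pdivrMr// mulrC ler_pM2l// lerDl.
Unshelve. all: by end_near. Qed.

(** A continuous linear functional commutes with the Bochner integral. On
    simple functions this is linearity; both errors, in the integrand and in
    the value of the integral, are controlled by the L2 norm
    (L2_functional_le) and tend to 0. *)
Lemma bochner_int_functional a b T h (y : R -> R) A :
  (mu \x mu)%E.-integrable setT (EFin \o cutoff a b T h) ->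
  measurable A -> A `<=` `]a, b[ ->
  is_bochner_int T (L2 a b) h y ->
  \int[mu]_(t in `]0, T[) slice_int A h t = \int[mu]_(x in A) y x.
Proof.
move=> Ih mA AI [L2y [s [[Ls sh] c1 c2]]].
have [K K0 HK] := L1_le_L2 a b.
(* the scalar simple functions obtained by applying the functional to the
   approximants *)
pose mn n t := \sum_(i < ssize (s n)) \1_(sset i) t * \int[mu]_(x in A) svec i x.
have Iv n (i : 'I_(ssize (s n))) : mu.-integrable `]a, b[ (EFin \o svec i).
  by apply: integrable_ab; apply: L2_integrable; have [] := Ls n i.
have IvA n (i : 'I_(ssize (s n))) : mu.-integrable A (EFin \o svec i).
  exact: integrableS (Iv n i).
have muT : (mu `]0%R, T[ < +oo)%E.
  by rewrite /= lebesgue_measure_itv /=; case: ifP => _; rewrite ?ltry// -EFinB ltry.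
have mS n (i : 'I_(ssize (s n))) : measurable (sset i) by have [] := Ls n i.
have I1S n (i : 'I_(ssize (s n))) : mu.-integrable `]0, T[ (EFin \o (\1_(sset i) : R -> R)).
  apply: measurable_bounded_integrable => //.
    by apply: measurable_funTS; apply: measurable_indic; exact: mS.
  exists 1; split => // M M1 t _ /=; rewrite indicE; case: (_ \in _).
    by rewrite normr1 ltW.
  by rewrite normr0 ltW// (lt_trans _ M1).
have P1 n := @Rintegral_sumr _ _ mu `]0, T[%classic _
    (fun (i : 'I_(ssize (s n))) (t : R) => \1_(sset i) t * \int[mu]_(x in A) svec i x)
    (measurable_itv _).
have I1 n (i : 'I_(ssize (s n))) : mu.-integrable `]0, T[
    (EFin \o (fun t => \1_(sset i) t * \int[mu]_(x in A) svec i x)).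
  have := @integrable_mulcl _ _ _ mu _ (measurable_itv _) (\int[mu]_(x in A) svec i x) _ (I1S n i).
  by apply: eq_integrable => // t _ /=; rewrite mulrC.
have Imn n : mu.-integrable `]0, T[ (EFin \o mn n) by have [] := P1 n (I1 n).
have P2 n := @Rintegral_sumr _ _ mu A _
    (fun (i : 'I_(ssize (s n))) (x : R) => fine (mu (sset i `&` `]0, T[)) * svec i x) mA.
have I2 n (i : 'I_(ssize (s n))) : mu.-integrable A
    (EFin \o (fun x => fine (mu (sset i `&` `]0, T[)) * svec i x)).
  exact: integrable_mulcl.
have intmn n : \int[mu]_(t in `]0, T[) mn n t = \int[mu]_(x in A) simple_int T (s n) x.
  have [_ ->] := P1 n (I1 n); have [_ ->] := P2 n (I2 n).
  apply: eq_bigr => i _; rewrite RintegralZl//.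
  have -> : (fun t => \1_(sset i) t * \int[mu]_(x in A) svec i x) =
      (fun t => (\int[mu]_(x in A) svec i x) * \1_(sset i) t).
    by apply/funext => t; rewrite mulrC.
  rewrite RintegralZl// mulrC; congr (_ * _).
  by rewrite /Rintegral; congr fine; apply: integral_indic; [exact: measurable_itv|exact: mS].
have Isl := slice_integrable Ih mA AI.
have Isi n : mu.-integrable `]a, b[ (EFin \o simple_int T (s n)).
  have [] // := @Rintegral_sumr _ _ mu `]a, b[%classic _
    (fun (i : 'I_(ssize (s n))) (x : R) => fine (mu (sset i `&` `]0, T[)) * svec i x)
    (measurable_itv _).
  by move=> i; exact: integrable_mulcl.
have Iy : mu.-integrable `]a, b[ (EFin \o y) by apply: integrable_ab; exact: L2_integrable.
have step2 n : ((`|\int[mu]_(x in A) simple_int T (s n) x - \int[mu]_(x in A) y x|)%:E <=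
    K%:E * fnorm (L2 a b) (simple_int T (s n) \- y)%R)%E.
  rewrite -RintegralB//; [|exact: integrableS (Isi n)|exact: integrableS Iy].
  apply: (L2_functional_le HK mA AI); exact: integrable_sub.
have step1 n : ((`|\int[mu]_(t in `]0, T[) slice_int A h t - \int[mu]_(t in `]0, T[) mn n t|)%:E <=
    (K + 1)%:E * (\int[mu]_(t in `]0%R, T[)
       fnorm (L2 a b) (h t \- simple_eval (s n) t)%R))%E.
  rewrite -RintegralB//.
  have Id : mu.-integrable `]0, T[ (EFin \o (fun t => slice_int A h t - mn n t)).
    exact: integrable_sub.
  rewrite (@le_trans _ _ ((\int[mu]_(t in `]0, T[) `|slice_int A h t - mn n t|)%:E))//.
    by rewrite lee_fin; exact: le_normr_Rintegral.
  rewrite -integral_EFin_norm//.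
  have [N [mN N0 subN]] := sh.
  (* w vanishes on the null set N, outside of which the norm of the slice
     controls the integrand *)
  pose w t := (`|slice_int A h t - mn n t| * \1_(~` N) t)%R.
  have wle t : `]0, T[%classic t ->
      ((K + 1)^-1%:E * (w t)%:E <= fnorm (L2 a b) (h t \- simple_eval (s n) t)%R)%E.
    move=> tT; have nn : (0 <= fnorm (L2 a b) (h t \- simple_eval (s n) t)%R)%E.
      exact: Lnorm_ge0.
    rewrite /w indicE; case: (boolP (t \in ~` N)) => tN; last by rewrite mulr0 mule0.
    rewrite mulr1.
    have [L2h _] : L2 a b (h t) /\ fnorm (L2 a b) (h t \- simple_eval (s n) t)%R @[n --> \oo] --> 0%E.
      apply: contrapT => H; move: tN; rewrite inE /= => tN; apply: tN; apply: subN => /=.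
      by move=> H2; apply: H; exact: H2.
    have Iht : mu.-integrable `]a, b[ (EFin \o h t).
      by apply: integrable_ab; exact: L2_integrable.
    have [Ise intse] : mu.-integrable `]a, b[ (EFin \o simple_eval (s n) t) /\
        \int[mu]_(x in A) simple_eval (s n) t x = mn n t.
      have H1 := @Rintegral_sumr _ _ mu `]a, b[%classic _
        (fun (i : 'I_(ssize (s n))) (x : R) => \1_(sset i) t * svec i x) (measurable_itv _).
      have H2 := @Rintegral_sumr _ _ mu A _
        (fun (i : 'I_(ssize (s n))) (x : R) => \1_(sset i) t * svec i x) mA.
      have [|H1' _] := H1; first by move=> i; exact: integrable_mulcl.
      have [|_ H2'] := H2; first by move=> i; exact: integrable_mulcl.
      split => //; rewrite H2'; apply: eq_bigr => i _; rewrite RintegralZl//.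
    have -> : slice_int A h t - mn n t = \int[mu]_(x in A) (h t x - simple_eval (s n) t x).
      rewrite RintegralB ?intse//; [exact: integrableS Iht|exact: integrableS Ise].
    have Idt : mu.-integrable `]a, b[ (EFin \o (fun x => h t x - simple_eval (s n) t x)).
      exact: integrable_sub.
    have := L2_functional_le HK mA AI Idt => Hle.
    apply: (@le_trans _ _ ((K + 1)^-1%:E * (K%:E * fnorm (L2 a b) (h t \- simple_eval (s n) t)%R)))%E.
      by apply: lee_wpmul2l => //; rewrite lee_fin invr_ge0 addr_ge0.
    rewrite muleA -EFinM -[leRHS]mul1e; apply: lee_wpmul2r => //.
    by rewrite lee_fin mulrC ler_pdivrMr ?ltr_wpDl// mul1r lerDl.
  have K1 : 0 < K + 1 by rewrite ltr_wpDl.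
  have mw : measurable_fun `]0, T[ w.
    apply: measurable_funM.
      by apply: measurableT_comp => //; exact: integrable_measurable Id.
    by apply: measurable_funTS; apply: measurable_indic; exact: measurableC.
  have -> : (\int[mu]_(t in `]0%R, T[) (`|slice_int A h t - mn n t|)%:E)%E =
      (\int[mu]_(t in `]0%R, T[) (w t)%:E)%E.
    apply: ae_eq_integral => //.
    - apply/measurable_EFinP; apply: measurableT_comp => //; exact: integrable_measurable Id.
    - exact/measurable_EFinP.
    - exists N; split => // t /= /not_implyP[_]; apply: contra_notP => tN.
      by rewrite /w indicE mem_set// mulr1.
  have -> : (\int[mu]_(t in `]0%R, T[) (w t)%:E =
      (K + 1)%:E * \int[mu]_(t in `]0%R, T[) ((K + 1)^-1%:E * (w t)%:E))%E.
    rewrite ge0_integralZl//.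
    - by rewrite muleA -EFinM divff ?mul1e// gt_eqF.
    - exact/measurable_EFinP.
    - by move=> t _; rewrite lee_fin mulr_ge0.
    - by rewrite lee_fin invr_ge0 ltW.
  apply: lee_wpmul2l; first by rewrite lee_fin ltW.
  apply: ge0_le_integral_le => // t _; rewrite -EFinM lee_fin !mulr_ge0//.
  by rewrite invr_ge0 ltW.
apply/eqP; rewrite -subr_eq0 -normr_eq0 eq_le normr_ge0 andbT.
pose u n := (\int[mu]_(t in `]0%R, T[) fnorm (L2 a b) (h t \- simple_eval (s n) t)%R +
  fnorm (L2 a b) (simple_int T (s n) \- y)%R)%E.
apply: (@cvge0_real_le u _ (K + 1)); first by rewrite addr_ge0.
  rewrite -[X in _ --> X](adde0 0%E); exact: cvgeD.
move=> n; rewrite /u ge0_muleDr; last 2 first.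
- by apply: integral_ge0 => t _; exact: Lnorm_ge0.
- exact: Lnorm_ge0.
apply: (@le_trans _ _ ((`|\int[mu]_(t in `]0, T[) slice_int A h t - \int[mu]_(t in `]0, T[) mn n t| +
  `|\int[mu]_(x in A) simple_int T (s n) x - \int[mu]_(x in A) y x|)%:E)).
  rewrite lee_fin -intmn; apply: le_trans (ler_normD _ _).
  by rewrite addrA subrK.
rewrite EFinD; apply: leeD; first exact: step1.
apply: (le_trans (step2 n)); apply: lee_wpmul2r; first exact: Lnorm_ge0.
by rewrite lee_fin lerDl.
Qed.

End pairing.

(** * Integral representation in time *)

Section time_representation.
Variable R : realType.
Local Notation mu := (@lebesgue_measure R).
Local Notation RR := (measurableTypeR R * measurableTypeR R)%type.
Implicit Types (f g h : R -> R -> R) (a b T : R) (A : set R) (k : RR -> R).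

(** Fubini for real-valued integrals. The inner integral is finite only for
    almost all parameters, and taking its real value changes it on a null
    set. *)
Lemma RFubini k : (mu \x mu)%E.-integrable setT (EFin \o k) ->
  [/\ mu.-integrable setT (EFin \o (fun s => \int[mu]_x k (s, x))),
      mu.-integrable setT (EFin \o (fun x => \int[mu]_s k (s, x))) &
      \int[mu]_s (\int[mu]_x k (s, x)) = \int[mu]_x (\int[mu]_s k (s, x))].
Proof.
move=> Ik.
have fin (F : measurableTypeR R -> \bar R) : mu.-integrable setT F ->
    mu.-integrable setT (EFin \o (fine \o F)) /\
    (\int[mu]_s (fine (F s))%:E = \int[mu]_s F s)%E.
  move=> IF; have mF : measurable_fun setT F by case/integrableP : IF.
  have mfF : measurable_fun setT (EFin \o (fine \o F)).
    by apply/measurable_EFinP; exact: measurableT_comp.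
  split.
    apply: le_integrable IF => // t _ /=.
    by case: (F t) => [r| |]//=; rewrite ?leey// normr0 leey.
  apply: ae_eq_integral => //.
  have := integrable_ae measurableT IF; apply: ae_imp => t H _ /=.
  by rewrite fineK// H.
have [I1 E1] := fin _ (integrable_fubini_F Ik).
have IG : mu.-integrable setT (fubini_G mu (EFin \o k)).
  apply/integrableP; split; first exact: (measurable_fubini_G Ik).
  have mk : measurable_fun setT (EFin \o k) by case/integrableP : Ik.
  apply: le_lt_trans ((integrable21ltyP mu mu mk).1 Ik).
  apply: ge0_le_integral_le => // x _; apply: le_abse_integral => //.
  exact: measurableT_comp.
have [I2 E2] := fin _ IG.
split; [exact: I1|exact: I2|].
rewrite /Rintegral; congr fine.
by have := Fubini Ik; rewrite -E1 -E2.
Qed.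

(** Multiplication by the indicator of S x A reduces the integral over a
    rectangle of measurable sets to the whole plane. *)
Lemma RFubini_in k (S A : set R) : (mu \x mu)%E.-integrable setT (EFin \o k) ->
  measurable S -> measurable A ->
  [/\ mu.-integrable S (EFin \o (fun s => \int[mu]_(x in A) k (s, x))),
      mu.-integrable A (EFin \o (fun x => \int[mu]_(s in S) k (s, x))) &
      \int[mu]_(s in S) (\int[mu]_(x in A) k (s, x)) =
      \int[mu]_(x in A) (\int[mu]_(s in S) k (s, x))].
Proof.
move=> Ik mS mA.
pose c (z : RR) : R := \1_S z.1 * \1_A z.2.
have mc : measurable_fun setT c.
  by apply: measurable_funM; apply: measurableT_comp => //; exact: measurable_indic.
have c1 z : `|c z| <= 1.
  by rewrite /c !indicE; case: (_ \in _); case: (_ \in _);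
    rewrite ?mulr0 ?mulr1 ?mul0r ?normr1 ?normr0.
have Ick : (mu \x mu)%E.-integrable setT (EFin \o (fun z => c z * k z)).
  exact: (@integrable_bounded_mul _ _ _ _ setT _ c _ 1).
have [I1 I2 E] := RFubini Ick.
have Ex s : \int[mu]_x (c (s, x) * k (s, x)) = \1_S s * \int[mu]_(x in A) k (s, x).
  rewrite /c [in RHS]Rintegral_mkcond /= !indicE.
  case: (boolP (s \in S)) => [_|_] /=.
    rewrite !mul1r; apply: eq_Rintegral => x _; rewrite patchE indicE.
    by case: (x \in A); rewrite /= ?mul1r ?mul0r.
  rewrite mul0r (@eq_Rintegral _ _ _ mu _ (cst 0)) ?Rintegral_cst ?mul0r//.
  by move=> x _; rewrite !mul0r.
have Es x : \int[mu]_s (c (s, x) * k (s, x)) = \1_A x * \int[mu]_(s in S) k (s, x).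
  rewrite /c [in RHS]Rintegral_mkcond /= !indicE.
  case: (boolP (x \in A)) => [_|_] /=.
    rewrite !mul1r; apply: eq_Rintegral => s _; rewrite patchE indicE.
    by case: (s \in S); rewrite /= ?mul1r ?mul0r.
  rewrite mul0r (@eq_Rintegral _ _ _ mu _ (cst 0)) ?Rintegral_cst ?mul0r//.
  by move=> s _; rewrite mulr0 mul0r.
split.
- have I1S : mu.-integrable S (EFin \o (fun s => \int[mu]_x (c (s, x) * k (s, x)))).
    exact: integrableS I1.
  by apply: eq_integrable I1S => // s sS; rewrite /= Ex indicE sS mul1r.
- have I2A : mu.-integrable A (EFin \o (fun x => \int[mu]_s (c (s, x) * k (s, x)))).
    exact: integrableS I2.
  by apply: eq_integrable I2A => // x xA; rewrite /= Es indicE xA mul1r.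
- rewrite [LHS]Rintegral_mkcond [RHS]Rintegral_mkcond.
  transitivity (\int[mu]_s (\int[mu]_x (c (s, x) * k (s, x)))).
    apply: eq_Rintegral => s _; rewrite Ex patchE indicE.
    by case: (s \in S); rewrite ?mul1r ?mul0r.
  rewrite E; apply: eq_Rintegral => x _; rewrite Es patchE indicE.
  by case: (x \in A); rewrite ?mul1r ?mul0r.
Qed.

Lemma RFubini_cutoff a b T f (S A : set R) :
  (mu \x mu)%E.-integrable setT (EFin \o cutoff a b T f) ->
  measurable S -> S `<=` `]0, T[ -> measurable A -> A `<=` `]a, b[ ->
  mu.-integrable A (EFin \o (fun x => \int[mu]_(s in S) f s x)) /\
  \int[mu]_(s in S) slice_int A f s = \int[mu]_(x in A) (\int[mu]_(s in S) f s x).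
Proof.
move=> If mS ST mA AI; have [_ I2 E] := RFubini_in If mS mA.
have Es x : x \in A ->
    \int[mu]_(s in S) cutoff a b T f (s, x) = \int[mu]_(s in S) f s x.
  move=> /set_mem /AI xab; apply: eq_Rintegral => s /set_mem /ST sT.
  by rewrite cutoffE.
split; first by apply: eq_integrable I2 => // x xA; rewrite /= Es.
transitivity (\int[mu]_(x in A) (\int[mu]_(s in S) cutoff a b T f (s, x))).
  rewrite -E; apply: eq_Rintegral => s /set_mem /ST sT.
  by apply: eq_Rintegral => x /set_mem /AI xab; rewrite cutoffE.
by apply: eq_Rintegral => x xA; rewrite Es.
Qed.

Lemma LX_ae_mem (p : \bar R) T (X : fspace R) f : LX p T X f ->
  {ae mu, forall t : R, t \in `]0, T[ -> X (f t)}.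
Proof.
by move=> [[s [_ H]] _]; move: H; apply: ae_imp => t H tT; have [] := H tT.
Qed.

Lemma cutoff_scale a b T f (c : R -> R) (B : R) :
  (mu \x mu)%E.-integrable setT (EFin \o cutoff a b T f) ->
  continuous c -> (forall t, t \in `]0, T[ -> `|c t| <= B) ->
  (mu \x mu)%E.-integrable setT (EFin \o cutoff a b T (fun t x => c t * f t x)).
Proof.
move=> If cc cB.
pose k (z : RR) : R := (c \_ `]0, T[) z.1.
have mk : measurable_fun setT k.
  apply: measurableT_comp => //.
  apply: (proj1 (measurable_restrictT _ _)); first exact: measurable_itv.
  by apply: measurable_funTS; exact: continuous_measurable_fun.
have k1 z : `|k z| <= `|B|.
  rewrite /k patchE; case: ifPn => [/set_mem tT|_]; last by rewrite normr0.
  by apply: (le_trans (cB _ tT)); exact: ler_norm.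
have := cutoff_mul_integrable If mk k1; apply: eq_integrable => // -[t x] _ /=.
rewrite /k /=; congr EFin; rewrite patchE.
have [tT|tT] := boolP (t \in `]0, T[); last by rewrite !cutoff_out// mulr0.
rewrite mem_set//.
have [xT|xT] := boolP (x \in `]a, b[); last by rewrite !cutoff_out2// mulr0.
by rewrite !cutoffE.
Qed.

Lemma ae_Rintegral_eq (D : set R) (f g : R -> R) : measurable D ->
  mu.-integrable D (EFin \o f) -> mu.-integrable D (EFin \o g) ->
  {ae mu, forall t : R, D t -> f t = g t} ->
  \int[mu]_(t in D) f t = \int[mu]_(t in D) g t.
Proof.
move=> mD If Ig H; apply: ae_eq_Rintegral => //.
- exact: integrable_measurable If.
- exact: integrable_measurable Ig.
Qed.

(** Both sides of the vector-valued identity are Bochner integrals. Applying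
    to them the functional that integrates over A gives the scalar weak
    derivative. *)
Lemma weak_time_derivative_slice a b T f f1 A :
  (mu \x mu)%E.-integrable setT (EFin \o cutoff a b T f) ->
  (mu \x mu)%E.-integrable setT (EFin \o cutoff a b T f1) ->
  {ae mu, forall t : R, t \in `]0, T[ -> L2 a b (f t)} ->
  {ae mu, forall t : R, t \in `]0, T[ -> L2 a b (f1 t)} ->
  measurable A -> A `<=` `]a, b[ -> 0 < T ->
  is_tderiv T (L2 a b) f f1 ->
  forall phi, test_fun 0 T phi ->
  \int[mu]_(t in `]0, T[) (slice_int A f t * derive1 phi t) =
  - \int[mu]_(t in `]0, T[) (slice_int A f1 t * phi t).
Proof.
move=> If If1 Lf Lf1 mA AI T0 H phi tphi.
have [sphi _ _] := tphi.
have bnd (c : R -> R) c' : ac 0 T c c' -> exists B, forall t, t \in `]0, T[ -> `|c t| <= B.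
  move=> acc; exists (`|c 0| + \int[mu]_(t in `]0, T]) `|c' t|) => t.
  by rewrite in_itv /= => /andP[t0 tT]; apply: ac_bounded acc _; rewrite !ltW.
have scale g (c c' : R -> R) (y : R -> R) : continuous c -> ac 0 T c c' ->
    (mu \x mu)%E.-integrable setT (EFin \o cutoff a b T g) ->
    {ae mu, forall t : R, t \in `]0, T[ -> L2 a b (g t)} ->
    is_bochner_int T (L2 a b) (fun t x => c t * g t x) y ->
    \int[mu]_(t in `]0, T[) (slice_int A g t * c t) = \int[mu]_(x in A) y x.
  move=> cc acc Ig Lg By; have [B HB] := bnd _ _ acc.
  have Icg := cutoff_scale Ig cc HB.
  rewrite -(bochner_int_functional Icg mA AI By).
  apply: ae_Rintegral_eq => //.
  - have := @integrable_bounded_mul _ _ _ mu `]0, T[%classic (measurable_itv _) c _ B.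
    move=> /(_ (slice_int A g)) h; apply: eq_integrable (h _ _ _) => //.
    + by move=> t _ /=; rewrite mulrC.
    + by apply: (@measurable_funS _ _ _ _ setT) => //; exact: continuous_measurable_fun.
    + exact: slice_integrable Ig mA AI.
  - exact: slice_integrable Icg mA AI.
  - move: Lg; apply: ae_imp => t Lg tT.
    rewrite {2}/slice_int RintegralZl//; first by rewrite mulrC.
    exact: L2_integrable_sub (Lg tT).
have [y [B1 B2]] := H phi tphi.
have ac1 := smooth_ac (ltW T0) sphi.
have ac2 := smooth_ac (ltW T0) (smooth_derive1 sphi).
rewrite (scale f _ _ y _ ac2 If Lf B1); last exact: smooth_continuous (smooth_derive1 sphi).
rewrite (scale f1 _ _ _ _ ac1 If1 Lf1 B2); last exact: smooth_continuous.
have IyA : mu.-integrable A (EFin \o y).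
  by case: B1 => Ly _; exact: L2_integrable_sub Ly.
rewrite -[LHS]opprK; congr (- _).
rewrite -[LHS]mulN1r -RintegralZl//; apply: eq_Rintegral => x _; exact: mulN1r.
Qed.

(** The du Bois-Reymond lemma in time determines the slice integral up to a
    constant. The constant is identified by letting t tend to 0 along times
    at which f coincides with its continuous representative g. *)
Lemma slice_ac a b T f f1 (f0 : R -> R) A :
  (mu \x mu)%E.-integrable setT (EFin \o cutoff a b T f) ->
  (mu \x mu)%E.-integrable setT (EFin \o cutoff a b T f1) ->
  {ae mu, forall t : R, t \in `]0, T[ -> L2 a b (f t)} ->
  {ae mu, forall t : R, t \in `]0, T[ -> L2 a b (f1 t)} ->
  measurable A -> A `<=` `]a, b[ -> 0 < T ->
  is_tderiv T (L2 a b) f f1 -> attains a b T (L2 a b) f f0 ->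
  mu.-integrable `]a, b] (EFin \o f0) ->
  {ae mu, forall t : R, t \in `]0, T[ ->
     slice_int A f t = \int[mu]_(x in A) f0 x + \int[mu]_(s in `]0, t]) slice_int A f1 s}.
Proof.
move=> If If1 Lf Lf1 mA AI T0 H [g [Cg gf g0]] If0.
have w := weak_time_derivative_slice If If1 Lf Lf1 mA AI T0 H.
have oc (k0 : R -> R) : mu.-integrable `]0, T[ (EFin \o k0) -> mu.-integrable `]0, T] (EFin \o k0).
  exact: (@integrable_itv_bnd _ false true false false).
have Is1 := oc _ (slice_integrable If1 mA AI).
have [c Hc] := du_bois_reymond T0 (oc _ (slice_integrable If mA AI)) Is1 w.
have [K K0 HK] := L1_le_L2 a b.
have T00 : 0 \in `[0, T] by rewrite in_itv /= lexx ltW.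
have [Lg0 cg0] := Cg 0 T00.
have IgA t : t \in `[0, T] -> mu.-integrable A (EFin \o g t).
  by move=> tT; exact: L2_integrable_sub mA AI (Cg t tT).1.
have Igab t : t \in `[0, T] -> mu.-integrable `]a, b[ (EFin \o g t).
  by move=> tT; apply: integrable_ab; apply: L2_integrable; exact: (Cg t tT).1.
have IfA : mu.-integrable A (EFin \o f0).
  by apply: integrableS If0 => // x /AI; exact: subset_itv_oo_oc.
have gf0 : \int[mu]_(x in A) g 0 x = \int[mu]_(x in A) f0 x.
  apply: ae_Rintegral_eq => //; first exact: IgA.
  by move: g0; apply: ae_imp => x h xA; apply: h; exact: AI.
suff c0 : c = \int[mu]_(x in A) g 0 x.
  move: Hc; apply: ae_imp => t h tT; rewrite h//.
  by rewrite c0 gf0.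
apply/eqP; rewrite -subr_eq0 -normr_eq0 eq_le normr_ge0 andbT.
apply/ler_addgt0Pr => e e0; rewrite add0r.
have K1 : 0 < K + 1 by rewrite ltr_wpDl.
have e2 : 0 < e / 2 by rewrite divr_gt0.
have cI := integral_ub_continuous (ltW T0) Is1.
have [_ cI0 _] := (continuous_within_itvP _ T0).1 cI.
have Z0 : \int[mu]_(t in `]0, 0]) slice_int A f1 t = 0.
  have -> : `]0, 0]%classic = set0 :> set R by rewrite set_itv_ge// bnd_simp ltxx.
  by rewrite Rintegral_set0.
rewrite Z0 in cI0.
have /cvgrPdist_lt/(_ _ e2) := cI0.
rewrite near_withinE /= near_simpl => -[d1 /= d10 Hd1].
have /fine_cvgP[fin0 /cvgrPdist_lt/(_ _ (divr_gt0 e2 K1))] := cg0.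
move: fin0; rewrite !near_withinE /= !near_simpl => -[d2 /= d20 Hd2] -[d3 /= d30 Hd3].
pose d := Num.min (Num.min d1 d2) (Num.min d3 T).
have d0 : 0 < d by rewrite !lt_min d10 d20 d30.
(* the three properties hold together at some positive time below every
   threshold, as they hold almost everywhere *)
have good := ae_and Hc (ae_and gf Lf).
have [t /andP[t0 td] [h1 [h2 h3]]] := ae_exists_in_itv d0 good.
move: td; rewrite /d !lt_min => /andP[/andP[td1 td2] /andP[td3 tT]].
have tin : t \in `]0, T[ by rewrite in_itv /= t0.
have tin' : t \in `[0, T] by rewrite in_itv /= !ltW.
have b0 (r : R) : t < r -> ball_ [eta Num.norm] 0 r t.
  by move=> tr; rewrite /ball_ /= sub0r normrN gtr0_norm.
have := Hd1 t (b0 _ td1) t0; rewrite sub0r normrN => r1.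
have := Hd3 t (b0 _ td3) tin'; rewrite sub0r normrN => r3.
have f3 := Hd2 t (b0 _ td2) tin'.
have gfA : slice_int A f t = \int[mu]_(x in A) g t x.
  apply: ae_Rintegral_eq => //.
  - exact: L2_integrable_sub (h3 tin).
  - exact: IgA.
  - by move: (h2 tin); apply: ae_imp => x h xA; apply/esym; apply: h; exact: AI.
have := h1 tin; rewrite gfA => E.
have -> : c - \int[mu]_(x in A) g 0 x =
   (\int[mu]_(x in A) g t x - \int[mu]_(x in A) g 0 x) -
   \int[mu]_(s in `]0, t]) slice_int A f1 s by rewrite E; ring.
apply: (le_trans (ler_normB _ _)).
rewrite [leRHS](splitr e); apply: lerD; last exact: ltW.
rewrite -RintegralB//; [|exact: IgA|exact: IgA].
have Idab : mu.-integrable `]a, b[ (EFin \o (fun x => g t x - g 0 x)).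
  by apply: integrable_sub => //; exact: Igab.
rewrite -lee_fin; apply: (le_trans (L2_functional_le HK mA AI Idab)).
apply: (@le_trans _ _ (K%:E * (e / 2 / (K + 1))%:E)%E).
  apply: lee_wpmul2l; first by rewrite lee_fin.
  have : (fnorm (L2 a b) (g t \- g 0)%R <= (e / 2 / (K + 1))%:E)%E.
    have f3' : fnorm (L2 a b) (g t \- g 0)%R \is a fin_num by exact: f3.
    rewrite -(fineK f3') lee_fin; apply: ltW; apply: le_lt_trans r3.
    exact: ler_norm.
  exact.
by rewrite -EFinM lee_fin mulrA ler_pdivrMr// mulrC ler_pM2l// lerDl.
Qed.

(** For almost all t the formula of slice_ac holds simultaneously for all
    A = ]p, q] with p and q rational. Two integrable functions of x with the
    same integrals over these intervals coincide almost everywhere. *)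
Lemma time_representation a b T f f1 (f0 : R -> R) :
  (mu \x mu)%E.-integrable setT (EFin \o cutoff a b T f) ->
  (mu \x mu)%E.-integrable setT (EFin \o cutoff a b T f1) ->
  {ae mu, forall t : R, t \in `]0, T[ -> L2 a b (f t)} ->
  {ae mu, forall t : R, t \in `]0, T[ -> L2 a b (f1 t)} -> 0 < T ->
  is_tderiv T (L2 a b) f f1 -> attains a b T (L2 a b) f f0 ->
  mu.-integrable `]a, b] (EFin \o f0) ->
  {ae mu, forall t : R, t \in `]0, T[ -> ae_eq mu `]a, b[%classic (f t)
     (fun x => f0 x + \int[mu]_(s in `]0, t]) f1 s x)}.
Proof.
move=> If If1 Lf Lf1 T0 H att If0.
have sub (p q : R) : a < p -> q < b -> `]p, q] `<=` `]a, b[.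
  move=> ap qb x /=; rewrite !in_itv /= => /andP[px xq].
  by rewrite (lt_trans ap px) (le_lt_trans xq qb).
have E (pq : rat * rat) : {ae mu, forall t : R, a < ratr pq.1 -> ratr pq.2 < b ->
    t \in `]0, T[ -> slice_int `]ratr pq.1, ratr pq.2] f t =
    \int[mu]_(x in `]ratr pq.1, ratr pq.2]) f0 x +
    \int[mu]_(s in `]0, t]) slice_int `]ratr pq.1, ratr pq.2] f1 s}.
  have [ap|pa] := ltP a (ratr pq.1); last by apply: aeW.
  have [qb|bq] := ltP (ratr pq.2) b; last by apply: aeW.
  have := slice_ac If If1 Lf Lf1 (measurable_itv _) (sub _ _ ap qb) T0 H att If0.
  by apply: ae_imp => t h _ _; exact: h.
move: (ae_forall_count E) Lf; apply: ae_imp2 => t Ht Lt tT.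
have tT' : `]0, t] `<=` `]0, T[.
  move: tT; rewrite in_itv /= => /andP[_ tT] s /=; rewrite !in_itv /= => /andP[-> /=].
  by move=> /le_lt_trans; apply.
have [Iab _] := RFubini_cutoff If1 (measurable_itv _) tT' (measurable_itv _) (@subset_refl _ `]a, b[%classic).
have Ift := L2_integrable (Lt tT).
have Isum : mu.-integrable `]a, b] (EFin \o (fun x => f0 x + \int[mu]_(s in `]0, t]) f1 s x)).
  by apply: integrable_add => //; exact: (@integrable_itv_bnd _ false true false false).
have : ae_eq mu `]a, b[%classic
    (fun x => f t x - (f0 x + \int[mu]_(s in `]0, t]) f1 s x)) (cst 0).
  apply: ae_eq0_rational_intervals.
    move=> p q ap pq qb; apply: integrable_sub => //.
      exact: integrable_sub_itv (ltW ap) (ltW qb) Ift.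
    exact: integrable_sub_itv (ltW ap) (ltW qb) Isum.
  move=> p q ap pq qb.
  have [Ipq Epq] := RFubini_cutoff If1 (measurable_itv _) tT' (measurable_itv _) (sub _ _ ap qb).
  have I1 := integrable_sub_itv (ltW ap) (ltW qb) Ift.
  have I0 := integrable_sub_itv (ltW ap) (ltW qb) If0.
  rewrite RintegralB//; last exact: integrable_add.
  have := Ht (p, q) ap qb tT; rewrite /= Epq /slice_int => ->.
  by rewrite RintegralD// subrr.
apply: ae_imp => x h xab; have := h xab => /= /eqP.
by rewrite subr_eq0 => /eqP.
Qed.

End time_representation.

(** * Comparison by the cubic energy *)

(** Tonelli, applied to the positive and negative parts. *)
Lemma measurable_Rintegral_param d (X : measurableType d) (R : realType)
    (k : X * measurableTypeR R -> R) : measurable_fun setT k ->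
  measurable_fun setT (fun z => \int[@lebesgue_measure R]_s k (z, s)).
Proof.
move=> mk; set mu := @lebesgue_measure R.
apply: measurableT_comp => //.
have mk' : measurable_fun setT (EFin \o k) by exact/measurable_EFinP.
rewrite (_ : (fun z => _) = (fun z => (\int[mu]_s (EFin \o k)^\+ (z, s) -
    \int[mu]_s (EFin \o k)^\- (z, s))%E)); last first.
  apply/funext => z; rewrite [LHS]integralE; congr (_ - _)%E;
    by apply: eq_integral => s _; rewrite ?funeposE ?funenegE.
apply: emeasurable_funB.
  apply: (measurable_fun_fubini_tonelli_F (EFin \o k)^\+%E) => //.
  exact: measurable_funepos.
apply: (measurable_fun_fubini_tonelli_F (EFin \o k)^\-%E) => //.
exact: measurable_funeneg.
Qed.

Section comparison.
Variable R : realType.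
Local Notation mu := (@lebesgue_measure R).
Local Notation RR := (measurableTypeR R * measurableTypeR R)%type.
Implicit Types (a b T : R) (k V D : RR -> R).

Lemma measurable_lt_indicator d (X : measurableType d) (f g : X -> R) (c : R) :
  measurable_fun setT f -> measurable_fun setT g ->
  measurable_fun setT (fun z => (c < f z <= g z)%R%:R : R).
Proof.
move=> mf mg.
have m1 : measurable_fun setT (fun z => (c < f z) && (f z <= g z)).
  apply: measurable_and; first exact: measurable_fun_ltr.
  exact: measurable_fun_ler.
rewrite (_ : (fun z => _) = (fun z => if (c < f z) && (f z <= g z) then 1 else 0 : R)); last first.
  by apply/funext => z; case: (_ && _).
exact: measurable_fun_ifT.
Qed.

(** The variable upper bound is moved into the integrand as an indicator
    that is jointly measurable. *)
Lemma measurable_time_primitive k : measurable_fun setT k ->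
  measurable_fun setT (fun z : RR => \int[mu]_(s in `]0, z.1]) k (s, z.2)).
Proof.
move=> mk.
have := @measurable_Rintegral_param _ RR R
  (fun zs : RR * measurableTypeR R => (0 < zs.2 <= zs.1.1)%R%:R * k (zs.2, zs.1.2)).
move=> H; rewrite (_ : (fun z : RR => _) =
    (fun z : RR => \int[mu]_s ((0 < s <= z.1)%R%:R * k (s, z.2)))); last first.
  apply/funext => z; rewrite Rintegral_mkcond; apply: eq_Rintegral => s _.
  rewrite patchE mem_setE in_itv /=.
  by case: ifP => _; rewrite ?mul1r ?mul0r.
apply: H; apply: measurable_funM.
  apply: measurable_lt_indicator => //.
  exact: measurableT_comp measurable_fst measurable_fst.
apply: measurableT_comp => //; apply: measurable_fun_pair => //.
exact: measurableT_comp measurable_snd measurable_fst.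
Qed.

Lemma measurable_space_primitive a k : measurable_fun setT k ->
  measurable_fun setT (fun z : RR => \int[mu]_(x in `]a, z.2]) k (z.1, x)).
Proof.
move=> mk.
have := @measurable_Rintegral_param _ RR R
  (fun zs : RR * measurableTypeR R => (a < zs.2 <= zs.1.2)%R%:R * k (zs.1.1, zs.2)).
move=> H; rewrite (_ : (fun z : RR => _) =
    (fun z : RR => \int[mu]_x ((a < x <= z.2)%R%:R * k (z.1, x)))); last first.
  apply/funext => z; rewrite Rintegral_mkcond; apply: eq_Rintegral => s _.
  rewrite patchE mem_setE in_itv /=.
  by case: ifP => _; rewrite ?mul1r ?mul0r.
apply: H; apply: measurable_funM.
  apply: measurable_lt_indicator => //.
  exact: measurableT_comp measurable_snd measurable_fst.
apply: measurableT_comp => //; apply: measurable_fun_pair => //.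
exact: measurableT_comp measurable_fst measurable_fst.
Qed.

(** The bound is only required on almost all slices, which is how estimates
    from function spaces in x arrive; Tonelli turns it into joint
    integrability. *)
Lemma integrable_slicewise_le k V : measurable_fun setT k ->
  (mu \x mu)%E.-integrable setT (EFin \o V) ->
  {ae mu, forall t : R, {ae mu, forall x : R, `|k (t, x)| <= `|V (t, x)|}} ->
  (mu \x mu)%E.-integrable setT (EFin \o k).
Proof.
move=> mk IV H.
have mk' : measurable_fun setT (EFin \o k) by exact/measurable_EFinP.
have mV : measurable_fun setT (EFin \o V) by case/integrableP : IV.
have nk (h : RR -> R) : measurable_fun setT (EFin \o h) ->
    measurable_fun setT (fun z => (`|h z|)%:E) /\
    forall t, measurable_fun setT (fun x : measurableTypeR R => (`|h (t, x)|)%:E).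
  move=> /measurable_EFinP mh; split; first by apply/measurable_EFinP; exact: measurableT_comp.
  by move=> t; apply/measurable_EFinP; apply: measurableT_comp => //; apply: measurableT_comp.
have [nk1 nk2] := nk _ mk'; have [nV1 nV2] := nk _ mV.
apply/(integrable12ltyP mu mu mk').
apply: le_lt_trans ((integrable12ltyP mu mu mV).1 IV) => /=.
apply: ae_ge0_le_integral => //.
- by move=> t _; apply: integral_ge0.
- exact: (measurable_fun_fubini_tonelli_F (fun z => (`|k z|)%:E)).
- by move=> t _; apply: integral_ge0.
- exact: (measurable_fun_fubini_tonelli_F (fun z => (`|V z|)%:E)).
- move: H; apply: ae_imp => t Ht _; apply: ae_ge0_le_integral => //.
  by move: Ht; apply: ae_imp => x h _; rewrite lee_fin.
Qed.

Lemma ae_product_coordinates (P : R -> Prop) : {ae mu, forall x : R, P x} ->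
  {ae (mu \x mu)%E, forall z : RR, P z.1} /\ {ae (mu \x mu)%E, forall z : RR, P z.2}.
Proof.
move=> [N [mN N0 subN]]; split.
  exists (N `*` setT); split; first exact: measurableX.
    by rewrite product_measure1E//= N0 mul0e.
  by move=> z /= Pz; split => //; exact: subN.
exists (setT `*` N); split; first exact: measurableX.
  by rewrite product_measure1E//= N0 mule0.
by move=> z /= Pz; split => //; exact: subN.
Qed.

(** A statement on almost all slices gives one for the product measure
    provided that the exceptional set is jointly measurable. The function
    (c - f)^+ is measurable and has integral 0 by Tonelli. The sides of the
    rectangle are null. *)
Lemma ae_rect_slices a b T (f : R -> R -> R) (c : R) : joint_measurable a b T f ->
  {ae mu, forall t : R, t \in `]0, T[ ->
    {ae mu, forall x : R, x \in `]a, b[ -> c <= f t x}} ->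
  ae_rect `[0, T] `[a, b] (fun t x => c <= f t x).
Proof.
move=> mf H; pose h := cutoff a b T (fun t x => pos (c - f t x)).
have mh : measurable_fun setT h.
  apply: measurable_cutoff; rewrite /joint_measurable.
  have mpos : measurable_fun setT (@pos R).
    by apply: continuous_measurable_fun; exact: continuous_pos.
  have mc : measurable_fun (`]0, T[ `*` `]a, b[) (fun z : RR => c - f z.1 z.2).
    exact: measurable_funB.
  exact: measurableT_comp mpos mc.
have h0 z : (0 <= (h z)%:E)%E.
  by rewrite lee_fin /h /cutoff patchE; case: ifP => // _; exact: pos_ge0.
have mh' : measurable_fun setT (EFin \o h) by exact/measurable_EFinP.
have int0 : (\int[mu \x mu]_z (h z)%:E = 0)%E.
  rewrite (fubini_tonelli1 (EFin \o h))//.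
  have mF := measurable_fun_fubini_tonelli_F (EFin \o h) mh' h0.
  have F0 : ae_eq mu setT (fubini_F mu (EFin \o h)) (cst 0%E).
    move: H; apply: ae_imp => t Ht _; rewrite /fubini_F.
    have [tT|tT] := boolP (t \in `]0, T[); last first.
      by rewrite (eq_integral (cst 0%E)) ?integral0// => x _; rewrite /= /h cutoff_out.
    have mht : measurable_fun setT (fun x : measurableTypeR R => (h (t, x))%:E).
      by apply/measurable_EFinP; apply: measurableT_comp.
    rewrite (ae_eq_integral (cst 0%E)) ?integral0//.
    move: (Ht tT); apply: ae_imp => x hx _ /=; congr EFin; rewrite /h.
    have [xab|xab] := boolP (x \in `]a, b[); last by rewrite cutoff_out2.
    by rewrite cutoffE// pos_if subr_ge0; case: ifP => // cf; apply/eqP; rewrite subr_eq0 eq_le cf hx.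
  by rewrite (ae_eq_integral (cst 0%E)) ?integral0.
have /ae_eq_integral_abs : (\int[mu \x mu]_z `|(h z)%:E| = 0)%E.
  by rewrite -[RHS]int0; apply: eq_integral => z _; rewrite gee0_abs.
move=> /(_ measurableT mh') hz.
have [n0 _] := ae_product_coordinates (ae_neq 0).
have [nT _] := ae_product_coordinates (ae_neq T).
have [_ na] := ae_product_coordinates (ae_neq a).
have [_ nb] := ae_product_coordinates (ae_neq b).
move: (ae_and n0 nT) (ae_and hz (ae_and na nb)).
apply: ae_imp2 => -[t x] /= [t0 tT] [hz0 [xa xb]].
rewrite !in_itv /= => /andP[t0' tT'] /andP[ax bx].
have tin : t \in `]0, T[ by rewrite in_itv /= !lt_neqAle t0' tT' eq_sym; move/eqP: t0 => ->; move/eqP: tT => ->.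
have xin : x \in `]a, b[ by rewrite in_itv /= !lt_neqAle ax bx eq_sym; move/eqP: xa => ->; move/eqP: xb => ->.
have := hz0 I; rewrite /h /= cutoffE// => -[]; rewrite pos_if; case: ifP.
  by move=> _ /eqP; rewrite subr_eq0 => /eqP ->.
by rewrite subr_ge0 => /negbT; rewrite -ltNge => /ltW.
Qed.

Lemma ae_Rintegral_ge0 (A : set R) (g : R -> R) : measurable A ->
  mu.-integrable A (EFin \o g) -> {ae mu, forall t : R, A t -> 0 <= g t} ->
  0 <= \int[mu]_(t in A) g t.
Proof.
move=> mA Ig g0; have mg := integrable_measurable Ig.
rewrite (@ae_eq_Rintegral _ A g (fun t => `|g t|))//.
- by apply: Rintegral_ge0 => t _.
- exact: measurableT_comp.
- by move: g0; apply: ae_imp => t h At; rewrite ger0_norm// h.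
Qed.

Lemma Rintegral_ge0_eq0 (A : set R) (g : R -> R) : measurable A ->
  mu.-integrable A (EFin \o g) -> (forall t, 0 <= g t) ->
  \int[mu]_(t in A) g t = 0 -> {ae mu, forall t : R, A t -> g t = 0}.
Proof.
move=> mA Ig g0 I0.
have /ae_eq_integral_abs : (\int[mu]_(s in A) `|(g s)%:E| = 0)%E.
  transitivity (\int[mu]_(s in A) (`|g s|)%:E)%E; first exact: eq_integral.
  rewrite integral_EFin_norm//; congr (EFin _); rewrite -[RHS]I0.
  by apply: eq_Rintegral => s _; rewrite ger0_norm.
have mg : measurable_fun A (EFin \o g) by case/integrableP : Ig.
by move=> /(_ mA mg); apply: ae_imp => t Ht At; have := Ht At => /= -[].
Qed.

Lemma ae_slice_integrable k : (mu \x mu)%E.-integrable setT (EFin \o k) ->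
  {ae mu, forall t : R, mu.-integrable setT (EFin \o (fun x => k (t, x)))} /\
  {ae mu, forall x : R, mu.-integrable setT (EFin \o (fun t => k (t, x)))}.
Proof.
move=> Ik; have mk : measurable_fun setT (EFin \o k) by case/integrableP : Ik.
have mk' : measurable_fun setT k by exact/measurable_EFinP.
have mn : measurable_fun setT (fun z => (`|k z|)%:E).
  by apply/measurable_EFinP; exact: measurableT_comp.
have n0 z : (0 <= (`|k z|)%:E)%E by rewrite lee_fin.
have fin (H : measurableTypeR R -> \bar R) : measurable_fun setT H ->
    (forall t, 0 <= H t)%E -> (\int[mu]_t H t < +oo)%E ->
    {ae mu, forall t : R, (H t < +oo)%E}.
  move=> mH H0 Hoo; have IH : mu.-integrable setT H.
    apply/integrableP; split => //; move: Hoo; apply: le_lt_trans.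
    by apply: ge0_le_integral_le => t _; rewrite ?gee0_abs// abse_ge0.
  have := integrable_ae measurableT IH; apply: ae_imp => t Ht.
  by rewrite -ge0_fin_numE//; exact: Ht.
split.
- have := (integrable12ltyP mu mu mk).1 Ik => /(fin _ _) h.
  have := h (measurable_fun_fubini_tonelli_F (fun z => (`|k z|)%:E) mn n0)
    (fun t => integral_ge0 _ (fun x _ => abse_ge0 _)).
  apply: ae_imp => t Ht; apply/integrableP; split => //.
  by apply/measurable_EFinP; apply: measurableT_comp.
- have := (integrable21ltyP mu mu mk).1 Ik => /(fin _ _) h.
  have := h (measurable_fun_fubini_tonelli_G (fun z => (`|k z|)%:E) mn n0)
    (fun t => integral_ge0 _ (fun x _ => abse_ge0 _)).
  apply: ae_imp => t Ht; apply/integrableP; split => //.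
  by apply/measurable_EFinP; apply: measurableT_comp.
Qed.

(** The function exp(- K t) times the primitive of F is nonnegative,
    vanishes at 0, and has a nonpositive derivative. *)
Lemma gronwall_zero T (K : R) (F : R -> R) : 0 < T ->
  mu.-integrable `]0, T] (EFin \o F) -> (forall t, 0 <= F t) ->
  {ae mu, forall t : R, t \in `]0, T[ -> F t <= K * \int[mu]_(s in `]0, t]) F s} ->
  {ae mu, forall t : R, t \in `]0, T[ -> F t = 0}.
Proof.
move=> T0 IF F0 H.
pose E t := 0 + \int[mu]_(s in `]0, t]) F s.
have acE : ac 0 T E F by exact: ac_integral.
have ace := ac_mul (ltW T0) (ac_comp (ltW T0) (ac_linear (- K) (ltW T0)) (locally_C11_expR R)) acE.
have E0 : E 0 = 0.
  have e : `]0, 0]%classic = set0 :> set R by rewrite set_itv_ge// bnd_simp ltxx.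
  by rewrite /E e Rintegral_set0 addr0.
have := ac_ftc (ltW T0) ace; rewrite /= E0 mulr0 subr0 => eET.
have neg : expR (- K * T) * E T <= 0.
  rewrite -eET -oppr_ge0 -mulN1r -RintegralZl//; last exact: ace.1.
  apply: ae_Rintegral_ge0 => //.
    by have := @integrable_mulcl _ _ _ mu _ (measurable_itv _) (-1) _ ace.1.
  move: H (ae_neq T); apply: ae_imp2 => t Ht tT; rewrite /= in_itv /= => /andP[t0 tT'].
  have tin : t \in `]0, T[ by rewrite in_itv /= t0 lt_neqAle tT' andbT; exact/eqP.
  have := Ht tin; rewrite /E !add0r => FK.
  rewrite (_ : -1 * _ = expR (- K * t) * (K * \int[mu]_(s in `]0, t]) F s - F t)); last by ring.
  by rewrite mulr_ge0 ?expR_ge0// subr_ge0.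
have ET : \int[mu]_(s in `]0, T]) F s = 0.
  apply/eqP; rewrite eq_le Rintegral_ge0// andbT.
  by move: neg; rewrite pmulr_rle0 ?expR_gt0// /E add0r.
move: (Rintegral_ge0_eq0 (measurable_itv _) IF F0 ET); apply: ae_imp => t Ht tT.
by apply: Ht; apply: subset_itv_oo_oc.
Qed.

(** The derivative of (exp s - Th)^+ cubed is
    3 ((exp s - Th)^+)^2 (exp s s_t - V). The first term is nonpositive and
    is dropped, and there is no initial term. *)
Lemma chain_time T (s s1 Th V : R -> R) : 0 < T -> ac 0 T s s1 -> ac 0 T Th V ->
  {ae mu, forall t : R, `]0, T]%classic t -> s1 t <= 0} -> expR (s 0) <= Th 0 ->
  forall t, 0 <= t <= T -> pos (expR (s t) - Th t) ^+ 3 <=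
    - (3 * \int[mu]_(r in `]0, t]) (pos (expR (s r) - Th r) ^+ 2 * V r)).
Proof.
move=> T0 acs acT s10 h0 t t0T; have /andP[t0 tT] := t0T.
have sub : `]0, t] `<=` `]0, T] by apply: subset_itv; rewrite bnd_simp.
have acd := ac_subitv (ac_sub (ac_comp (ltW T0) acs (locally_C11_expR R)) acT) t0T.
have acJ := ac_comp t0 acd (locally_C11_pos_cube R).
have acq := ac_comp t0 acd (locally_C11_pos_sqr R).
have Iv := ac_bounded_mul_integrable t0 acq (ac_subitv acT t0T).1.
have := acJ.2 t; rewrite t0 lexx /= => /(_ isT) ->.
have -> : pos (expR (s 0) - Th 0) = 0.
  by rewrite pos_if subr_ge0; case: ifP => // h; apply/eqP; rewrite subr_eq0 eq_le h h0.
rewrite expr0n add0r /= -subr_ge0 -mulNr -RintegralZl// -RintegralB//; last 2 first.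
- have := @integrable_mulcl _ _ _ mu _ (measurable_itv _) (-3) _ Iv.
  by apply: eq_integrable.
- exact: acJ.1.
apply: ae_Rintegral_ge0 => //.
  apply: integrable_sub => //; last exact: acJ.1.
  exact: (@integrable_mulcl _ _ _ mu _ (measurable_itv _) (-3) _ Iv).
move: s10; apply: ae_imp => r hr /sub /hr s1r.
set P := pos _ ^+ 2; rewrite (_ : _ - _ = (3 * P * expR (s r)) * - s1 r); last by ring.
by rewrite mulr_ge0 ?oppr_ge0// mulr_ge0 ?expR_ge0// mulr_ge0// sqr_ge0.
Qed.

(** Integrating the first inequality over x and exchanging the integrals
    bounds the cubic energy by the time integral of the left-hand side of
    the slice inequality, and Gronwall's lemma applies. The exchange needs
    joint integrability of D^2 V; it comes from the bound B on the slices of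
    the positive part. *)
Lemma comparison a b T (B C : R) D V : a < b -> 0 < T -> 0 <= B ->
  measurable_fun setT D -> (mu \x mu)%E.-integrable setT (EFin \o V) ->
  {ae mu, forall x : R, `]a, b]%classic x -> forall t, t \in `]0, T[ ->
     pos (D (t, x)) ^+ 3 <= - (3 * \int[mu]_(s in `]0, t]) (pos (D (s, x)) ^+ 2 * V (s, x)))} ->
  {ae mu, forall t : R, t \in `]0, T[ ->
     {ae mu, forall x : R, `]a, b]%classic x -> pos (D (t, x)) <= B}} ->
  {ae mu, forall t : R, t \in `]0, T[ ->
     - (\int[mu]_(x in `]a, b]) (pos (D (t, x)) ^+ 2 * V (t, x))) <=
     C * \int[mu]_(x in `]a, b]) pos (D (t, x)) ^+ 3} ->
  {ae mu, forall t : R, t \in `]0, T[ ->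
     {ae mu, forall x : R, `]a, b]%classic x -> D (t, x) <= 0}}.
Proof.
move=> ab T0 B0 mD IV Htime Hbound Henergy.
(* cutting off to the rectangle makes the iterated integrals global *)
pose rect (z : RR) : R := \1_(`]0, T[) z.1 * \1_(`]a, b]) z.2.
have mrect : measurable_fun setT rect.
  by apply: measurable_funM; apply: measurableT_comp => //; exact: measurable_indic.
pose Q z := rect z * pos (D z).
have mpos : measurable_fun setT (@pos R).
  by apply: continuous_measurable_fun; exact: continuous_pos.
have mQ : measurable_fun setT Q.
  by apply: measurable_funM => //; exact: measurableT_comp.
have Q0 z : 0 <= Q z by rewrite mulr_ge0 ?pos_ge0// mulr_ge0.
have rE (t x : R) : t \in `]0, T[ -> `]a, b]%classic x -> rect (t, x) = 1.
  by move=> tT xab; rewrite /rect !indicE /= !mem_set// mulr1.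
have QE (t x : R) : t \in `]0, T[ -> `]a, b]%classic x -> Q (t, x) = pos (D (t, x)).
  by move=> tT xab; rewrite /Q rE// mul1r.
have r0 (t x : R) : (t \notin `]0, T[) \/ (x \notin `]a, b]) -> rect (t, x) = 0.
  by rewrite /rect !indicE /= !mem_setE => -[/negbTE ->|/negbTE ->];
    rewrite ?mul0r ?mulr0.
have rect01 z : rect z = 0 \/ rect z = 1.
  rewrite /rect !indicE; case: (_ \in _); case: (_ \in _);
    rewrite ?mul1r ?mul0r; by [left|right].
have QB : {ae mu, forall t : R, {ae mu, forall x : R, Q (t, x) <= B * rect (t, x)}}.
  move: Hbound; apply: ae_imp => t Ht; have [tT|tT] := boolP (t \in `]0, T[); last first.
    by apply: aeW => x; rewrite /Q r0 ?mul0r ?mulr0//; left.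
  move: (Ht tT); apply: ae_imp => x Hx; case: (boolP (x \in `]a, b])) => xab; last first.
    by rewrite /Q r0 ?mul0r ?mulr0//; right.
  by rewrite QE// rE// mulr1; exact: Hx.
have Irect : (mu \x mu)%E.-integrable setT (EFin \o rect).
  apply: (@integrable_extend _ RR R (mu \x mu)%E (`]0, T[ `*` `]a, b] : set RR)).
  - by apply: measurableX; exact: measurable_itv.
  - move=> [t x] /= H; apply: r0; apply/orP; rewrite -negb_and; apply/negP => /andP[h1 h2].
    by apply: H; split.
  - apply: measurable_bounded_integrable.
    + by apply: measurableX; exact: measurable_itv.
    + have := @product_measure1E _ _ (measurableTypeR R) (measurableTypeR R) R mu mu `]0, T[%classic `]a, b]%classic
        (measurable_itv _) (measurable_itv _).
      move=> /= E; apply: (le_lt_trans (y := (mu `]0%R, T[ * mu `]a, b])%E)); first by rewrite -E.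
      rewrite /= !lebesgue_measure_itv/= !lte_fin T0 ab -!EFinB -EFinM ltry//.
    + exact: measurable_funTS.
    + exists 1; split => // M M1 z _; apply: ltW; apply: le_lt_trans M1; rewrite /=.
      by case: (rect01 z) => ->; rewrite ?normr0 ?normr1.
have IQ3 : (mu \x mu)%E.-integrable setT (EFin \o (fun z => Q z ^+ 3)).
  apply: (@integrable_slicewise_le _ (fun z => B ^+ 3 * rect z)).
  - exact: measurable_funX.
  - by apply: integrable_mulcl.
  - move: QB; apply: ae_imp => t; apply: ae_imp => x h.
    rewrite !ger0_norm ?exprn_ge0//; last first.
      by rewrite mulr_ge0 ?exprn_ge0//; case: (rect01 (t, x)) => ->.
    apply: (@le_trans _ _ ((B * rect (t, x)) ^+ 3)).
      by apply: lerXn2r => //; rewrite nnegrE// (le_trans (Q0 (t, x)) h).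
    by case: (rect01 (t, x)) => ->; rewrite ?mulr0 ?expr0n// !mulr1.
have IQV : (mu \x mu)%E.-integrable setT (EFin \o (fun z => Q z ^+ 2 * V z)).
  apply: (@integrable_slicewise_le _ (fun z => B ^+ 2 * V z)).
  - apply: measurable_funM; first exact: measurable_funX.
    by case/integrableP : IV => /measurable_EFinP.
  - by apply: integrable_mulcl.
  - move: QB; apply: ae_imp => t; apply: ae_imp => x h.
    rewrite (normrM (Q (t, x) ^+ 2)) (normrM (B ^+ 2)) ler_wpM2r//.
    rewrite (ger0_norm (exprn_ge0 2 (Q0 (t, x)))) (ger0_norm (exprn_ge0 2 B0)).
    rewrite ler_pXn2r ?nnegrE//; apply: (le_trans h).
    by case: (rect01 (t, x)) => ->; rewrite ?mulr0 ?mulr1.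
pose F t := \int[mu]_(x in `]a, b]) Q (t, x) ^+ 3.
have F0 t : 0 <= F t by apply: Rintegral_ge0 => x _; rewrite exprn_ge0.
have [IF _ _] := RFubini_in IQ3 (measurable_itv `]0, T]) (measurable_itv `]a, b]).
have [slQ _] := ae_slice_integrable IQ3.
have sl t : mu.-integrable setT (EFin \o (fun x => Q (t, x) ^+ 3)) ->
    mu.-integrable `]a, b] (EFin \o (fun x => Q (t, x) ^+ 3)).
  exact: integrableS.
have F3 t : t \in `]0, T[ -> F t = \int[mu]_(x in `]a, b]) pos (D (t, x)) ^+ 3.
  by move=> tT; apply: eq_Rintegral => x /set_mem xab; rewrite QE.
have Fz : {ae mu, forall t : R, t \in `]0, T[ -> F t = 0}.
  apply: (@gronwall_zero T (3 * C)) => //.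
  move: slQ; apply: ae_imp => t /sl It tT.
  have [I1 I2 E] := RFubini_in IQV (measurable_itv `]0, t]) (measurable_itv `]a, b]).
  have tT' (s : R) : `]0, t]%classic s -> s \in `]0, T[.
    move: tT; rewrite !in_itv /= in_itv /= => /andP[_ tT] /andP[-> /=].
    by move=> /le_lt_trans; apply.
  apply: (@le_trans _ _ (- (3 * \int[mu]_(x in `]a, b]) (\int[mu]_(s in `]0, t]) (Q (s, x) ^+ 2 * V (s, x)))))).
    rewrite -mulNr -RintegralZl// -subr_ge0 -RintegralB//; last exact: integrable_mulcl.
    apply: ae_Rintegral_ge0 => //; first by apply: integrable_sub => //; exact: integrable_mulcl.
    move: Htime; apply: ae_imp => x Hx xab; rewrite subr_ge0 QE// mulNr.
    apply: (le_trans (Hx xab t tT)); rewrite lerN2 ler_pM2l//.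
    rewrite le_eqVlt; apply/orP; left; apply/eqP; apply: eq_Rintegral => s /set_mem sT.
    by rewrite QE//; exact: tT'.
  rewrite -E -mulrA -mulrN ler_pM2l// -RintegralZl//; last first.
    by apply: integrable_sub_itv IF => //; move: tT; rewrite in_itv /= => /andP[_ /ltW].
  rewrite -subr_ge0 opprK -RintegralD//; last first.
    apply: integrable_mulcl => //.
    by apply: integrable_sub_itv IF => //; move: tT; rewrite in_itv /= => /andP[_ /ltW].
  apply: ae_Rintegral_ge0 => //.
    apply: integrable_add => //; apply: integrable_mulcl => //.
    by apply: integrable_sub_itv IF => //; move: tT; rewrite in_itv /= => /andP[_ /ltW].
  move: Henergy; apply: ae_imp => s Hs /tT' sT.
  have := Hs sT; rewrite F3// -subr_ge0 opprK; congr (0 <= _ + _).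
  by apply: eq_Rintegral => x /set_mem xab; rewrite QE.
move: slQ Fz; apply: ae_imp2 => t /sl It Ft tT.
have Q30 x : 0 <= Q (t, x) ^+ 3 by rewrite exprn_ge0.
move: (Rintegral_ge0_eq0 (measurable_itv _) It Q30 (Ft tT)).
apply: ae_imp => x Hx xab; have := Hx xab; rewrite QE// => /eqP.
by rewrite expf_eq0 /= pos_if; case: ifP => [_ /eqP ->//|/negbT]; rewrite -ltNge => /ltW.
Qed.

End comparison.

(** * The barrier *)

Section barrier.
Variable R : realType.
Local Notation mu := (@lebesgue_measure R).
Local Notation RR := (measurableTypeR R * measurableTypeR R)%type.
Implicit Types (a b T m M c : R) (U V : RR -> R).

(** The exponent s of the barrier. It has s_t = - m (integral of U over
    ]a, x]) - M and, when v_0 + (integral of U over time) is the velocity v,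
    s_x = - m v. *)
Definition barrier a c m M (v0 : R -> R) U : RR -> R := fun z =>
  c - m * (\int[mu]_(y in `]a, z.2]) v0 y)
    - m * (\int[mu]_(s in `]0, z.1]) \int[mu]_(y in `]a, z.2]) U (s, y)) - M * z.1.

Lemma measurable_barrier a c m M (v0 : R -> R) U : measurable_fun setT v0 ->
  measurable_fun setT U -> measurable_fun setT (barrier a c m M v0 U).
Proof.
move=> mv mU; apply: measurable_funB; last first.
  by apply: measurable_funM => //.
apply: measurable_funB.
  apply: measurable_funB => //; apply: measurable_funM => //.
  have mv2 : measurable_fun setT (fun z : RR => v0 z.2) by exact: measurableT_comp.
  exact: (measurable_space_primitive a mv2).
apply: measurable_funM => //.
exact: (measurable_time_primitive (measurable_space_primitive a mU)).
Qed.

(** The hypothesis on M says that |m| times the L1 norm of the acceleration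
    is at most M, so s_t lies between - 2 M and 0. *)
Lemma barrier_time a b T c m M (v0 : R -> R) U x : 0 < T -> a < x <= b ->
  (mu \x mu)%E.-integrable setT (EFin \o U) ->
  {ae mu, forall s : R, `]0, T]%classic s ->
    `|m| * (\int[mu]_(y in `]a, b]) `|U (s, y)|) <= M} ->
  ac 0 T (fun t => barrier a c m M v0 U (t, x))
    (fun s => - m * (\int[mu]_(y in `]a, x]) U (s, y)) - M) /\
  {ae mu, forall s : R, `]0, T]%classic s ->
    - (2 * M) <= - m * (\int[mu]_(y in `]a, x]) U (s, y)) - M <= 0}.
Proof.
have aux (u : R) : - M <= u <= M -> - (2 * M) <= - u - M <= 0.
  by move=> /andP[h1 h2]; apply/andP; split; lra.
move=> T0 /andP[ax xb] IU HM; split.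
  have [IS _ _] := RFubini_in IU (measurable_itv `]0, T]) (measurable_itv `]a, x]).
  have := ac_sub (ac_add (ac_cst 0 T (c - m * (\int[mu]_(y in `]a, x]) v0 y)))
    (ac_scale (- m) (ac_integral 0 IS))) (ac_linear M (ltW T0)).
  by move=> h; apply: ac_ext h _ _ => t _; rewrite /barrier /=; ring.
have [slU _] := ae_slice_integrable IU.
move: slU HM; apply: ae_imp2 => s Is Hs sT.
have I1 : mu.-integrable `]a, b] (EFin \o (fun y => U (s, y))) by exact: integrableS Is.
have I2 := integrable_sub_itv (lexx a) xb I1.
have : `|m * (\int[mu]_(y in `]a, x]) U (s, y))| <= M.
  rewrite normrM; apply: le_trans (Hs sT); apply: ler_wpM2l => //.
  apply: (le_trans (le_normr_Rintegral _ I2)) => //.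
  have In := integrable_normr (measurable_itv _) I1.
  by rewrite (Rintegral_cat (ltW ax) xb (lexx b) In) lerDl Rintegral_ge0.
by rewrite ler_norml mulNr => /aux.
Qed.

Lemma Rintegral_itv_bounds T (t lo hi : R) (g : R -> R) : 0 <= t <= T ->
  mu.-integrable `]0, T] (EFin \o g) ->
  {ae mu, forall s : R, `]0, T]%classic s -> lo <= g s <= hi} ->
  lo * t <= \int[mu]_(s in `]0, t]) g s <= hi * t.
Proof.
move=> /andP[t0 tT] Ig H.
have sub : `]0, t] `<=` `]0, T] by apply: subset_itv; rewrite bnd_simp.
have Igt := integrable_sub_itv (lexx 0) tT Ig.
have acl k := ac_linear k t0.
have el k : \int[mu]_(s in `]0, t]) cst k s = k * t.
  by rewrite (ac_ftc t0 (acl k)) mulr0 subr0.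
rewrite -!el; apply/andP; split; rewrite -subr_ge0 -RintegralB//;
  try exact: (acl _).1; apply: ae_Rintegral_ge0 => //;
  try (by apply: integrable_sub => //; exact: (acl _).1);
  move: H; apply: ae_imp => s Hs /sub /Hs /andP[h1 h2]; by rewrite subr_ge0.
Qed.

Lemma barrier_bounds a b T c m M (v0 : R -> R) U x (t : R) : 0 < T -> a < x <= b ->
  (mu \x mu)%E.-integrable setT (EFin \o U) ->
  mu.-integrable `]a, b] (EFin \o v0) ->
  {ae mu, forall s : R, `]0, T]%classic s ->
    `|m| * (\int[mu]_(y in `]a, b]) `|U (s, y)|) <= M} -> 0 <= t <= T -> 0 <= M ->
  c - `|m| * (\int[mu]_(y in `]a, b]) `|v0 y|) - 2 * M * T <= barrier a c m M v0 U (t, x) <=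
  c + `|m| * (\int[mu]_(y in `]a, b]) `|v0 y|).
Proof.
(* the inequalities are isolated from the integrals that are substituted for
   the variables *)
have aux (u N I B B' : R) : - N <= u <= N -> - B' <= I <= 0 -> B' <= B ->
    c - N - B <= c - u + I <= c + N.
  by move=> /andP[h1 h2] /andP[h3 h4] h5; apply/andP; split; lra.
move=> T0 /andP[ax xb] IU Iv HM /andP[t0 tT] M0.
have axb : a < x <= b by rewrite ax.
have [acx sx] := barrier_time c v0 T0 axb IU HM.
have t0T : 0 <= t <= T by rewrite t0.
have := acx.2 t t0T; set I := (X in _ = _ + X) => E.
have := Rintegral_itv_bounds t0T acx.1 sx; rewrite -/I mul0r => /andP[Il Ih].
have Z0 : barrier a c m M v0 U (0, x) = c - m * (\int[mu]_(y in `]a, x]) v0 y).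
  have e : `]0, 0]%classic = set0 :> set R by rewrite set_itv_ge// bnd_simp ltxx.
  by rewrite /barrier /= e Rintegral_set0; ring.
have : `|m * (\int[mu]_(y in `]a, x]) v0 y)| <= `|m| * (\int[mu]_(y in `]a, b]) `|v0 y|).
  rewrite normrM; apply: ler_wpM2l => //.
  have I2 := integrable_sub_itv (lexx a) xb Iv.
  apply: (le_trans (le_normr_Rintegral _ I2)) => //.
  have In := integrable_normr (measurable_itv _) Iv.
  by rewrite (Rintegral_cat (ltW ax) xb (lexx b) In) lerDl Rintegral_ge0.
rewrite ler_norml E Z0 => hu; apply: (aux _ _ _ _ (2 * M * t)) hu _ _.
  by rewrite -mulNr Il.
by rewrite ler_wpM2l// mulr_ge0.
Qed.

(** Exchanging the order of integration in time and space exhibits s(t,.) as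
    a primitive in x. *)
Lemma barrier_space a b T c m M (v0 p : R -> R) U (t : R) : a < b -> 0 < t < T ->
  (mu \x mu)%E.-integrable setT (EFin \o U) ->
  mu.-integrable `]a, b] (EFin \o v0) -> measurable_fun `]a, b] p ->
  ae_eq mu `]a, b]%classic (fun x => - m * (v0 x + \int[mu]_(s in `]0, t]) U (s, x))) p ->
  ac a b (fun x => barrier a c m M v0 U (t, x)) p.
Proof.
move=> ab /andP[t0 tT] IU Iv mp Hp.
have [_ IS _] := RFubini_in IU (measurable_itv `]0, t]) (measurable_itv `]a, b]).
have Isum : mu.-integrable `]a, b]
    (EFin \o (fun x => v0 x + \int[mu]_(s in `]0, t]) U (s, x))).
  exact: integrable_add.
have acI := ac_scale (- m) (ac_integral 0 Isum).
have := ac_add (ac_cst a b (c - M * t)) acI.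
move=> h; apply: ac_ae h _ mp _; last first.
  by move: Hp; apply: ae_imp => x hx xab; rewrite /= add0r hx.
move=> x /andP[ax xb].
have [_ _ E] := RFubini_in IU (measurable_itv `]0, t]) (measurable_itv `]a, x]).
rewrite /barrier /= E add0r RintegralD//; first by ring.
- exact: integrable_sub_itv (lexx a) xb Iv.
- exact: integrable_sub_itv (lexx a) xb IS.
Qed.

End barrier.

(** * Application to a solution *)

Section slices.
Variable R : realType.
Local Notation mu := (@lebesgue_measure R).
Implicit Types (a b m : R) (f g : R -> R).

(** The derivative in H^1 is only known to exist; a given weak derivative
    agrees with it almost everywhere. *)
Lemma Hk1_wderiv_integrable a b f g : Hk 1 a b f -> is_wderiv a b f g ->
  mu.-integrable `]a, b] (EFin \o g).
Proof.
move=> [_ [g0 w0 L2g0]] w; have [_ [mg _ _] _] := w.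
apply: (@integrable_itv_bnd _ false true false false).
have I0 := integrable_ab (L2_integrable L2g0).
exact: ae_eq_integrable (wderiv_unique w0 w) I0.
Qed.

(** The entropy equation says that theta_x has the weak derivative
    theta_t - m v_x theta, with no flux through the end points. The test
    functions used form a countable family, so that a single null set of
    times is excluded. *)
Lemma entropy_slice a b m (th thr tht thx utx : R -> R) : a < b ->
  ac a b thr thx -> ae_eq mu `]a, b[%classic th thr -> measurable_fun `]a, b[ th ->
  mu.-integrable `]a, b] (EFin \o tht) -> mu.-integrable `]a, b] (EFin \o utx) ->
  (forall psi, psi = cst 1 \/ (exists p q n, psi = ramp p q n) ->
    (\int[mu]_(x in `]a, b[) (tht x * psi x)) +
    (\int[mu]_(x in `]a, b[) (thx x * derive1 psi x)) =
    m * (\int[mu]_(x in `]a, b[) (th x * utx x * psi x))) ->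
  exists G, [/\ ac a b thr G, ac a b G (fun x => tht x + (- m * utx x) * thr x),
    G a = 0 & G b = 0].
Proof.
move=> ab acth thE mth It Iu H.
set g := fun x => tht x + (- m * utx x) * thr x.
have Itu := ac_bounded_mul_integrable (ltW ab) acth Iu.
have Ig : mu.-integrable `]a, b] (EFin \o g).
  apply: integrable_add => //.
  have := @integrable_mulcl _ _ _ mu _ (measurable_itv _) (- m) _ Itu.
  by apply: eq_integrable => // x _ /=; congr EFin; ring.
have key (psi psi' : R -> R) : ac a b psi psi' ->
    (\int[mu]_(x in `]a, b[) (tht x * psi x)) +
    (\int[mu]_(x in `]a, b[) (thx x * psi' x)) =
    m * (\int[mu]_(x in `]a, b[) (th x * utx x * psi x)) ->
    \int[mu]_(x in `]a, b[) (g x * psi x) + \int[mu]_(x in `]a, b[) (thx x * psi' x) = 0.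
  move=> acp.
  have I1 : mu.-integrable `]a, b[ (EFin \o (fun x => tht x * psi x)).
    have := integrable_ab (ac_bounded_mul_integrable (ltW ab) acp It).
    by apply: eq_integrable => // x _ /=; rewrite mulrC.
  have I2 : mu.-integrable `]a, b[ (EFin \o (fun x => thr x * utx x * psi x)).
    have := integrable_ab (ac_bounded_mul_integrable (ltW ab) acp Itu).
    by apply: eq_integrable => // x _ /=; rewrite mulrC.
  have mutx : measurable_fun `]a, b[ utx by exact: integrable_measurable (integrable_ab Iu).
  have mpsi : measurable_fun `]a, b[ psi.
    apply: (@measurable_funS _ _ _ _ `]a, b]) => //; first exact: subset_itv_oo_oc.
    exact: ac_measurable (ltW ab) acp.
  have e : \int[mu]_(x in `]a, b[) (th x * utx x * psi x) =
      \int[mu]_(x in `]a, b[) (thr x * utx x * psi x).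
    apply: ae_eq_Rintegral => //.
    - by apply: measurable_funM => //; exact: measurable_funM.
    - exact: integrable_measurable I2.
    - by move: thE; apply: ae_imp => x hx xab; rewrite hx.
  rewrite e => E.
  have -> : \int[mu]_(x in `]a, b[) (g x * psi x) =
     \int[mu]_(x in `]a, b[) (tht x * psi x) - m * \int[mu]_(x in `]a, b[) (thr x * utx x * psi x).
    rewrite -RintegralZl// -RintegralB//; last exact: integrable_mulcl.
    by apply: eq_Rintegral => x _; rewrite /g; ring.
  by rewrite -E; ring.
have Ix := acth.1.
have h1 : \int[mu]_(x in `]a, b[) g x = 0.
  have := key (cst 1) (cst 0) (ac_cst a b 1).
  have := H (cst 1) (or_introl erefl).
  have -> : derive1 (cst 1 : R -> R) = cst 0 by apply/funext => x; rewrite derive1_cst.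
  move=> e /(_ e); rewrite [X in _ + X](@eq_Rintegral _ _ _ mu _ (cst 0)); last first.
    by move=> x _; rewrite /= mulr0.
  rewrite Rintegral_cst// mul0r addr0 => <-.
  by apply: eq_Rintegral => x _; rewrite /= mulr1.
have [|G [acG xG Ga Gb]] := neumann_representation ab Ix Ig h1.
  move=> p q n; apply: key; first exact: ac_ramp.
  by rewrite -derive1_ramp; apply: H; right; exists p, q, n.
exists G; split => //.
apply: ac_ae acth _ (ac_measurable (ltW ab) acG) _ => //.
exact: ae_eq_oo_oc.
Qed.

(** The energy estimate for almost all times, with the temperature and its
    time derivative replaced by arbitrary functions that agree with them
    almost everywhere. The freedom is used to insert the representatives
    that are absolutely continuous in time; the constant depends on the
    interval only. *)
Lemma slice_comparison a b : a < b -> exists2 C : R, 0 <= C &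
  forall m (th tht thx v vx s Th V : R -> R) (B1 B2 : R),
  Hk 1 a b th -> is_wderiv a b th thx -> H10 a b v -> is_wderiv a b v vx ->
  L2 a b tht -> (fnorm (H10 a b) v <= B1%:E)%E -> (fnorm (Hk 1 a b) th <= B2%:E)%E ->
  (forall psi, psi = cst 1 \/ (exists p q n, psi = ramp p q n) ->
    (\int[mu]_(x in `]a, b[) (tht x * psi x)) +
    (\int[mu]_(x in `]a, b[) (thx x * derive1 psi x)) =
    m * (\int[mu]_(x in `]a, b[) (th x * vx x * psi x))) ->
  (forall p : R -> R, measurable_fun `]a, b] p ->
    ae_eq mu `]a, b]%classic (fun x => - m * v x) p -> ac a b s p) ->
  measurable_fun `]a, b] Th -> measurable_fun `]a, b] V ->
  ae_eq mu `]a, b]%classic th Th -> ae_eq mu `]a, b]%classic tht V ->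
  {ae mu, forall x : R, `]a, b]%classic x -> `|Th x| <= C * B2} /\
  - (\int[mu]_(x in `]a, b]) (pos (expR (s x) - Th x) ^+ 2 * V x)) <=
  9 / 8 * (`|m| * (C * B1)) ^+ 2 * \int[mu]_(x in `]a, b]) (pos (expR (s x) - Th x) ^+ 3).
Proof.
move=> ab; have [C C0 HC] := H1_sup ab; exists C => //.
move=> m th tht thx v vx s Th V B1 B2 Hth wth Hv wv Ltht nv nth ent acs mTh mV thE thtE.
have Ith := L2_integrable Hth.1.
have Ithx := Hk1_wderiv_integrable Hth wth.
have Iv := L2_integrable Hv.1.1.
have Ivx := Hk1_wderiv_integrable Hv.1 wv.
have Itht := L2_integrable Ltht.
have [_ [thr [acth thrE thrB]]] := HC _ _ Ith Ithx wth.
have [vxB _] := HC _ _ Iv Ivx wv.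
have [F [acF vF Fa Fb]] := H10_trace ab Hv wv Ivx.
have [G [acthG acG Ga Gb]] :=
  entropy_slice ab acth thrE (integrable_measurable (integrable_ab Ith)) Itht Ivx ent.
have fin (r B : R) (N : \bar R) : (r%:E <= C%:E * N)%E -> (N <= B%:E)%E -> r <= C * B.
  move=> h1 h2; rewrite -lee_fin EFinM; apply: (le_trans h1).
  by apply: lee_wpmul2l; rewrite ?lee_fin.
have acp := ac_scale (- m) acF.
have pB x : a < x <= b -> `|- m * F x| <= `|m| * (C * B1).
  move=> /andP[ax xb]; rewrite normrM normrN ler_wpM2l//.
  have axb : a <= x <= b by rewrite xb ltW.
  apply: (le_trans (ac_bounded acF axb)); rewrite Fa normr0 add0r.
  exact: fin vxB nv.
have acs' : ac a b s (fun x => - m * F x).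
  apply: acs; first exact: ac_measurable (ltW ab) acp.
  by move: (ae_eq_oo_oc vF); apply: ae_imp => x h xab; rewrite h.
have pa : - m * F a = 0 by rewrite Fa mulr0.
have pb : - m * F b = 0 by rewrite Fb mulr0.
have teq : ae_eq mu `]a, b]%classic tht
    (fun x => tht x + (- m * vx x) * thr x - (- m * vx x) * thr x).
  by apply: aeW => x _; rewrite addrK.
have := slice_energy ab acthG acG Ga Gb acp pa pb acs' Itht teq pB.
have thrTh : {ae mu, forall x : R, `]a, b]%classic x -> thr x = Th x}.
  move: (ae_eq_oo_oc thrE) thE; apply: ae_imp2 => x h1 h2 xab.
  by rewrite -(h1 xab) (h2 xab).
have ms : measurable_fun `]a, b] s by exact: ac_measurable (ltW ab) acs'.
have mthr : measurable_fun `]a, b] thr by exact: ac_measurable (ltW ab) acth.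
have mtht : measurable_fun `]a, b] tht by exact: integrable_measurable Itht.
have mk (h : R -> R) n : measurable_fun `]a, b] h ->
    measurable_fun `]a, b] (fun x => pos (expR (s x) - h x) ^+ n).
  move=> mh; apply: measurable_funX.
  have mpos : measurable_fun setT (@pos R).
    by apply: continuous_measurable_fun; exact: continuous_pos.
  apply: (measurableT_comp mpos); apply: measurable_funB => //.
  exact: measurableT_comp.
move=> E; split.
  move: thrTh; apply: ae_imp => x h /[dup] xab; rewrite -h//= in_itv /= => /andP[ax xb].
  by apply: fin nth; apply: thrB; rewrite xb ltW.
have <- : \int[mu]_(x in `]a, b]) (pos (expR (s x) - thr x) ^+ 2 * tht x) =
    \int[mu]_(x in `]a, b]) (pos (expR (s x) - Th x) ^+ 2 * V x).
  apply: ae_eq_Rintegral => //.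
  - by apply: measurable_funM => //; exact: mk.
  - by apply: measurable_funM => //; exact: mk.
  - by move: thrTh thtE; apply: ae_imp2 => x h1 h2 xab; rewrite h1// h2.
have <- : \int[mu]_(x in `]a, b]) (pos (expR (s x) - thr x) ^+ 3) =
    \int[mu]_(x in `]a, b]) (pos (expR (s x) - Th x) ^+ 3).
  apply: ae_eq_Rintegral => //; try exact: mk.
  by move: thrTh; apply: ae_imp => x h1 xab; rewrite h1.
exact: E.
Qed.

End slices.

Section temperature.
Variable R : realType.
Local Notation mu := (@lebesgue_measure R).
Local Notation RR := (measurableTypeR R * measurableTypeR R)%type.

(** The barrier starts from k0 = ln c0 - |m| (L1 norm of v_0), where c0 is
    the positive lower bound of th_0, so that it lies below th_0 at time 0.
    The comparison is between the barrier and the representative Th of the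
    temperature that is absolutely continuous in time; the bound for Th
    carries over to th on almost all slices and then on the rectangle. *)
Lemma temperature_lower_bound (a b T m : R) (u0 v0 th0 : R -> R)
    (u ut utt ux uxx utx th tht thx : R -> R -> R) : a < b -> 0 < T ->
  solves a b T m u0 v0 th0 u ut utt ux uxx utx th tht thx ->
  exists c : R, 0 < c /\ ae_rect `[0, T] `[a, b] (fun t x => c <= th t x).
Proof.
move=> ab T0 [_ hv0 hth0 [c0 c00 th0c] [_ mut mutt] [_ _ mutx] [mth mtht mthx]
  _ [_ Lut10 _] [_ [Lut Lutt dut]] LthH1 [Lth Ltht dth] _ _ dutx dthx _ ent _ attut attth].
have IU := LXy_integrable mutt Lutt.
have IV := LX2_integrable mtht Ltht.
have Iut := LXy_integrable mut Lut.
have Ith := LX2_integrable mth Lth.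
set U := cutoff a b T utt in IU *; set V := cutoff a b T tht in IV *.
have mU : measurable_fun setT U by exact: measurable_cutoff.
have mV : measurable_fun setT V by exact: measurable_cutoff.
have Iv0 := L2_integrable hv0.1.1.
have Ith0 := L2_integrable hth0.1.
(* the data are cut off in order to be measurable on the whole line *)
pose w := v0 \_ `]a, b]; pose q := th0 \_ `]a, b].
have mw : measurable_fun setT w.
  apply: (proj1 (measurable_restrictT _ _)) => //; exact: integrable_measurable Iv0.
have mq : measurable_fun setT q.
  apply: (proj1 (measurable_restrictT _ _)) => //; exact: integrable_measurable Ith0.
have wE x : `]a, b]%classic x -> w x = v0 x by move=> h; rewrite /w patchE mem_set.
have qE x : `]a, b]%classic x -> q x = th0 x by move=> h; rewrite /q patchE mem_set.
have Iw : mu.-integrable `]a, b] (EFin \o w).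
  by apply: eq_integrable Iv0 => // x /set_mem xab; rewrite /= wE.
have [K K0 HK] := L1_le_L2 a b.
have [Bu Bu0 HBu] := LXy_bound Lutt.
pose M := `|m| * (K * Bu).
have M0 : 0 <= M by rewrite !mulr_ge0.
have oo_of_oc (s : R) : `]0, T]%classic s -> s <> T -> s \in `]0, T[.
  rewrite /= !in_itv /= => /andP[-> sT] /eqP nT; by rewrite lt_neqAle nT.
have HM : {ae mu, forall s : R, `]0, T]%classic s ->
    `|m| * (\int[mu]_(y in `]a, b]) `|U (s, y)|) <= M}.
  move: (ae_and HBu (LX_ae_mem Lutt)) (ae_neq T).
  apply: ae_imp2 => s [Hs Ls] nT sT; have sin := oo_of_oc s sT nT.
  have Is := integrable_ab (L2_integrable (Ls sin)).
  apply: ler_wpM2l => //.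
  have UE y : `]a, b[%classic y -> `|U (s, y)| = `|utt s y|.
    by move=> yab; rewrite /U cutoffE.
  have IUs : mu.-integrable `]a, b[ (EFin \o (fun y => `|U (s, y)|)).
    apply: eq_integrable (integrable_normr (measurable_itv _) Is) => //.
    by move=> y /set_mem yab; rewrite /= UE.
  rewrite -Rintegral_oo_oc; last exact: (@integrable_itv_bnd _ false true false false).
  rewrite (@eq_Rintegral _ _ _ mu _ (fun y => `|utt s y|)); last first.
    by move=> y /set_mem; exact: UE.
  rewrite -lee_fin -integral_EFin_norm//.
  apply: (le_trans (HK _ (measurable_slice mutt sin))).
  by rewrite EFinM; apply: lee_wpmul2l; [rewrite lee_fin|exact: Hs].
pose k0 := ln c0 - `|m| * \int[mu]_(x in `]a, b]) `|w x|.
pose sg := barrier a k0 m M w U.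
pose Th (z : RR) := q z.2 + \int[mu]_(s in `]0, z.1]) V (s, z.2).
have ThE (t x : R) : t \in `]0, T[ -> `]a, b[%classic x ->
    Th (t, x) = th0 x + \int[mu]_(s in `]0, t]) tht s x.
  move=> tT xab; rewrite /Th /= qE; last exact: subset_itv_oo_oc xab.
  congr (_ + _); apply: eq_Rintegral => s /set_mem sT; rewrite /V cutoffE//.
  move: sT tT; rewrite /= !in_itv /= => /andP[-> /= st] /andP[_].
  exact: le_lt_trans.
pose D (z : RR) := expR (sg z) - Th z.
have mTh : measurable_fun setT Th.
  apply: measurable_funD; first exact: measurableT_comp.
  exact: measurable_time_primitive.
have mD : measurable_fun setT D.
  apply: measurable_funB => //.
  by apply: measurableT_comp => //; exact: measurable_barrier.
pose lo := k0 - `|m| * (\int[mu]_(y in `]a, b]) `|w y|) - 2 * M * T.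
have sgb x t : `]a, b]%classic x -> 0 <= t <= T -> lo <= sg (t, x) <= ln c0.
  rewrite /= in_itv /= => xab tT.
  have := barrier_bounds k0 T0 xab IU Iw HM tT M0.
  by rewrite -[k0 + _]/(ln c0 - _ + _) subrK.
have e00 : `]0, 0]%classic = set0 :> set R by rewrite set_itv_ge// bnd_simp ltxx.
have Htime : {ae mu, forall x : R, `]a, b]%classic x -> forall t, t \in `]0, T[ ->
     pos (D (t, x)) ^+ 3 <= - (3 * \int[mu]_(s in `]0, t]) (pos (D (s, x)) ^+ 2 * V (s, x)))}.
  have [_ slV] := ae_slice_integrable IV.
  move: slV; apply: ae_imp => x IVx xab t tT.
  have xab' : a < x <= b by move: xab; rewrite /= in_itv.
  have [acs s1] := barrier_time k0 w T0 xab' IU HM.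
  have IVx' : mu.-integrable `]0, T] (EFin \o (fun s => V (s, x))) by exact: integrableS IVx.
  apply: (chain_time T0 acs (ac_integral (q x) IVx')).
  - by move: s1; apply: ae_imp => s h /h /andP[].
  - rewrite e00 Rintegral_set0 addr0 qE//.
    apply: (@le_trans _ _ c0); last first.
      by apply: th0c; rewrite in_itv /=; case/andP: xab' => /ltW -> ->.
    rewrite -[leRHS]lnK ?posrE// ler_expR.
    have t00 : (0 : R) <= 0 <= T by apply/andP; split => //; exact: ltW.
    by case/andP: (sgb x 0 xab t00).
  - by move: tT; rewrite in_itv /= => /andP[t0 tT]; rewrite !ltW.
have [C C0 HC] := slice_comparison ab.
have [B1 B10 HB1] := LXy_bound Lut10.
have [B2 B20 HB2] := LXy_bound LthH1.
have repth := time_representation Ith IV (LX_ae_mem Lth) (LX_ae_mem Ltht) T0 dth attth Ith0.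
have reput := time_representation Iut IU (LX_ae_mem Lut) (LX_ae_mem Lutt) T0 dut attut Iv0.
have entall : {ae mu, forall t : R, t \in `]0, T[ ->
    forall psi, psi = cst 1 \/ (exists p q n, psi = ramp p q n) ->
    (\int[mu]_(x in `]a, b[) (tht t x * psi x)) +
    (\int[mu]_(x in `]a, b[) (thx t x * derive1 psi x)) =
    m * (\int[mu]_(x in `]a, b[) (th t x * utx t x * psi x))}.
  (* constants give the mean value of the flux derivative, ramps its
     distributional form *)
  have h1 := ent (cst 1) (@smooth_cst R 1).
  have := ae_forall_count (fun pqn : rat * rat * nat =>
    ent (ramp pqn.1.1 pqn.1.2 pqn.2) (@smooth_ramp R pqn.1.1 pqn.1.2 pqn.2)).
  move: h1; apply: ae_imp2 => t h1 h2 tT psi [->|[p [r [n ->]]]]; first exact: h1.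
  exact: (h2 (p, r, n)).
have Hslice : {ae mu, forall t : R, t \in `]0, T[ ->
    {ae mu, forall x : R, `]a, b]%classic x -> `|Th (t, x)| <= C * B2} /\
    - (\int[mu]_(x in `]a, b]) (pos (D (t, x)) ^+ 2 * V (t, x))) <=
    9 / 8 * (`|m| * (C * B1)) ^+ 2 * \int[mu]_(x in `]a, b]) (pos (D (t, x)) ^+ 3)}.
  have := ae_and entall (ae_and repth reput).
  have := ae_and (LX_ae_mem LthH1) (ae_and
     (LX_ae_mem Lut10) (LX_ae_mem Ltht)).
  have := ae_and (ae_and HB1 HB2)
    (ae_and dutx dthx).
  move=> h1 h2 h3; move: h1 (ae_and h2 h3).
  apply: ae_imp2 => t [[b1 b2] [d1 d2]] [[m1 [m2 m3]] [en [rth rut]]] tT.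
  have tT' : 0 < t < T by move: tT; rewrite in_itv.
  have sub (s : R) : `]0, t]%classic s -> s \in `]0, T[.
    rewrite /= !in_itv /= => /andP[-> /= st]; rewrite (le_lt_trans st)//.
    by case/andP: tT'.
  have VE : ae_eq mu `]a, b]%classic (tht t) (fun x => V (t, x)).
    by apply: ae_eq_oo_oc; apply: aeW => x xab; rewrite /V cutoffE.
  apply: (HC m (th t) (tht t) (thx t) (ut t) (utx t) (fun x => sg (t, x))
    (fun x => Th (t, x)) (fun x => V (t, x)) B1 B2 (m1 tT) (d2 tT) (m2 tT) (d1 tT)
    (m3 tT) (b1 tT) (b2 tT) (en tT)) => //.
  - move=> p mp Hp; apply: (@barrier_space _ a b T) => //.
    move: (ae_and Hp (ae_eq_oo_oc (rut tT))) (ae_neq b).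
    apply: ae_imp2 => x [px utE] nb xab; rewrite -(px xab) (utE xab) wE//; congr (_ * (_ + _)).
    have xab' : x \in `]a, b[.
      by move: xab; rewrite /= !in_itv /= => /andP[-> xb]; rewrite lt_neqAle xb andbT; exact/eqP.
    by apply: eq_Rintegral => s /set_mem /sub sT; rewrite /U cutoffE.
  - by apply: measurable_funTS; apply: (measurableT_comp mTh).
  - by apply: measurable_funTS; apply: (measurableT_comp mV).
  - apply: ae_eq_oo_oc; move: (rth tT); apply: ae_imp => x h xab.
    by rewrite h//= -ThE.
have Dle : {ae mu, forall t : R, t \in `]0, T[ ->
     {ae mu, forall x : R, `]a, b]%classic x -> D (t, x) <= 0}}.
  apply: (@comparison _ a b T (c0 + C * B2) (9 / 8 * (`|m| * (C * B1)) ^+ 2) D V) => //.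
  - by rewrite addr_ge0 ?mulr_ge0// ltW.
  - move: Hslice; apply: ae_imp => t Ht tT; have [HB _] := Ht tT.
    move: HB; apply: ae_imp => x hx xab.
    have t0T : 0 <= t <= T by move: tT; rewrite in_itv /= => /andP[h1 h2]; rewrite !ltW.
    have /andP[_ h1] := sgb x t xab t0T.
    rewrite /pos ge_max; apply/andP; split; last by rewrite addr_ge0 ?mulr_ge0// ltW.
    apply: lerD.
      by rewrite -[leRHS]lnK ?posrE// ler_expR.
    by apply: le_trans (hx xab); rewrite -normrN ler_norm.
  - by move: Hslice; apply: ae_imp => t Ht /Ht[].
exists (expR lo); split; first exact: expR_gt0.
apply: ae_rect_slices => //.
move: Dle repth; apply: ae_imp2 => t h1 h2 tT.
move: (h1 tT) (h2 tT); apply: ae_imp2 => x d1 d2 xab.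
have xab' : `]a, b]%classic x by exact: subset_itv_oo_oc xab.
have t0T : 0 <= t <= T by move: tT; rewrite in_itv /= => /andP[l1 l2]; rewrite !ltW.
have /andP[l1 _] := sgb x t xab' t0T.
apply: (@le_trans _ _ (expR (sg (t, x)))); first by rewrite ler_expR.
by rewrite d2//= -ThE// -subr_le0; exact: d1.
Qed.

End temperature.

Theorem theorem4p6 (R : realType) (a b T mu : R) (u0 v0 th0 : R -> R)
    (u th : R -> R -> R) (hab : a < b) (hT : 0 < T)
    (hsol : is_solution a b T mu u0 v0 th0 u th) :
  exists c : R, 0 < c /\ ae_rect `[0, T] `[a, b] (fun t x => c <= th t x).
Proof.
have [ut [utt [ux [uxx [utx [tht [thx sol]]]]]]] := hsol.
exact: temperature_lower_bound sol.
Qed.
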